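(* For any $e \in \{4, 5, \ldots, 130\}$ and any integer $n \ge b_e$, we have: (i) if $b_e \le n < \omega_e$, then $\mathcal{D}_{n,e}$ is the unique graph (up to isomorphism) attaining the maximum spectral radius on $\mathcal{C}_{n,e}$; (ii) if $n = \omega_e$, then $\mathcal{D}_{n,e}$ and $\mathcal{V}_{n,e}$ are the only two graphs (up to isomorphism) attaining the maximum spectral radius on $\mathcal{C}_{n,e}$; (iii) if $n > \omega_e$, then $\mathcal{V}_{n,e}$ is the unique graph (up to isomorphism) attaining the maximum spectral radius on $\mathcal{C}_{n,e}$.
   Context: All graphs are undirected, finite and simple. The spectral radius $\rho(G)$ of a graph $G$ is the largest modulus of an eigenvalue of its adjacency matrix. $G_1 \lor G_2$ and $G_1 + G_2$ denote the join and the disjoint union of graphs; $K_0$ (and $0K_1$) is the empty graph on no vertices, which is neutral for both operations. $\mathcal{C}_{n,e}$ is the set of connected graphs with $n$ vertices and $n-1+e$ edges. For an integer $e \ge 1$, let $k_e$ be the largest natural number with $\binom{k_e}{2} \le e$, and let $t_e = e - \binom{k_e}{2}$ (so $0 \le t_e \le k_e - 1$). Let $b_e = k_e + 1$ if $t_e = 0$, and $b_e = k_e + 2$ if $t_e \ne 0$; a graph in $\mathcal{C}_{n,e}$ exists if and only if $n \ge b_e$. For $n \ge b_e$, the graph $\mathcal{D}_{n,e} \in \mathcal{C}_{n,e}$ is $$\mathcal{D}_{n,e} = \big( ( (K_{k_e - t_e} + K_1) \lor K_{t_e} ) + (n - k_e - 2) K_1 \big) \lor K_1 \quad \text{if } n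 \ge k_e + 2, \qquad \mathcal{D}_{n,e} = K_n \quad \text{if } n < k_e + 2.$$ For $n \ge e+2$, the graph $\mathcal{V}_{n,e} \in \mathcal{C}_{n,e}$ is $\mathcal{V}_{n,e} = (K_{1,e} + (n-e-2)K_1) \lor K_1$. For $e \ge 4$, writing $k = k_e$, $t = t_e$, define the polynomial \begin{align*} \Psi_e(\lambda) &= \lambda^3 (k-1)(k-2)(k^2-3k+4t)\\ &\quad - \lambda^2 \big(k^5 - 6k^4 + k^3(4t+15) - k^2(20t+18) + k(8t^2+24t+8) - (4t^2+12t)\big)\\ &\quad - \lambda (k^2-k+2t)\big(k^3 + k^2(t-4) - k(3t-5) + (4t^2-2t-2)\big)\\ &\quad + t(k-t-1)(k^2-3k+2t)(k^2-k+2t), \end{align*} let $\psi_e$ be the largest real root of $\Psi_e$ (it exists), and let $$\omega_e = e + 2 + \frac{\psi_e(\psi_e+1)(\psi_e^2-\psi_e-2e)}{\psi_e^2-e},$$ which is well defined and satisfies $\omega_e > e+2$. *)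

(* Defs.v *)
From HB Require Import structures.
From mathcomp Require Import all_boot all_order all_algebra.
From mathcomp Require Import boolp classical_sets reals.
From mathcomp Require Import complex.

Set Implicit Arguments.
Unset Strict Implicit.
Unset Printing Implicit Defensive.

Import Order.TTheory GRing.Theory Num.Theory.

Record sgraph := SGraph {
  vertex :> finType;
  edge : rel vertex;
  edge_sym : symmetric edge;
  edge_irrefl : irreflexive edge
}.

Definition edge_set (G : sgraph) : {set {set G}} :=
  [set [set p.1; p.2] | p : G * G & edge p.1 p.2]%SET.

Definition connected (G : sgraph) : Prop :=
  forall x y : G, connect (@edge G) x y.

Definition isomorphic (G H : sgraph) : Prop :=
  exists2 f : G -> H, bijective f & forall x y, edge (f x) (f y) = edge x y.

Section Constructions.

Definition complete_edge (n : nat) : rel 'I_n := fun x y => x != y.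

Lemma complete_sym n : symmetric (@complete_edge n).
Proof. by move=> x y; rewrite /complete_edge eq_sym. Qed.

Lemma complete_irrefl n : irreflexive (@complete_edge n).
Proof. by move=> x; rewrite /complete_edge eqxx. Qed.

Definition complete (n : nat) : sgraph :=
  SGraph (@complete_sym n) (@complete_irrefl n).

(* n K_1, the disjoint union of n isolated vertices *)
Definition edgeless (n : nat) : sgraph :=
  @SGraph 'I_n (fun _ _ => false) (fun _ _ => erefl) (fun _ => erefl).

Variables G H : sgraph.

(* [b] tells whether vertices from different summands are adjacent *)
Definition sum_edge (b : bool) : rel (G + H)%type := fun u v =>
  match u, v with
  | inl x, inl y => edge x y
  | inr x, inr y => edge x y
  | _, _ => b
  end.

Lemma sum_edge_sym b : symmetric (sum_edge b).
Proof. by move=> [x|x] [y|y] //=; rewrite edge_sym. Qed.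

Lemma sum_edge_irrefl b : irreflexive (sum_edge b).
Proof. by move=> [x|x] /=; rewrite edge_irrefl. Qed.

Definition disjoint_union : sgraph :=
  SGraph (sum_edge_sym false) (sum_edge_irrefl false).

Definition join : sgraph :=
  SGraph (sum_edge_sym true) (sum_edge_irrefl true).

End Constructions.

Definition complete_bipartite (m n : nat) : sgraph :=
  join (edgeless m) (edgeless n).

(* The connected graphs with n vertices and n - 1 + e edges (used for n > 0). *)
Definition in_C (n e : nat) (G : sgraph) : Prop :=
  [/\ #|G| = n, connected G & #|edge_set G| = n - 1 + e].

(* 'C(k, 2) <= e forces k < e.+2, so the bound on k excludes nothing. *)
Definition k_ (e : nat) : nat := \max_(k < e.+2 | 'C(k, 2) <= e) k.

Definition t_ (e : nat) : nat := e - 'C(k_ e, 2).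

Definition b_ (e : nat) : nat := if t_ e == 0 then k_ e + 1 else k_ e + 2.

Definition graph_D (n e : nat) : sgraph :=
  if k_ e + 2 <= n then
    join
      (disjoint_union
         (join (disjoint_union (complete (k_ e - t_ e)) (complete 1))
               (complete (t_ e)))
         (edgeless (n - k_ e - 2)))
      (complete 1)
  else complete n.

(* Meaningful for n >= e + 2 only. *)
Definition graph_V (n e : nat) : sgraph :=
  join (disjoint_union (complete_bipartite 1 e) (edgeless (n - e - 2)))
       (complete 1).

Local Open Scope ring_scope.

Definition adjacency (F : nzRingType) (G : sgraph) : 'M[F]_#|G| :=
  \matrix_(i, j) (edge (enum_val i) (enum_val j))%:R.

(* The set of moduli is finite, and nonempty as soon as G has a vertex, so
   that its sup is then its largest element. *)
Definition spectral_radius (R : realType) (G : sgraph) : R :=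
  sup [set r : R | exists2 z : R[i],
         eigenvalue (adjacency (R[i]) G) z & `|z| = r%:C%C]%classic.

Definition attains_max_spectral_radius (R : realType) (n e : nat)
    (G : sgraph) : Prop :=
  in_C n e G /\
  forall H : sgraph, in_C n e H -> spectral_radius R H <= spectral_radius R G.

Definition Psi (R : realType) (e : nat) : {poly R} :=
  let k : R := (k_ e)%:R in
  let t : R := (t_ e)%:R in
    ((k - 1) * (k - 2) * (k ^+ 2 - 3 * k + 4 * t)) *: 'X^3
  - (k ^+ 5 - 6 * k ^+ 4 + k ^+ 3 * (4 * t + 15) - k ^+ 2 * (20 * t + 18)
     + k * (8 * t ^+ 2 + 24 * t + 8) - (4 * t ^+ 2 + 12 * t)) *: 'X^2
  - ((k ^+ 2 - k + 2 * t)
     * (k ^+ 3 + k ^+ 2 * (t - 4) - k * (3 * t - 5)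
        + (4 * t ^+ 2 - 2 * t - 2))) *: 'X
  + (t * (k - t - 1) * (k ^+ 2 - 3 * k + 2 * t) * (k ^+ 2 - k + 2 * t))%:P.

(* For e >= 4 the cubic Psi R e has positive leading coefficient, so its set of
   roots is finite and nonempty, and this is the largest root. *)
Definition psi (R : realType) (e : nat) : R :=
  sup [set x : R | root (Psi R e) x]%classic.

Definition omega (R : realType) (e : nat) : R :=
  let p := psi R e in
  e%:R + 2 + p * (p + 1) * (p ^+ 2 - p - 2 * e%:R) / (p ^+ 2 - e%:R).

(* Main.v *)
(** Let x be a Perron vector of a connected graph G and v a vertex of maximal
    weight.  Replacing an edge wu by wv does not decrease the Rayleigh quotient, so
    that in an extremal graph v is adjacent to all the other vertices.  Normalising
    x v = 1, the quotient turns into the concave form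
    qform lam 1 N r x = sum_N (2 x - lam x^2) + <x, A x> of the graph r induced on the
    n - 1 remaining vertices, which has e edges; if the excess g is lam * max qform - (n - 1),
    then lam = rho(G) amounts to lam^2 = n - 1 + g.

    The core of the proof is the bound g <= max (gD, gV) for every graph with e edges
    and every lam >= k_e, where gD and gV are the values for the quasi-complete graph
    and the star, with equality for these two graphs only.  It goes by induction on e:
    the same rotation makes a vertex v of degree d dominate all the non-isolated
    vertices, and then g = (lam + 1)^2 s / (lam^2 - s) - d where s - d is the value of
    g for the e - d edges left after removing v.  If d = e we have a star; if d is least
    possible the remaining graph is controlled by the quasi-complete graph with e - d
    edges.  In between, the value of g at k_(e-d) + 1, known by induction, is
    extrapolated to larger lam by means of de Caen's bound on the sum of squared degrees;
    what remains are polynomial inequalities in lam, which for each e <= 130 are certified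
    by the signs of integer coefficients.

    Finally gD - gV has the sign of - Psi_e, whose only zero beyond k_e is psi_e, and
    omega_e - 1 = psi_e^2 - gV psi_e. *)
Require Import Defs.
From Stdlib Require Import ZArith.
From mathcomp Require Import all_boot all_order all_algebra.
From mathcomp Require Import reals.
From mathcomp Require Import complex spectral sesquilinear.
From mathcomp Require Import ring lra zify ssrZ.

Set Implicit Arguments.
Unset Strict Implicit.
Unset Printing Implicit Defensive.

Import Order.TTheory GRing.Theory Num.Theory.
Local Open Scope ring_scope.

(** * Quadratic forms of graphs and rotation of edges *)

(** An isolated vertex adds exactly 1/lam to the maximum of the form, so the excess does not see it:
    it is the series of w_j / lam^j over j >= 1, where w_j counts the walks with j edges. For large
    lam the star therefore wins, and this is the obstacle to the induction. Once a vertex of degree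
    d is removed, the other e - d edges live on its d neighbours, where a star with e - d edges does
    not fit if e - d >= d; the maximum of gD and gV at lam is then too weak a bound. At k_(e-d) + 1
    the quasi-complete graph is still best, so that a star costs nothing there, and the passage to
    larger lam through squared degrees takes the number d of vertices into account. It applies
    because k_(e-d) + 1 <= k_e <= lam. The restriction lam >= k_e is harmless since D contains a
    clique on k_e + 1 vertices. Uniqueness travels along: a maximizer admits no further rotation
    towards its heaviest vertex, and every other estimate is either strict or hands equality down to
    a smaller graph. Graphs are relations on a fixed type supported in a set S, so that deleting a
    vertex only changes S. *)

Section Form.
Variables (R : realFieldType) (T : finType).
Implicit Types (r : rel T) (S : {set T}) (x y : T -> R) (u v w : T).

Definition graph_on S r :=
  [/\ symmetric r, irreflexive r & forall u v, r u v -> u \in S].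

Definition deg r u : nat := \sum_v r u v.
(** Every edge is counted in both directions, whence the recurring [2 * e]. *)
Definition arcs r : nat := \sum_u deg r u.
Definition quad r x : R := \sum_u \sum_v (r u v)%:R * (x u * x v).
(** The coefficient [c] varies: it is 1 for the graph at hand, [1 + x v] on the neighbours of a
    removed vertex [v], and 0 for the plain Rayleigh quotient. *)
Definition qform lam c S r x : R :=
  \sum_(v in S) (2 * c * x v - lam * x v ^+ 2) + quad r x.

Lemma sum_pair_eq (p q : T) (f : T -> T -> R) :
  \sum_a \sum_b ((a == p) && (b == q))%:R * f a b = f p q.
Proof.
rewrite (bigD1 p) //= (bigD1 q) //= !eqxx mul1r !big1 ?addr0 //.
  by move=> a ap; apply: big1 => b _; rewrite (negPf ap) mul0r.
by move=> b bq; rewrite (negPf bq) andbF mul0r.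
Qed.

(* The edge wu is replaced by wv. *)
Definition rotate r u w v : rel T := fun a b =>
  [|| (a == w) && (b == v), (a == v) && (b == w)
    | r a b && ~~ ((a == w) && (b == u) || (a == u) && (b == w))].

Section Rotate.
Variables (S : {set T}) (r : rel T) (u w v : T).
Hypotheses (rS : graph_on S r) (rwu : r w u) (rwv : ~~ r w v) (wv : w != v).

Let uv : u != v. Proof. by apply: contraNneq rwv => <-. Qed.
Let wu : w != u.
Proof. by have [_ ri _] := rS; apply: contraTneq rwu => <-; rewrite ri. Qed.

(** An entrywise balance without subtraction; summed with or without weights it gives the change of
    [quad] and the invariance of [arcs]. *)
Lemma rotate_count a b :
  (rotate r u w v a b + ((a == w) && (b == u)) + ((a == u) && (b == w))
   = r a b + ((a == w) && (b == v)) + ((a == v) && (b == w)))%N.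
Proof.
have [rs ri _] := rS; rewrite /rotate.
have rvw : r v w = false by rewrite rs (negPf rwv).
have ruw : r u w = true by rewrite rs rwu.
have vw : v != w by rewrite eq_sym. have uw : u != w by rewrite eq_sym.
have vu : v != u by rewrite eq_sym.
case: (eqVneq a w) => [->|aw] /=.
  rewrite (negPf wv) (negPf wu) /= !orbF !addn0.
  case: (eqVneq b v) => [->|bv] /=; first by rewrite (negPf rwv) (negPf vu).
  by case: (eqVneq b u) => [->|bu] /=; rewrite ?rwu ?andbT ?andbF.
case: (eqVneq b w) => [->|bw] /=; last by rewrite !andbF /= !andbT !addn0.
rewrite !andbT.
case: (eqVneq a v) => [->|av] /=; first by rewrite (negPf vu) rvw.
by case: (eqVneq a u) => [->|au] /=; rewrite ?ruw ?andbT ?andbF.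
Qed.

Lemma rotate_graph_on : v \in S -> graph_on S (rotate r u w v).
Proof.
have [rs ri rin] := rS => vS; split.
- move=> a b; rewrite /rotate rs.
  case: (a == w); case: (b == v); case: (a == v); case: (b == w);
  by case: (b == u); case: (a == u); rewrite ?orbT ?andbF ?andbT.
- move=> a; rewrite /rotate ri /= orbF andbC orbb.
  by apply/negP => /andP[/eqP -> /eqP e]; move: wv; rewrite e eqxx.
move=> a b /or3P[/andP[/eqP-> _]|/andP[/eqP-> _]|/andP[/rin]] //.
exact: rin rwu.
Qed.

Lemma rotate_quad x :
  quad (rotate r u w v) x = quad r x + 2 * x w * (x v - x u).
Proof.
apply: (addIr (2 * x w * x u)); apply/eqP; rewrite -addrA.
have -> : 2 * x w * (x v - x u) + 2 * x w * x u = x w * x v + x v * x w by ring.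
have {1}-> : 2 * x w * x u = x w * x u + x u * x w by ring.
rewrite -(sum_pair_eq w u (fun a b => x a * x b)).
rewrite -(sum_pair_eq u w (fun a b => x a * x b)).
rewrite -(sum_pair_eq w v (fun a b => x a * x b)).
rewrite -(sum_pair_eq v w (fun a b => x a * x b)).
rewrite !addrA /quad -!big_split /=; apply/eqP/eq_bigr => a _.
rewrite -!big_split /=; apply: eq_bigr => b _.
by rewrite -!mulrDl -!natrD rotate_count.
Qed.

Lemma rotate_arcs : arcs (rotate r u w v) = arcs r.
Proof.
have E (p q : T) : (\sum_a \sum_b ((a == p) && (b == q)) = 1)%N.
  rewrite (bigD1 p) //= (bigD1 q) //= !eqxx !big1 //.
    by move=> a ap; apply: big1 => b _; rewrite (negPf ap).
  by move=> b bq; rewrite (negPf bq) andbF.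
suff : (arcs (rotate r u w v) + 1 + 1 = arcs r + 1 + 1)%N by lia.
rewrite -{1}(E w u) -{1}(E u w) -{1}(E w v) -{1}(E v w).
rewrite /arcs /deg -!big_split /=; apply: eq_bigr => a _.
by rewrite -!big_split /=; apply: eq_bigr => b _; apply: rotate_count.
Qed.

Lemma rotate_deg : deg (rotate r u w v) v = (deg r v).+1.
Proof.
have vw : v != w by rewrite eq_sym.
rewrite /deg (bigD1 w) //= [in RHS](bigD1 w) //=.
have [rs _ _] := rS.
rewrite rs (negPf rwv) add0n /rotate !eqxx !orbT add1n; congr _.+1.
apply: eq_bigr => b bw.
by rewrite (negPf vw) (negPf bw) !andbF /= andbT.
Qed.

Lemma rotate_sum_v x :
  \sum_b (rotate r u w v v b)%:R * x b = \sum_b (r v b)%:R * x b + x w.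
Proof.
have vw : v != w by rewrite eq_sym.
rewrite (bigD1 w) //= [in RHS](bigD1 w) //=.
have [rs _ _] := rS.
rewrite rs (negPf rwv) mul0r add0r /rotate !eqxx !orbT mul1r addrC.
congr (_ + _); apply: eq_bigr => b bw.
by rewrite (negPf vw) (negPf bw) !andbF /= andbT.
Qed.

End Rotate.

Lemma quad_abs r x : quad r x <= quad r (fun u => `|x u|).
Proof.
apply: ler_sum => u _; apply: ler_sum => v _.
by apply: ler_wpM2l; rewrite ?ler0n // -normrM ler_norm.
Qed.

Lemma form_abs lam c S r x : 0 <= c ->
  qform lam c S r x <= qform lam c S r (fun u => `|x u|).
Proof.
move=> c0; apply: lerD (quad_abs _ _); apply: ler_sum => u _.
rewrite real_normK ?num_real // lerD2r ler_wpM2l ?ler_norm //; lra.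
Qed.

Lemma form_scale lam c S r x : 0 < c ->
  qform lam c S r x = c ^+ 2 * qform lam 1 S r (fun u => x u / c).
Proof.
move=> c0; have cn : c != 0 by rewrite gt_eqF.
rewrite /qform mulrDr; congr (_ + _).
  by rewrite big_distrr /=; apply: eq_bigr => u _; field.
rewrite /quad big_distrr /=; apply: eq_bigr => u _.
by rewrite big_distrr /=; apply: eq_bigr => v _; field.
Qed.

Definition nsum r x u : R := \sum_v (r u v)%:R * x v.

Lemma quadE r x : quad r x = \sum_u x u * nsum r x u.
Proof.
apply: eq_bigr => u _; rewrite /nsum big_distrr /=.
by apply: eq_bigr => v _; ring.
Qed.

Lemma quad_perturb S r x v e : graph_on S r ->
  quad r (fun u => x u + e * (u == v)%:R) = quad r x + 2 * e * nsum r x v.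
Proof.
move=> [rs ri _].
have -> : 2 * e * nsum r x v = \sum_u \sum_w (u == v)%:R * ((r u w)%:R * e * x w)
    + \sum_u \sum_w (w == v)%:R * ((r u w)%:R * e * x u).
  rewrite [X in _ = _ + X]exchange_big /= -big_split /= (bigD1 v) //=.
  rewrite [X in _ + X]big1 ?addr0; last first.
    by move=> u uv; rewrite !big1 ?addr0 // => w _; rewrite (negPf uv) mul0r.
  rewrite -big_split /= /nsum big_distrr /=; apply: eq_bigr => w _.
  by rewrite eqxx (rs w v) /=; ring.
rewrite /quad -!big_split /=; apply: eq_bigr => u _; rewrite -!big_split /=.
apply: eq_bigr => w _.
have [->|uv] := eqVneq u v; have [->|wv] := eqVneq w v;
  rewrite ?ri /=; ring.
Qed.

(** With [g] half the partial derivative at [v], a step [g / lam] along this coordinate raises the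
    form by exactly [g ^+ 2 / lam]; at a maximizer [g] must vanish. *)
Lemma stationary lam c S r x B : 0 < lam -> graph_on S r ->
  (forall y, qform lam c S r y <= B) -> qform lam c S r x = B ->
  forall v, v \in S -> lam * x v = c + nsum r x v.
Proof.
move=> l0 rS bB eB v vS.
pose g := c + nsum r x v - lam * x v.
have := bB (fun u => x u + g / lam * (u == v)%:R).
rewrite -eB /qform (quad_perturb _ _ _ rS) (bigD1 v) //= [in X in _ <= X](bigD1 v) //=.
under [X in _ + X + _ <= _]eq_bigr => u /andP[_ /negPf ->] do rewrite mulr0 addr0.
rewrite eqxx mulr1 => H.
have: g ^+ 2 <= 0.
  have E : 2 * c * (x v + g / lam) - lam * (x v + g / lam) ^+ 2 + 2 * (g / lam) * nsum r x v
    = 2 * c * x v - lam * x v ^+ 2 + g ^+ 2 / lam.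
    by rewrite /g; field; rewrite gt_eqF.
  have : g ^+ 2 / lam <= 0 by lra.
  by rewrite pmulr_lle0 // invr_gt0.
move=> g2; have : g ^+ 2 == 0 by rewrite eq_le g2 sqr_ge0.
by rewrite sqrf_eq0 /g => /eqP; lra.
Qed.

Definition dominates r v := forall a b, r a b -> a != v -> r v a.

Lemma dominatesP S r v : graph_on S r ->
  dominates r v \/ exists u w, [/\ r w u, ~~ r w v & w != v].
Proof.
move=> [rs _ _].
case: (pickP [pred p : T * T | [&& r p.2 p.1, ~~ r p.2 v & p.2 != v]]) => [[u w] /and3P[]|H].
  by move=> a b c; right; exists u, w.
left=> a b rab av; have := H (b, a); rewrite /= rab av andbT /=.
by move/negbFE; rewrite rs.
Qed.

Lemma deg_le r v : (deg r v <= #|T|)%N.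
Proof.
rewrite -sum1_card; apply: leq_sum => u _; exact: leq_b1.
Qed.

(** Fix the weights [|x u|] and a heaviest vertex [v] of [S]. Each rotation towards [v] keeps the
    number of edges, does not lower the form and raises [deg r v], so rotations end at a graph
    dominated by [v]. *)
Lemma compress_le lam S B m :
  (forall r x v, graph_on S r -> arcs r = m -> (forall u, 0 <= x u) ->
     v \in S -> dominates r v -> qform lam 1 S r x <= B) ->
  forall r x, S != set0 -> graph_on S r -> arcs r = m -> qform lam 1 S r x <= B.
Proof.
move=> H r x /set0Pn[v0 v0S] rS am.
apply: le_trans (form_abs _ _ _ _ ler01) _.
pose y u : R := `|x u|; rewrite -/y.
have y0 u : 0 <= y u by apply: normr_ge0.
have [v vS vmax] : exists2 v, v \in S & forall u, u \in S -> y u <= y v.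
  by case: (arg_maxP y v0S) => v vS vm; exists v.
have [n] := ubnP (#|T| - deg r v); elim: n r rS am => // n IH r rS am le_n.
have [dom|[u [w [rwu rwv wv]]]] := dominatesP v rS; first exact: H dom.
have r1S := rotate_graph_on rS rwu wv vS.
have := IH _ r1S _ _; rewrite (rotate_arcs rS) // (rotate_deg u rS) //.
have dl : (deg r v < #|T|)%N.
  by have := deg_le (rotate r u w v) v; rewrite (rotate_deg u rS).
move=> /(_ am) H1; apply: le_trans (H1 _); last by lia.
rewrite /qform lerD2l (rotate_quad rS) // lerDl mulr_ge0 ?subr_ge0 ?vmax //.
  by rewrite mulr_ge0.
by have [rs _ rin] := rS; apply: rin (w) _; rewrite rs.
Qed.

(** The maximizer itself is dominated, not merely a rotated copy of it. A possible rotation would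
    give a second maximizer with the same weights; the stationary equations of both at [v] force
    [y w = 0], whereas the equation at [w] reads [0 = 1 + nsum r y w] with a nonnegative sum. *)
Lemma compress_eq lam S B m : 0 < lam ->
  (forall r x v, graph_on S r -> arcs r = m -> (forall u, 0 <= x u) ->
     v \in S -> dominates r v -> qform lam 1 S r x <= B) ->
  forall r x, S != set0 -> graph_on S r -> arcs r = m -> qform lam 1 S r x = B ->
  exists y v, [/\ forall u, 0 <= y u, v \in S, dominates r v
               & qform lam 1 S r y = B].
Proof.
move=> l0 H r x S0 rS am eB; have bB r' z := @compress_le lam S B m H r' z S0.
have /set0Pn[v0 v0S] := S0.
pose y u : R := `|x u|.
have y0 u : 0 <= y u by apply: normr_ge0.
have eyB : qform lam 1 S r y = B.
  by apply/eqP; rewrite eq_le bB // -eB form_abs.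
have [v vS vmax] : exists2 v, v \in S & forall u, u \in S -> y u <= y v.
  by case: (arg_maxP y v0S) => v vS vm; exists v.
have [dom|[u [w [rwu rwv wv]]]] := dominatesP v rS; first by exists y, v; split.
have [rs _ rin] := rS.
have wS := rin _ _ rwu.
have uS : u \in S by apply: rin (w) _; rewrite rs.
have r1S := rotate_graph_on rS rwu wv vS.
have r1B z : qform lam 1 S (rotate r u w v) z <= B.
  by apply: bB => //; rewrite (rotate_arcs rS).
have e1 : qform lam 1 S (rotate r u w v) y = B.
  apply/eqP; rewrite eq_le r1B -eyB /qform lerD2l (rotate_quad rS) //.
  by rewrite lerDl mulr_ge0 ?subr_ge0 ?vmax // mulr_ge0.
have s0 := stationary l0 rS (fun z => bB r z rS am) eyB.
have s1 := stationary l0 r1S r1B e1 vS.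
have yw : y w = 0.
  by have := s0 _ vS; rewrite s1 /nsum (rotate_sum_v u rS) // -/(nsum r y v); lra.
have := s0 _ wS; rewrite yw mulr0 => h.
have : 0 <= nsum r y w by apply: sumr_ge0 => b _; rewrite mulr_ge0 ?ler0n.
by move: h; lra.
Qed.

Definition nbr r v : {set T} := [set u | r v u].
Definition unstar r v : rel T := fun a b => [&& r a b, a != v & b != v].

Lemma deg_card r v : deg r v = #|nbr r v|.
Proof.
rewrite /deg -sum1_card [RHS]big_mkcond /=; apply: eq_bigr => u _.
by rewrite inE; case: (r v u).
Qed.

Lemma unstar_graph_on S r v : graph_on S r -> dominates r v ->
  graph_on (nbr r v) (unstar r v).
Proof.
move=> [rs ri _] dom; split.
- by move=> a b; rewrite /unstar rs; congr (_ && _); rewrite andbC.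
- by move=> a; rewrite /unstar ri.
- by move=> a b /and3P[rab av bv]; rewrite inE (dom a b).
Qed.

Lemma unstar_count S r v a b : graph_on S r ->
  (r a b = unstar r v a b + ((a == v) && r v b) + ((b == v) && r v a) :> nat)%N.
Proof.
move=> [rs ri _]; rewrite /unstar.
have [->|av] := eqVneq a v; have [->|bv] := eqVneq b v; rewrite ?ri ?andbF ?andbT ?addn0 //=.
by rewrite rs.
Qed.

Lemma unstar_arcs S r v : graph_on S r ->
  arcs r = (arcs (unstar r v) + 2 * #|nbr r v|)%N.
Proof.
move=> rS; rewrite /arcs /deg.
under eq_bigr => a _ do (under eq_bigr => b _ do rewrite (unstar_count v a b rS)).
under eq_bigr => a _ do rewrite !big_split /=.
rewrite !big_split /= -addnA mul2n -addnn; congr (_ + (_ + _))%N.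
  rewrite (bigD1 v) //= [X in (_ + X)%N]big1 ?addn0; last first.
    by move=> a av; apply: big1 => b _; rewrite (negPf av).
  by rewrite -deg_card /deg; apply: eq_bigr => b _; rewrite eqxx.
rewrite -deg_card /deg; apply: eq_bigr => a _.
rewrite (bigD1 v) //= eqxx [X in (_ + X)%N]big1 ?addn0 //.
by move=> b bv; rewrite (negPf bv).
Qed.

Lemma unstar_quad S r v x : graph_on S r ->
  quad r x = quad (unstar r v) x + 2 * x v * \sum_(u in nbr r v) x u.
Proof.
move=> rS; rewrite /quad.
under eq_bigr => a _ do (under eq_bigr => b _ do
  rewrite (unstar_count v a b rS) !natrD !mulrDl).
under eq_bigr => a _ do rewrite !big_split /=.
have E : \sum_b (r v b)%:R * (x v * x b) = x v * \sum_(u in nbr r v) x u.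
  rewrite big_distrr [RHS]big_mkcond /=; apply: eq_bigr => u _.
  by rewrite inE; case: (r v u); rewrite ?mul1r ?mul0r.
rewrite !big_split /= -addrA; congr (_ + _).
have -> : 2 * x v * \sum_(u in nbr r v) x u =
   \sum_b (r v b)%:R * (x v * x b) + \sum_b (r v b)%:R * (x v * x b) by rewrite E; ring.
congr (_ + _).
  rewrite (bigD1 v) //= [X in _ + X]big1 ?addr0; last first.
    by move=> a av; apply: big1 => b _; rewrite (negPf av) mul0r.
  by apply: eq_bigr => b _; rewrite eqxx.
apply: eq_bigr => a _; rewrite (bigD1 v) //= eqxx [X in _ + X]big1 ?addr0 /= 1?[x a * _]mulrC //.
by move=> b bv; rewrite (negPf bv) mul0r.
Qed.

Lemma dominated_form lam S r v x : graph_on S r -> v \in S ->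
  qform lam 1 S r x = 2 * x v - lam * x v ^+ 2
    + qform lam (1 + x v) (nbr r v) (unstar r v) x
    + \sum_(u in S :\ v :\: nbr r v) (2 * x u - lam * x u ^+ 2).
Proof.
move=> rS vS; have [rs ri rin] := rS.
have NS : nbr r v \subset S :\ v.
  apply/subsetP => u; rewrite !inE => rvu; apply/andP; split.
    by apply: contraTneq rvu => ->; rewrite ri.
  by apply: rin (v) _; rewrite rs.
rewrite /qform (unstar_quad v x rS) (big_setD1 v vS) /=.
rewrite (big_setID (nbr r v)) /= (setIidPr NS).
have -> : \sum_(u in nbr r v) (2 * (1 + x v) * x u - lam * x u ^+ 2) =
  \sum_(u in nbr r v) (2 * 1 * x u - lam * x u ^+ 2) + 2 * x v * \sum_(u in nbr r v) x u.
  by rewrite big_distrr -big_split /=; apply: eq_bigr => u _; ring.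
have -> : \sum_(u in S :\ v :\: nbr r v) (2 * x u - lam * x u ^+ 2) =
  \sum_(u in S :\ v :\: nbr r v) (2 * 1 * x u - lam * x u ^+ 2).
  by apply: eq_bigr => u _; rewrite mulr1.
by ring.
Qed.

(* If v is joined to the d vertices of a graph with excess s - d, the excess of the
   result is starred lam d s. *)
Definition starred (lam d s : R) : R := (lam + 1) ^+ 2 * s / (lam ^+ 2 - s) - d.

Lemma isolated_le lam (z : R) : 0 < lam -> 2 * z - lam * z ^+ 2 <= lam^-1.
Proof.
move=> l0; rewrite -subr_ge0.
have -> : lam^-1 - (2 * z - lam * z ^+ 2) = (lam * z - 1) ^+ 2 / lam.
  by field; rewrite gt_eqF.
by rewrite divr_ge0 ?sqr_ge0 // ltW.
Qed.

(** Vertices not adjacent to [v] contribute at most [lam^-1] each. What remains is a quadratic in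
    [a = x v] with maximum at [a = (s + lam) / (lam ^+ 2 - s)], the origin of the fraction in
    [starred]. As the estimates simply add up, equality forces equality on the neighbours. *)
Lemma dominated_le lam S r v x s : 0 < lam -> s < lam ^+ 2 -> graph_on S r -> v \in S ->
  qform lam (1 + x v) (nbr r v) (unstar r v) x <= (1 + x v) ^+ 2 * (s / lam) ->
  qform lam 1 S r x <= (#|S|%:R + starred lam #|nbr r v|%:R s) / lam
  /\ (qform lam 1 S r x = (#|S|%:R + starred lam #|nbr r v|%:R s) / lam ->
      qform lam (1 + x v) (nbr r v) (unstar r v) x = (1 + x v) ^+ 2 * (s / lam)).
Proof.
move=> l0 sl rS vS; have [rs ri rin] := rS.
rewrite (dominated_form _ _ rS vS).
set f := qform _ _ _ _ _; set a := x v => fle.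
set rest := \sum_(u in _) _.
have NS : nbr r v \subset S :\ v.
  apply/subsetP => u; rewrite !inE => rvu; apply/andP; split.
    by apply: contraTneq rvu => ->; rewrite ri.
  by apply: rin (v) _; rewrite rs.
have restle : rest <= (#|S|%:R - 1 - #|nbr r v|%:R) / lam.
  have -> : #|S|%:R - 1 - #|nbr r v|%:R = #|S :\ v :\: nbr r v|%:R :> R.
    have := cardsID (nbr r v) (S :\ v); rewrite (setIidPr NS) => e1.
    by have := cardsD1 v S; rewrite vS -e1 /= => ->; rewrite !natrD; ring.
  by rewrite mulr_natl -sumr_const; apply: ler_sum => u _; apply: isolated_le.
have key : 2 * a - lam * a ^+ 2 + (1 + a) ^+ 2 * (s / lam) <=
    (1 + starred lam 0 s) / lam.
  rewrite -subr_ge0.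
  have -> : (1 + starred lam 0 s) / lam - (2 * a - lam * a ^+ 2 + (1 + a) ^+ 2 * (s / lam))
    = ((lam ^+ 2 - s) * a - (s + lam)) ^+ 2 / ((lam ^+ 2 - s) * lam).
    by rewrite /starred; field; apply/andP; split; rewrite gt_eqF // subr_gt0.
  by rewrite divr_ge0 ?sqr_ge0 // mulr_ge0 ?subr_ge0 // ltW.
have -> : (#|S|%:R + starred lam #|nbr r v|%:R s) / lam =
  (#|S|%:R - 1 - #|nbr r v|%:R) / lam + (1 + starred lam 0 s) / lam.
  by rewrite /starred; ring.
split; lra.
Qed.

End Form.

(** * Squared degrees and extrapolation in lam *)

Section Moments.
Variables (R : realFieldType) (T : finType).
Implicit Types (r : rel T) (S : {set T}) (x y : T -> R) (u v w : T).

Lemma deg_out S r u : graph_on S r -> u \notin S -> deg r u = 0%N.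
Proof.
move=> [_ _ rin] uS; apply: big1 => v _.
by case E: (r u v) => //; rewrite (rin _ _ E) in uS.
Qed.

Lemma sum_deg_in S r (f : T -> R) : graph_on S r ->
  \sum_u (deg r u)%:R * f u = \sum_(u in S) (deg r u)%:R * f u.
Proof.
move=> rS; rewrite [RHS]big_mkcond /=; apply: eq_bigr => u _.
by case: ifPn => // uS; rewrite (deg_out rS uS) mul0r.
Qed.

Lemma nbrS S r v : graph_on S r -> nbr r v \subset S :\ v.
Proof.
move=> [rs ri rin]; apply/subsetP => u; rewrite !inE => rvu; apply/andP; split.
  by apply: contraTneq rvu => ->; rewrite ri.
by apply: rin (v) _; rewrite rs.
Qed.

Lemma deg_lt S r v : graph_on S r -> v \in S -> (deg r v < #|S|)%N.
Proof.
move=> rS vS; rewrite deg_card (cardsD1 v S) vS add1n ltnS.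
exact: subset_leq_card (nbrS _ rS).
Qed.

Lemma nbr_deg_sum S r : graph_on S r ->
  \sum_v \sum_(w in nbr r v) (deg r w)%:R = \sum_v (deg r v)%:R ^+ 2 :> R.
Proof.
move=> [rs _ _].
under eq_bigr => v _ do rewrite big_mkcond /=.
rewrite exchange_big /=; apply: eq_bigr => w _.
rewrite -big_mkcond /=.
rewrite (eq_bigl (fun v => v \in nbr r w)); last by move=> v; rewrite !inE rs.
by rewrite sumr_const -deg_card expr2 mulr_natr.
Qed.

(* For w adjacent to v and u not adjacent to v, (m - 1 - deg w) + deg u >= 1;
   summing over all such pairs bounds the degree sum of the neighbours of v. *)
Lemma nbr_deg_le S r v : graph_on S r -> v \in S ->
  (#|S|%:R - 1) * \sum_(w in nbr r v) (deg r w)%:R <=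
    (deg r v)%:R * ((arcs r)%:R + (#|S|%:R - 1) * (#|S|%:R - 2 - (deg r v)%:R)) :> R.
Proof.
set d : R := (deg r v)%:R; set m : R := #|S|%:R.
move=> rS vS; have [rs ri rin] := rS; have NS := nbrS v rS.
pose U := S :\ v :\: nbr r v.
set s := \sum_(w in nbr r v) _.
have cU : #|U|%:R = m - 1 - d.
  have := cardsID (nbr r v) (S :\ v); rewrite (setIidPr NS) -/U => e1.
  have := cardsD1 v S; rewrite vS /= -e1 /m /d deg_card => ->.
  by rewrite !natrD; ring.
have sU : \sum_(u in U) (deg r u)%:R = (arcs r)%:R - d - s.
  have -> : (arcs r)%:R = \sum_(u in S) (deg r u)%:R :> R.
    rewrite natr_sum; transitivity (\sum_u (deg r u)%:R * 1 : R).
      by apply: eq_bigr => u _; rewrite mulr1.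
    by rewrite (sum_deg_in (fun=> 1) rS); apply: eq_bigr => u _; rewrite mulr1.
  rewrite (big_setD1 v vS) /= [in RHS](big_setID (nbr r v)) /= (setIidPr NS).
  rewrite -/U -/s -/d.
  by ring.
have : 0 <= \sum_(w in nbr r v) \sum_(u in U) (m - 2 - (deg r w)%:R + (deg r u)%:R).
  apply: sumr_ge0 => w wN; apply: sumr_ge0 => u uU.
  have wS : w \in S by have := subsetP NS _ wN; rewrite !inE => /andP[].
  (* If [u] is isolated, then [w] is adjacent neither to itself nor to [u]; otherwise
     [deg r w < #|S|] is enough. *)
  have : ((deg r w).+2 <= #|S| + deg r u)%N.
    case Eu: (deg r u) => [|n]; last by have := deg_lt rS wS; lia.
    rewrite addn0 deg_card.
    have uw : u \notin nbr r w.
      rewrite inE rs; apply/negP => ruw; move: Eu.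
      by rewrite /deg (bigD1 w) //= ruw.
    have wu : w != u.
      by apply: contraTneq uU => <-; rewrite /U in_setD wN.
    have uS : u \in S by move: uU; rewrite !inE => /and3P[].
    have : nbr r w \subset S :\ w :\ u.
      apply/subsetP => z zw; rewrite in_setD1; apply/andP; split.
        by apply: contraNneq uw => <-.
      exact: (subsetP (nbrS w rS)).
    move/subset_leq_card; rewrite (cardsD1 w S) wS (cardsD1 u (S :\ w)).
    by rewrite in_setD1 eq_sym wu uS /=; lia.
  by rewrite -(ler_nat R) !mulrSr natrD -/m; lra.
have -> : \sum_(w in nbr r v) \sum_(u in U) (m - 2 - (deg r w)%:R + (deg r u)%:R)
   = (m - 1 - d) * (d * (m - 2) - s) + d * ((arcs r)%:R - d - s).
  have E w : \sum_(u in U) (m - 2 - (deg r w)%:R + (deg r u)%:R) =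
      (m - 1 - d) * (m - 2 - (deg r w)%:R) + ((arcs r)%:R - d - s).
    by rewrite big_split /= sU sumr_const -[_ *+ #|U|]mulr_natl cU.
  rewrite (eq_bigr _ (fun w _ => E w)) big_split /= sumr_const -deg_card.
  rewrite -[_ *+ deg r v]mulr_natl -/d -mulr_sumr; congr (_ * _ + _).
  by rewrite sumrB sumr_const -deg_card -[_ *+ deg r v]mulr_natl -/d.
move=> H; rewrite -subr_ge0; apply: le_trans H _.
by rewrite le_eqVlt; apply/orP; left; apply/eqP; ring.
Qed.

(* de Caen's inequality *)
Lemma sum_deg_sqr_le S r e : graph_on S r -> arcs r = (2 * e)%N -> (1 < #|S|)%N ->
  \sum_u (deg r u)%:R ^+ 2
    <= (e * (2 * e + (#|S| - 1) * (#|S| - 2)))%:R / (#|S| - 1)%:R :> R.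
Proof.
move=> rS ae S1; rewrite ler_pdivlMr ?ltr0n ?subn_gt0 //.
set N := \sum_u _; set m : R := #|S|%:R.
have em : (#|S| - 1)%:R = m - 1 by rewrite natrB // ltnW.
have em2 : (#|S| - 2)%:R = m - 2 by rewrite natrB.
have H : (m - 1) * N <=
    \sum_(v in S) (deg r v)%:R * ((arcs r)%:R + (m - 1) * (m - 2 - (deg r v)%:R)).
  rewrite /N -(nbr_deg_sum rS).
  have -> : \sum_v \sum_(w in nbr r v) (deg r w)%:R =
     \sum_(v in S) \sum_(w in nbr r v) (deg r w)%:R :> R.
    rewrite [RHS]big_mkcond /=; apply: eq_bigr => v _; case: ifPn => // vS.
    apply: big1 => w; rewrite inE => rvw.
    by have [_ _ rin] := rS; rewrite (rin _ _ rvw) in vS.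
  by rewrite big_distrr /=; apply: ler_sum => v vS; apply: nbr_deg_le.
rewrite -(sum_deg_in (fun v => (arcs r)%:R + (m - 1) * (m - 2 - (deg r v)%:R)) rS) in H.
have E : \sum_u (deg r u)%:R * ((arcs r)%:R + (m - 1) * (m - 2 - (deg r u)%:R))
   = ((arcs r)%:R + (m - 1) * (m - 2)) * (arcs r)%:R - (m - 1) * N.
  rewrite {3}/arcs natr_sum /N !mulr_sumr -sumrB; apply: eq_bigr => u _; ring.
rewrite E ae natrM in H.
by rewrite !natrM natrD !natrM em em2 -/m -/N; lra.
Qed.

Lemma quad_shift r (c : R) y : symmetric r ->
  quad r (fun u => c + y u) =
    c ^+ 2 * (arcs r)%:R + 2 * c * (\sum_u (deg r u)%:R * y u) + quad r y.
Proof.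
move=> rs.
have A : (arcs r)%:R = \sum_u \sum_v (r u v)%:R :> R.
  by rewrite natr_sum; apply: eq_bigr => u _; rewrite natr_sum.
have D1 : \sum_u (deg r u)%:R * y u = \sum_u \sum_v (r u v)%:R * y u.
  by apply: eq_bigr => u _; rewrite natr_sum mulr_suml.
have D2 : \sum_u (deg r u)%:R * y u = \sum_u \sum_v (r u v)%:R * y v.
  by rewrite D1 exchange_big; apply: eq_bigr => u _; apply: eq_bigr => v _; rewrite rs.
have -> : 2 * c * (\sum_u (deg r u)%:R * y u) =
   c * (\sum_u (deg r u)%:R * y u) + c * (\sum_u (deg r u)%:R * y u) by ring.
rewrite {1}D1 D2 A /quad !mulr_sumr -!big_split /=; apply: eq_bigr => u _.
rewrite !mulr_sumr -!big_split /=; apply: eq_bigr => v _; ring.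
Qed.

Lemma quad_scale r (c : R) y : quad r (fun u => c * y u) = c ^+ 2 * quad r y.
Proof.
rewrite /quad mulr_sumr; apply: eq_bigr => u _; rewrite mulr_sumr.
by apply: eq_bigr => v _; ring.
Qed.

Lemma form_shift (lam c : R) S r x y : lam != 0 -> graph_on S r ->
  (forall u, lam * x u = c + y u) ->
  lam ^+ 2 * qform lam c S r x = c ^+ 2 * (lam * #|S|%:R + (arcs r)%:R)
   + 2 * c * (\sum_u (deg r u)%:R * y u) + quad r y - lam * \sum_(u in S) y u ^+ 2.
Proof.
move=> l0 [rs _ _] xy; rewrite /qform mulrDr -quad_scale.
have -> : quad r (fun u => lam * x u) = quad r (fun u => c + y u).
  by apply: eq_bigr => u _; apply: eq_bigr => v _; rewrite !xy.
rewrite quad_shift //.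
have -> : lam ^+ 2 * \sum_(v in S) (2 * c * x v - lam * x v ^+ 2) =
   c ^+ 2 * (lam * #|S|%:R) - lam * \sum_(u in S) y u ^+ 2.
  have -> : c ^+ 2 * (lam * #|S|%:R) = \sum_(u in S) c ^+ 2 * lam.
    by rewrite sumr_const mulrA mulr_natr.
  rewrite !mulr_sumr -sumrB; apply: eq_bigr => u _.
  by have -> : y u = lam * x u - c; [rewrite xy; ring | ring].
by ring.
Qed.

(* With y = lam x - 1 the qform becomes, up to the constant lam |S| + 2 e, the
   qform of the same shape with the degree vector in place of 1.  Being a moment
   1/(lam - theta) of a measure of mass sum deg^2, its value at lam is bounded,
   by concavity, through its value at a smaller lam0. *)
Lemma form_extrapolate (lam0 lam : R) S r e (G0 N : R) :
  0 < lam0 -> lam0 <= lam -> 0 < G0 -> 0 < N -> graph_on S r -> arcs r = (2 * e)%N ->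
  (forall x, qform lam0 1 S r x <= (#|S|%:R + (2 * e%:R + G0) / lam0) / lam0) ->
  \sum_u (deg r u)%:R ^+ 2 <= N ->
  let G := (G0^-1 + (lam - lam0) / N)^-1 in
  forall x, qform lam 1 S r x <= (#|S|%:R + (2 * e%:R + G) / lam) / lam
   /\ (qform lam 1 S r x = (#|S|%:R + (2 * e%:R + G) / lam) / lam ->
       exists z, qform lam0 1 S r z = (#|S|%:R + (2 * e%:R + G0) / lam0) / lam0).
Proof.
move=> l0 ll G00 N0 rS ae b0 dN G x.
have lp : 0 < lam by apply: lt_le_trans ll.
pose k := (lam - lam0) / N.
have k0 : 0 <= k by rewrite divr_ge0 ?subr_ge0 // ltW.
have Gp : 0 < G by rewrite invr_gt0 ltr_wpDr // invr_gt0.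
(* The share [c] of the linear term [2 * q] is charged to the bound at [lam0], the share
   [1 - c = k * G] to the extra [(lam - lam0) * Y]. For [k > 0] this choice minimises the total cost
   [c ^+ 2 * G0 + (1 - c) ^+ 2 / k], and the minimum is [G]. *)
pose c := G / G0.
have cp : 0 < c by rewrite divr_gt0.
have ck : c + k * G = 1.
  have Gn : (G0^-1 + k) != 0 by rewrite -invr_eq0 -/G gt_eqF.
  by rewrite /c mulrC -mulrDl mulfV.
pose y u := lam * x u - 1.
pose z u := (c + y u) / lam0.
have F1 := @form_shift lam 1 S r x y (lt0r_neq0 lp) rS.
have F0 := @form_shift lam0 c S r z y (lt0r_neq0 l0) rS.
have {}F1 := F1 (fun u => esym (subrKC 1 (lam * x u))).
have Ez u : lam0 * z u = c + y u by rewrite /z mulrC divfK // gt_eqF.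
have {}F0 := F0 Ez.
rewrite ae natrM in F0 F1.
set q := \sum_u _ in F0 F1; set Y := \sum_(u in S) _ in F0 F1.
set Qy := quad r y in F0 F1.
(* Cauchy-Schwarz for [y] and the degree vector, in the form of a sum of squares with multiplier
   [G / N]. *)
have YG : 2 * G * q - G ^+ 2 <= N * Y.
  have : 0 <= \sum_(u in S) (y u - G / N * (deg r u)%:R) ^+ 2.
    by apply: sumr_ge0 => u _; apply: sqr_ge0.
  have -> : \sum_(u in S) (y u - G / N * (deg r u)%:R) ^+ 2 =
     Y - 2 * G / N * q + (G / N) ^+ 2 * \sum_u (deg r u)%:R ^+ 2.
    have -> : \sum_u (deg r u)%:R ^+ 2 = \sum_(u in S) (deg r u)%:R * (deg r u)%:R :> R.
      by rewrite -(sum_deg_in _ rS); apply: eq_bigr => u _; rewrite expr2.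
    rewrite /q (sum_deg_in _ rS) /Y !mulr_sumr -sumrB -big_split /=.
    by apply: eq_bigr => u _; ring.
  move=> H.
  have H2 : (G / N) ^+ 2 * \sum_u (deg r u)%:R ^+ 2 <= (G / N) ^+ 2 * N.
    by apply: ler_wpM2l => //; apply: sqr_ge0.
  have H3 : 0 <= Y - 2 * G / N * q + (G / N) ^+ 2 * N by lra.
  have H4 : 0 <= N * (Y - 2 * G / N * q + (G / N) ^+ 2 * N) by rewrite mulr_ge0 // ltW.
  have E : N * (Y - 2 * G / N * q + (G / N) ^+ 2 * N) = N * Y - 2 * G * q + G ^+ 2.
    by field; rewrite gt_eqF.
  by rewrite E in H4; lra.
have B0 : lam0 ^+ 2 * qform lam0 c S r z <= c ^+ 2 * (lam0 * #|S|%:R + 2 * e%:R + G0).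
  rewrite (form_scale _ _ _ _ cp).
  have -> : c ^+ 2 * (lam0 * #|S|%:R + 2 * e%:R + G0) =
    lam0 ^+ 2 * (c ^+ 2 * ((#|S|%:R + (2 * e%:R + G0) / lam0) / lam0)).
    by field; rewrite gt_eqF.
  by rewrite !ler_wpM2l ?sqr_ge0.
have key : 2 * q + Qy - lam * Y <= G /\ (2 * q + Qy - lam * Y = G ->
    2 * c * q + Qy - lam0 * Y = c ^+ 2 * G0).
  have A1 : 2 * c * q + Qy - lam0 * Y <= c ^+ 2 * G0 by lra.
  have A2 : k * (2 * G * q - G ^+ 2) <= (lam - lam0) * Y.
    have -> : (lam - lam0) * Y = k * (N * Y) by rewrite /k; field; rewrite gt_eqF.
    exact: ler_wpM2l.
  have E1 : c ^+ 2 * G0 = c * G by rewrite /c; field; rewrite gt_eqF.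
  have E2 : 2 * q = 2 * c * q + 2 * (k * G) * q by rewrite -{1}[2 * q]mulr1 -ck; ring.
  have E3 : c * G + k * G ^+ 2 = G by rewrite -{3}[G]mulr1 -ck; ring.
  by rewrite E1 in A1 *; split; lra.
have target : (#|S|%:R + (2 * e%:R + G) / lam) / lam =
   (lam * #|S|%:R + 2 * e%:R + G) / lam ^+ 2 by field; rewrite gt_eqF.
have l2 : 0 < lam ^+ 2 by rewrite exprn_gt0.
have formE : qform lam 1 S r x = (lam * #|S|%:R + 2 * e%:R + (2 * q + Qy - lam * Y)) / lam ^+ 2.
  apply: (mulfI (lt0r_neq0 l2)); rewrite F1; field; exact: lt0r_neq0.
case: key => key1 key2; rewrite target formE; split.
  by rewrite ler_pM2r ?invr_gt0 // lerD2l.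
move/(mulIf (invr_neq0 (lt0r_neq0 l2))) => /addrI /key2 K.
exists (fun u => z u / c).
have : lam0 ^+ 2 * qform lam0 c S r z = c ^+ 2 * (lam0 * #|S|%:R + 2 * e%:R + G0) by lra.
rewrite (form_scale _ _ _ _ cp) => K2.
have c2 : c ^+ 2 != 0 by rewrite expf_neq0 // gt_eqF.
have l02 : lam0 ^+ 2 != 0 by rewrite expf_neq0 // gt_eqF.
apply: (mulfI c2); apply: (mulfI l02); rewrite K2.
by field; rewrite gt_eqF.
Qed.

End Moments.

(** * The rational functions gD and gV *)

Section Excess.
Variable R : realFieldType.
Implicit Types lam k t e d s : R.

(** The characteristic polynomial of the quotient matrix of the quasi-complete graph for its classes
    of sizes t, k - t and 1. The fraction [numD / denD] is lam times the sum of the entries of (lam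
    - A)^-1, minus the number k + 1 of vertices. *)
Definition denD k t lam :=
  lam ^+ 3 - (k - 2) * lam ^+ 2 - (k + t - 1) * lam + t * (k - t - 1).
Definition numD k t lam :=
  (k ^+ 2 - k + 2 * t) * lam ^+ 2 + (k ^+ 2 - k + t ^+ 2 + 3 * t) * lam
  - (k + 1) * t * (k - t - 1).
Definition gD k t lam := numD k t lam / denD k t lam.
Definition gV e lam := e * (2 * lam + 1 + e) / (lam ^+ 2 - e).

Lemma denD_gt0 k t lam : 0 <= t -> t + 1 <= k -> k <= lam -> 0 < denD k t lam.
Proof.
move=> t0 tk kl; rewrite /denD.
(* In the nonnegative variables [t], [j], [y] all coefficients turn out positive. *)
pose j := k - t - 1; pose y := lam - k.
have j0 : 0 <= j by rewrite /j; lra.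
have y0 : 0 <= y by rewrite /y; lra.
have ek : k = t + 1 + j by rewrite /j; ring.
have el : lam = t + 1 + j + y by rewrite /y /j; ring.
clearbody j y; rewrite el ek.
have -> : (t + 1 + j + y) ^+ 3 - (t + 1 + j - 2) * (t + 1 + j + y) ^+ 2
   - (t + 1 + j + t - 1) * (t + 1 + j + y) + t * (t + 1 + j - t - 1) =
   t ^+ 2 * y + 2 * t * j + 2 * t * j * y + 2 * t + 4 * t * y + 2 * t * y ^+ 2
   + j ^+ 2 + j ^+ 2 * y + 3 * j + 5 * j * y + 2 * j * y ^+ 2 + 5 * y
   + 4 * y ^+ 2 + y ^+ 3 + 2 by ring.
by apply: ltr_wpDl; rewrite ?ltr0n // !(addr_ge0, mulr_ge0, exprn_ge0) ?ler0n.
Qed.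

Lemma starred_star e lam : lam ^+ 2 - e != 0 -> starred lam e e = gV e lam.
Proof. by move=> h; rewrite /starred /gV; field. Qed.

Lemma gD_clique k lam : lam != 0 -> lam + 1 != 0 -> lam - k + 1 != 0 ->
  gD k 0 lam = k * (k - 1) / (lam - k + 1).
Proof.
move=> h1 h2 h3.
have dE : denD k 0 lam = lam * (lam + 1) * (lam - k + 1) by rewrite /denD; ring.
have nE : numD k 0 lam = lam * (lam + 1) * (k * (k - 1)) by rewrite /numD; ring.
by rewrite /gD dE nE; field; rewrite h1 h2 h3.
Qed.

(** Deleting a vertex of degree k from the quasi-complete graph of parameters k, t + 1 leaves the
    one of parameters k - 1, t on its k neighbours. By a Schur complement [lam ^+ 2 - s] is lam
    times the ratio of the two characteristic polynomials. *)
Lemma starred_gD k t lam : 0 <= t -> t + 2 <= k -> k <= lam ->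
  k + gD (k - 1) t lam < lam ^+ 2 /\
  starred lam k (k + gD (k - 1) t lam) = gD k (t + 1) lam.
Proof.
move=> t0 tk kl.
have d1 : 0 < denD (k - 1) t lam by apply: denD_gt0; lra.
have d2 : 0 < denD k (t + 1) lam by apply: denD_gt0; lra.
have lp : 0 < lam by lra.
have E : lam ^+ 2 - (k + gD (k - 1) t lam) =
   lam * (lam + 1) * denD k (t + 1) lam / denD (k - 1) t lam.
  apply: (mulIf (lt0r_neq0 d1)); rewrite divfK ?lt0r_neq0 // /gD mulrBl mulrDl.
  by rewrite divfK ?lt0r_neq0 // /denD /numD; ring.
have p : 0 < lam ^+ 2 - (k + gD (k - 1) t lam).
  by rewrite E divr_gt0 // !mulr_gt0 // ltr_wpDl // ltW.
split; first by rewrite -subr_gt0.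
rewrite /starred E /gD; apply: (mulIf (lt0r_neq0 d2)); rewrite divfK ?lt0r_neq0 //.
rewrite mulrBl invf_div.
have l1 : lam + 1 != 0 by rewrite lt0r_neq0 // ltr_wpDl // ltW.
have -> : (lam + 1) ^+ 2 * (k + numD (k - 1) t lam / denD (k - 1) t lam) *
   (denD (k - 1) t lam / (lam * (lam + 1) * denD k (t + 1) lam)) * denD k (t + 1) lam
   = (lam + 1) * (k * denD (k - 1) t lam + numD (k - 1) t lam) / lam.
  by field; rewrite !lt0r_neq0 // ltr_wpDl // ltW.
apply: (mulIf (lt0r_neq0 lp)); rewrite mulrBl divfK ?lt0r_neq0 // /numD /denD; ring.
Qed.

Lemma starred_clique k lam : 2 <= k -> k <= lam ->
  k - 1 + gD (k - 1) 0 lam < lam ^+ 2 /\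
  starred lam (k - 1) (k - 1 + gD (k - 1) 0 lam) = gD k 0 lam.
Proof.
move=> k2 kl; have lp : 0 < lam by lra.
rewrite !gD_clique ?lt0r_neq0 //; try lra.
set D := lam - (k - 1) + 1; have D0 : 0 < D by rewrite /D; lra.
have E : lam ^+ 2 - (k - 1 + (k - 1) * (k - 1 - 1) / D) = lam * (lam + 1) * (lam - k + 1) / D.
  by rewrite /D in D0 *; field; rewrite lt0r_neq0.
have l1 : 0 < lam + 1 by lra. have lk : 0 < lam - k + 1 by lra.
have p : 0 < lam ^+ 2 - (k - 1 + (k - 1) * (k - 1 - 1) / D).
  by rewrite E divr_gt0 // !mulr_gt0.
split; first by rewrite -subr_gt0.
rewrite /starred E; rewrite /D in D0 *; field.
by rewrite !lt0r_neq0.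
Qed.

(** Degrees are at most k, so w_j <= 2 e k^(j-1) for the walk counts. The bound is proportional to
    the number of edges, as the interpolation between degrees requires. *)
Lemma gD_le k t lam : 0 <= t -> t + 1 <= k -> k < lam ->
  gD k t lam <= (k ^+ 2 - k + 2 * t) / (lam - k).
Proof.
move=> t0 tk kl; have d : 0 < denD k t lam by apply: denD_gt0; lra.
rewrite /gD ler_pdivrMr // mulrAC ler_pdivlMr ?subr_gt0 // /numD /denD.
pose j := k - t - 1; pose y := lam - k.
have j0 : 0 <= j by rewrite /j; lra.
have y0 : 0 <= y by rewrite /y; lra.
have ek : k = t + 1 + j by rewrite /j; ring.
have el : lam = t + 1 + j + y by rewrite /y /j; ring.
clearbody j y; rewrite el ek.
rewrite -subr_ge0.
have -> : ((t + 1 + j) ^+ 2 - (t + 1 + j) + 2 * t) * ((t + 1 + j + y) ^+ 3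
   - (t + 1 + j - 2) * (t + 1 + j + y) ^+ 2
   - (t + 1 + j + t - 1) * (t + 1 + j + y) + t * (t + 1 + j - t - 1))
   - (((t + 1 + j) ^+ 2 - (t + 1 + j) + 2 * t) * (t + 1 + j + y) ^+ 2
     + ((t + 1 + j) ^+ 2 - (t + 1 + j) + t ^+ 2 + 3 * t) * (t + 1 + j + y)
     - (t + 1 + j + 1) * t * (t + 1 + j - t - 1)) * (t + 1 + j + y - (t + 1 + j)) =
   2 * t ^+ 3 * j + 2 * t ^+ 3 + 5 * t ^+ 2 * j ^+ 2 + 13 * t ^+ 2 * j
   + 4 * t ^+ 2 * j * y + 8 * t ^+ 2 + 4 * t ^+ 2 * y + 4 * t * j ^+ 3
   + 13 * t * j ^+ 2 + 6 * t * j ^+ 2 * y + 15 * t * j + 14 * t * j * y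
   + 2 * t * j * y ^+ 2 + 6 * t + 8 * t * y + 2 * t * y ^+ 2 + j ^+ 4
   + 4 * j ^+ 3 + 2 * j ^+ 3 * y + 5 * j ^+ 2 + 5 * j ^+ 2 * y
   + j ^+ 2 * y ^+ 2 + 2 * j + 3 * j * y + j * y ^+ 2 by ring.
by rewrite !(addr_ge0, mulr_ge0, exprn_ge0) ?ler0n.
Qed.

Definition psi_poly k t lam :=
  ((k - 1) * (k - 2) * (k ^+ 2 - 3 * k + 4 * t)) * lam ^+ 3
  - (k ^+ 5 - 6 * k ^+ 4 + k ^+ 3 * (4 * t + 15) - k ^+ 2 * (20 * t + 18)
     + k * (8 * t ^+ 2 + 24 * t + 8) - (4 * t ^+ 2 + 12 * t)) * lam ^+ 2
  - ((k ^+ 2 - k + 2 * t)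
     * (k ^+ 3 + k ^+ 2 * (t - 4) - k * (3 * t - 5)
        + (4 * t ^+ 2 - 2 * t - 2))) * lam
  + t * (k - t - 1) * (k ^+ 2 - 3 * k + 2 * t) * (k ^+ 2 - k + 2 * t).

Lemma gD_sub_gV k t e lam : 2 * e = k ^+ 2 - k + 2 * t ->
  denD k t lam != 0 -> lam ^+ 2 - e != 0 ->
  gD k t lam - gV e lam = - psi_poly k t lam / (4 * (denD k t lam * (lam ^+ 2 - e))).
Proof.
move=> he h1 h2.
have E : 4 * (numD k t lam * (lam ^+ 2 - e) - e * (2 * lam + 1 + e) * denD k t lam)
   = - psi_poly k t lam.
  have -> : e = (k ^+ 2 - k + 2 * t) / 2 by rewrite -he; field.
  by rewrite /numD /denD /psi_poly; field.
by rewrite -E /gD /gV; field; rewrite h1 h2.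
Qed.

End Excess.

(** * Integer certificates for polynomial inequalities *)

(* Polynomials are lists of coefficients, lowest degree first. *)
Section IntPoly.
Local Open Scope Z_scope.
Implicit Types (p q : seq Z) (a b c : Z).

Fixpoint padd p q :=
  match p, q with
  | [::], _ => q
  | _, [::] => p
  | a :: p', b :: q' => (a + b) :: padd p' q'
  end.
Definition pscale c p := map (Z.mul c) p.
Fixpoint pmul p q :=
  if p is a :: p' then padd (pscale a q) (0 :: pmul p' q) else [::].
Definition psub p q := padd p (pscale (-1) q).
Definition pshift c p := foldr (fun a s => padd [:: a] (padd (pscale c s) (0 :: s))) [::] p.
Fixpoint pdilate w u p := if p is a :: p' then a * u :: pdilate w (w * u) p' else [::].
(** A power of [w] times p(x / w), which has integer coefficients again; thresholds may thus be
    fractions with denominator [w]. *)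
Definition phom w p := rev (pdilate w 1 (rev p)).

Definition all_nonneg p := all (fun a => 0 <=? a) p.
Definition pos_head p := if p is a :: p' then (0 <? a) && all_nonneg p' else false.
Definition pos_ray p c := pos_head (pshift c p).
(** The substitution that turns the segment into a ray sends the end [a] to infinity, which is why
    the constant coefficient of [q] has a test of its own. *)
Definition pos_segment p a c :=
  let q := pdilate (c - a) 1 (pshift a p) in
  (0 <? head 0 q) && pos_head (pshift 1 (rev q)).
End IntPoly.

Section Eval.
Variable R : realFieldType.
Implicit Types (p q : seq Z) (a b c : Z) (x y : R).

Definition zr a : R := (int_of_Z a)%:~R.
Definition peval p x : R := foldr (fun a s => zr a + x * s) 0 p.

Lemma zr0 : zr 0 = 0. Proof. by []. Qed.
Lemma zr1 : zr 1 = 1. Proof. by []. Qed.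
Lemma zrD a b : zr (Z.add a b) = zr a + zr b.
Proof. by rewrite /zr -intrD -rmorphD. Qed.
Lemma zrM a b : zr (Z.mul a b) = zr a * zr b.
Proof. by rewrite /zr -intrM -rmorphM. Qed.
Lemma zrN a : zr (Z.opp a) = - zr a.
Proof. by rewrite /zr -[Z.opp a]/(- a) !rmorphN. Qed.
Lemma zrB a b : zr (Z.sub a b) = zr a - zr b.
Proof. by rewrite -zrN -zrD. Qed.
Lemma zr_nat n : zr (Z.of_nat n) = n%:R.
Proof. by rewrite /zr -[Z.of_nat n]/(Z_of_int n%:Z) Z_of_intK. Qed.
Lemma zr_ge0 a : Z.leb 0 a -> 0 <= zr a.
Proof. by rewrite /zr ler0z; case: a. Qed.
Lemma zr_gt0 a : Z.ltb 0 a -> 0 < zr a.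
Proof. by rewrite /zr ltr0z; case: a => //= p; lia. Qed.

Lemma peval_add p q x : peval (padd p q) x = peval p x + peval q x.
Proof.
elim: p q => [|a p IH] [|b q] //=; rewrite ?add0r ?addr0 //.
by rewrite IH zrD; ring.
Qed.

Lemma peval_scale c p x : peval (pscale c p) x = zr c * peval p x.
Proof. by elim: p => [|a p IH] /=; rewrite ?mulr0 // IH zrM; ring. Qed.

Lemma peval_mul p q x : peval (pmul p q) x = peval p x * peval q x.
Proof.
by elim: p => [|a p IH] /=; rewrite ?mul0r // peval_add peval_scale /= IH zr0; ring.
Qed.

Lemma peval_sub p q x : peval (psub p q) x = peval p x - peval q x.
Proof. by rewrite /psub peval_add peval_scale (zrN 1) zr1; ring. Qed.

Lemma peval_shift c p x : peval (pshift c p) x = peval p (zr c + x).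
Proof.
elim: p => [|a p IH] //.
rewrite -[pshift c (a :: p)]/(padd [:: a] (padd (pscale c (pshift c p)) (Z0 :: pshift c p))).
by rewrite !peval_add peval_scale /= IH zr0; ring.
Qed.

Lemma peval_dilate w u p x : peval (pdilate w u p) x = zr u * peval p (zr w * x).
Proof. by elim: p u => [|a p IH] u /=; rewrite ?mulr0 // IH !zrM; ring. Qed.

Lemma peval_rcons p a x : peval (rcons p a) x = peval p x + x ^+ size p * zr a.
Proof. by elim: p => [|b p IH] /=; rewrite ?expr0 ?exprS ?IH; ring. Qed.

Lemma peval_rev p x : x != 0 -> x * peval (rev p) x = x ^+ size p * peval p x^-1.
Proof.
move=> x0; elim: p => [|a p IH]; first by rewrite /= mulr0 mulr0.
rewrite rev_cons peval_rcons mulrDr IH size_rev /= exprS.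
by rewrite [RHS]mulrDr addrC; congr (_ + _); [ring | field].
Qed.

Lemma peval_hom w p x : x != 0 -> zr w != 0 ->
  zr w * peval (phom w p) (zr w * x) = zr w ^+ size p * peval p x.
Proof.
move=> x0 w0; have wx0 : zr w * x != 0 by rewrite mulf_neq0.
apply: (mulfI x0); rewrite mulrA [x * zr w]mulrC /phom peval_rev // peval_dilate zr1 mul1r.
rewrite [size _](_ : _ = size p); last first.
  by rewrite -(size_rev p); elim: (rev p) (Zpos xH) => //= a q IH u; rewrite IH.
have -> : zr w * (zr w * x)^-1 = x^-1 by field; rewrite x0.
rewrite exprMn -mulrA [RHS]mulrCA; congr (_ * _).
have := @peval_rev p x^-1 (invr_neq0 x0).
rewrite invrK => E.
have -> : peval (rev p) x^-1 = x * (x^-1 * peval (rev p) x^-1) by rewrite mulrA mulfV // mul1r.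
rewrite E exprVn; rewrite mulrCA [x ^+ _ * _]mulrA mulfV ?expf_neq0 // mul1r //.
Qed.

Lemma all_nonneg_ge0 p x : all_nonneg p -> 0 <= x -> 0 <= peval p x.
Proof.
move=> + x0; elim: p => [|a p IH] //= /andP[a0 /IH p0].
by rewrite addr_ge0 ?zr_ge0 // mulr_ge0.
Qed.

Lemma pos_head_gt0 p x : pos_head p -> 0 <= x -> 0 < peval p x.
Proof.
case: p => [|a p] //= /andP[a0 p0] x0.
by rewrite ltr_wpDr ?zr_gt0 // mulr_ge0 ?all_nonneg_ge0.
Qed.

Lemma pos_ray_gt0 p c x : pos_ray p c -> zr c <= x -> 0 < peval p x.
Proof.
move=> h cx; have -> : x = zr c + (x - zr c) by ring.
by rewrite -peval_shift pos_head_gt0 // subr_ge0.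
Qed.

(* Bernstein's criterion: y = 1/theta - 1 maps theta in ]0, 1] to y >= 0. *)
Lemma pos_segment_gt0 p a c x : pos_segment p a c -> zr a <= x -> x <= zr c ->
  0 < peval p x.
Proof.
rewrite /pos_segment; set q := pdilate _ _ _ => /andP[h0 h1] ax xc.
have [eax|nax] := eqVneq x (zr a).
  rewrite eax; have -> : zr a = zr a + 0 by ring.
  rewrite -peval_shift; move: h0; rewrite /q.
  case: (pshift a p) => [|b s] //= h; rewrite mul0r addr0.
  by apply: zr_gt0; move: h; rewrite Z.mul_1_r.
have lt_ax : zr a < x by rewrite lt_neqAle eq_sym nax.
pose w := zr c - zr a; have w0 : 0 < w by rewrite /w; lra.
pose z := (x - zr a) / w.
have z0 : 0 < z by rewrite /z divr_gt0 // subr_gt0.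
have z1 : z <= 1 by rewrite /z ler_pdivrMr // mul1r /w lerD2r.
have -> : peval p x = peval q z.
  rewrite /q peval_dilate zr1 mul1r zrB -/w peval_shift; congr peval.
  by rewrite /z mulrC divfK ?lt0r_neq0 // addrC subrK.
have y0 : 0 <= z^-1 - 1 by rewrite subr_ge0 invf_ge1.
have := pos_head_gt0 h1 y0; rewrite peval_shift zr1.
have -> : 1 + (z^-1 - 1) = z^-1 by ring.
have zi : z^-1 != 0 by rewrite invr_neq0 // lt0r_neq0.
have := peval_rev q zi; rewrite invrK => E H.
have : 0 < z^-1 * peval (rev q) z^-1 by rewrite mulr_gt0 ?invr_gt0.
have e0 : 0 < z^-1 ^+ size q by rewrite exprn_gt0 // invr_gt0.
by rewrite E (pmulr_rgt0 _ e0).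
Qed.

Lemma peval_hom_gt0 w p x : 0 < x -> 0 < zr w ->
  (0 < peval (phom w p) (zr w * x)) = (0 < peval p x).
Proof.
move=> x0 w0; rewrite -(pmulr_rgt0 (peval (phom w p) _) w0) peval_hom ?lt0r_neq0 //.
by rewrite pmulr_rgt0 // exprn_gt0.
Qed.

End Eval.

(** Computes k_e and t_e by recursion, in a form suited to evaluation. It starts with k = 1 because
    'C(1, 2) = 0. *)
Fixpoint tri (e : nat) : nat * nat :=
  if e is e'.+1 then
    let: (k, t) := tri e' in if t.+1 == k then (k.+1, 0%N) else (k, t.+1)
  else (1, 0)%N.

Lemma bin2S n : 'C(n.+1, 2) = ('C(n, 2) + n)%N.
Proof. by rewrite binS bin1. Qed.

Lemma tri_spec e : (e = 'C((tri e).1, 2) + (tri e).2 /\ (tri e).2 < (tri e).1)%N.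
Proof.
elim: e => //= e; case: (tri e) => k t /= [{1}-> tk].
case: eqP => [<-|/eqP tk'] /=; first by rewrite (bin2S t.+1); lia.
by rewrite addnS ltn_neqAle tk' tk.
Qed.

Lemma bin2_mono m n : (m <= n -> 'C(m, 2) <= 'C(n, 2))%N.
Proof. by move=> mn; rewrite leq_bin2l. Qed.

Lemma k_E e : k_ e = (tri e).1.
Proof.
have [e1 tk] := tri_spec e; set k := (tri e).1 in e1 tk *.
apply/eqP; rewrite eqn_leq; apply/andP; split.
  apply/bigmax_leqP => i; apply: contraLR; rewrite -!ltnNge => ki.
  by have := bin2_mono ki; rewrite bin2S; lia.
have ke : (k < e.+2)%N.
  by case: k e1 tk => [|[|k]] //; rewrite bin2S; lia.
have := @leq_bigmax_cond _ (fun k : 'I_e.+2 => ('C(k, 2) <= e)%N) (fun k => k : nat) (Ordinal ke).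
by apply; rewrite /= e1 leq_addr.
Qed.

Lemma t_E e : t_ e = (tri e).2.
Proof. by rewrite /t_ k_E; have [e1 _] := tri_spec e; lia. Qed.

Lemma tri_k_mono e e' : (e' <= e)%N -> ((tri e').1 <= (tri e).1)%N.
Proof.
move=> ee; have [e1 t1] := tri_spec e; have [e2 t2] := tri_spec e'.
rewrite leqNgt; apply/negP => kk; have := bin2_mono kk.
by rewrite bin2S; lia.
Qed.

(** * Certificates for a given number of edges *)

Section Check.
Local Open Scope Z_scope.
Implicit Types (k t e d c : Z) (S D : seq Z).

Definition denP k t : seq Z := [:: t * (k - t - 1); - (k + t - 1); - (k - 2); 1].
Definition numP k t : seq Z :=
  [:: - ((k + 1) * t * (k - t - 1)); k * k - k + t * t + 3 * t; k * k - k + 2 * t].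
Definition starredP d S D :=
  let f := psub (0 :: 0 :: D) S in (psub (pmul [:: 1; 2; 1] S) (pscale d f), f).

(* S / D bounds d + (excess of the rest); 16 c separates the range of lam where
   the quasi-complete graph is used from that where the star is used. *)
Definition check k t e c d S D :=
  let: (n, f) := starredP d S D in
  [&& pos_ray D k, pos_ray f k,
      pos_ray (phom 16 (psub (pmul [:: e * (1 + e); 2 * e] f) (pmul n [:: - e; 0; 1]))) c
    & pos_segment (phom 16 (psub (pmul (numP k t) f) (pmul n (denP k t)))) (16 * k) c].

Definition zeval p a := foldr (fun b s => b + a * s) 0 p.

(** This and [check_linear] test the two majorants of the rest, gV and the linear bound on gD, at a
    single degree [d]; convexity carries the result to all larger degrees. *)
Definition check_star k t e c d :=
  let e' := e - d in
  check k t e c d [:: e' * (1 + e') - d * e'; 2 * e'; d] [:: - e'; 0; 1].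

Definition check_linear k t e c d h :=
  check k t e c d [:: 2 * (e - d) - h * d; d] [:: - h; 1].

(** Here [q1 / q2] is the value G0 at k' + 1 from which [form_extrapolate] starts and [n1 / (d - 1)]
    is de Caen's bound on [d] vertices; the extrapolated G is [q1 * n1] over [A]. *)
Definition check_extrapolate k t e c d k' t' :=
  let e' := e - d in
  let q2 := zeval (denP k' t') (k' + 1) in
  let q1 := (k' + 1) * zeval (numP k' t') (k' + 1) - 2 * e' * q2 in
  let n1 := e' * (2 * e' + (d - 1) * (d - 2)) in
  let A := [:: q2 * n1 - q1 * (d - 1) * (k' + 1); q1 * (d - 1)] in
  (0 <? q1) && check k t e c d (padd (pmul [:: 2 * e'; d] A) [:: q1 * n1]) (0 :: A).

Definition psiP k t : seq Z :=
  [:: t * (k - t - 1) * (k * k - 3 * k + 2 * t) * (k * k - k + 2 * t);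
      - ((k * k - k + 2 * t) * (k * k * k + k * k * (t - 4) - k * (3 * t - 5)
          + (4 * (t * t) - 2 * t - 2)));
      - (k * k * k * k * k - 6 * (k * k * k * k) + k * k * k * (4 * t + 15)
         - k * k * (20 * t + 18) + k * (8 * (t * t) + 24 * t + 8)
         - (4 * (t * t) + 12 * t));
      (k - 1) * (k - 2) * (k * k - 3 * k + 4 * t)].

(** Whatever the sign of [p1], the quotient q(y) / y is then increasing on y > 0, so the cubic q
    changes sign exactly once there. *)
Definition cubic_signs (p : seq Z) :=
  if p is [:: p0; p1; p2; p3] then [&& p0 <? 0, 0 <=? p2 & 0 <? p3] else false.
Definition check_psi k t :=
  (zeval (psiP k t) (k + 1) <? 0) && cubic_signs (pshift k (psiP k t)).
End Check.

(** The degrees [d0] and [e] carry no certificate: there the quasi-complete graph and the star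
    attain equality. *)
Definition check_edges (e c d1 : nat) : bool :=
  let: (k, t) := tri e in
  let d0 := if t == 0%N then k.-1 else k in
  let K := Z.of_nat k in let T := Z.of_nat t in
  let E := Z.of_nat e in let C := Z.of_nat c in
  [&& check_psi K T, (d0 < d1 <= e)%N,
      (d1 == e) || check_star K T E C (Z.of_nat d1)
         && check_linear K T E C (Z.of_nat d1) (Z.of_nat (tri (e - d1)).1)
    & all (fun d => let: (k', t') := tri (e - d) in
             check_extrapolate K T E C (Z.of_nat d) (Z.of_nat k') (Z.of_nat t'))
        (iota d0.+1 (d1 - d0.+1))].

(* For e = 4, ..., 130 the pair (c, d1) of check_edges: the inequalities are proved
   against gD for lam <= c / 16 and against gV for lam >= c / 16; removing a vertex of
   degree d is treated by extrapolation for d < d1 and by interpolation between d1 and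
   e for d >= d1. *)
Definition thresholds : seq (nat * nat) :=
  [:: (82, 4); (104, 5); (144, 4); (97, 5); (97, 6); (110, 7); (128, 5);
   (110, 6); (108, 7); (113, 8); (122, 9); (133, 6); (124, 7); (122, 8);
   (124, 9); (129, 10); (136, 11); (144, 7); (138, 8); (136, 9); (137, 10);
   (140, 11); (144, 12); (150, 13); (157, 9); (153, 9); (151, 10); (152, 11);
   (153, 12); (156, 13); (160, 14); (165, 15); (171, 11); (168, 11);
   (167, 12); (167, 12); (168, 13); (170, 14); (173, 15); (176, 16);
   (180, 17); (185, 13); (183, 13); (182, 14); (182, 14); (183, 15);
   (184, 15); (186, 16); (189, 17); (192, 18); (196, 19); (200, 15);
   (198, 15); (198, 16); (197, 16); (198, 17); (199, 17); (201, 17);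
   (203, 18); (205, 19); (208, 20); (212, 21); (215, 17); (214, 18);
   (213, 18); (213, 19); (213, 19); (214, 19); (215, 20); (217, 20);
   (219, 20); (221, 21); (224, 22); (227, 23); (230, 20); (229, 20);
   (229, 21); (229, 21); (229, 22); (229, 22); (230, 22); (232, 23);
   (233, 23); (235, 23); (238, 23); (240, 24); (243, 25); (246, 22);
   (245, 23); (245, 24); (244, 24); (244, 25); (245, 25); (246, 25);
   (247, 25); (248, 26); (250, 26); (252, 26); (254, 26); (256, 26);
   (259, 27); (261, 25); (261, 26); (261, 27); (260, 27); (260, 27);
   (261, 28); (261, 28); (262, 28); (263, 29); (265, 29); (266, 29);
   (268, 29); (270, 29); (272, 29); (274, 29); (277, 28); (276, 29);
   (276, 30); (276, 30); (276, 31); (276, 31); (277, 31); (277, 32);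
   (278, 32); (280, 32); (281, 32)]%N.

Definition check_all :=
  all (fun p => check_edges p.1 p.2.1 p.2.2) (zip (iota 4 127) thresholds).

Lemma check_allT : check_all = true.
Proof. by vm_compute. Qed.

(** * Soundness of the certificates *)

Section Sound.
Local Arguments Z.add : simpl never.
Local Arguments Z.sub : simpl never.
Local Arguments Z.opp : simpl never.
Local Arguments Z.mul : simpl never.
Local Arguments Z.of_nat : simpl never.
Variable R : realFieldType.
Implicit Types (lam x : R) (e d : nat).

Definition kR e : R := (tri e).1%:R.
Definition tR e : R := (tri e).2%:R.
Definition gDe e lam := gD (kR e) (tR e) lam.
Definition gVe e lam := gV (e%:R : R) lam.
Definition gmax e lam : R := Num.max (gDe e lam) (gVe e lam).

Lemma kRtR e : [/\ 1 <= kR e, 0 <= tR e, tR e + 1 <= kR e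
  & 2 * e%:R = kR e ^+ 2 - kR e + 2 * tR e].
Proof.
rewrite /kR /tR; have [e1 tk] := tri_spec e; move: (tri e).1 (tri e).2 e1 tk => k t -> tk.
split; [by rewrite ler1n; case: k tk | exact: ler0n | by rewrite natr1 ler_nat |].
have := mul_bin_diag k 1; rewrite bin1; case: k tk => // k _ /= /(congr1 (fun n => n%:R : R)).
by rewrite natrD !natrM -!natr1 => h; rewrite mulrDr -h; ring.
Qed.

Lemma edges_lt_sqr e lam : kR e <= lam -> 0 < lam ^+ 2 - e%:R.
Proof.
move=> kl; have [k1 t0 tk e2] := kRtR e.
have : kR e ^+ 2 <= lam ^+ 2 by rewrite ler_pXn2r // nnegrE; lra.
have : 0 <= (kR e - 1) ^+ 2 by apply: sqr_ge0.
by have -> : (kR e - 1) ^+ 2 = kR e ^+ 2 - 2 * kR e + 1 by [ring]; nra.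
Qed.

Lemma starred_le lam (d s s' : R) : 0 <= lam -> s <= s' -> s' < lam ^+ 2 ->
  starred lam d s <= starred lam d s'.
Proof.
move=> l0 ss s'l; have sl := le_lt_trans ss s'l.
rewrite /starred lerD2r ler_pdivrMr ?subr_gt0 // [leRHS]mulrAC ler_pdivlMr ?subr_gt0 //.
rewrite -[leLHS]mulrA -[leRHS]mulrA; apply: (ler_wpM2l (sqr_ge0 (lam + 1))).
have : s * lam ^+ 2 <= s' * lam ^+ 2 by rewrite ler_wpM2r // sqr_ge0.
by lra.
Qed.

Lemma peval_starred (d : Z) S D lam : 0 < peval D lam ->
  0 < peval (starredP d S D).2 lam ->
  let s := peval S lam / peval D lam in
  s < lam ^+ 2 /\
  starred lam (zr R d) s = peval (starredP d S D).1 lam / peval (starredP d S D).2 lam.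
Proof.
move=> D0; pose f := psub [:: Z0, Z0 & D] S.
rewrite -[(starredP d S D).2]/f.
rewrite -[(starredP d S D).1]/(psub (pmul [:: Zpos 1; Zpos 2; Zpos 1] S) (pscale d f)).
move=> f0.
have fE : peval f lam = lam ^+ 2 * peval D lam - peval S lam.
  by rewrite /f peval_sub /= zr0; ring.
have sl : peval S lam / peval D lam < lam ^+ 2 by rewrite ltr_pdivrMr // -subr_gt0 -fE.
split=> //; rewrite peval_sub peval_scale peval_mul fE in f0 *.
rewrite /starred /= zr1 [zr _ (Zpos 2)](_ : _ = 2) //.
by field; rewrite !lt0r_neq0.
Qed.

Lemma peval_denP e lam : peval (denP (Z.of_nat (tri e).1) (Z.of_nat (tri e).2)) lam
  = denD (kR e) (tR e) lam.
Proof.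
rewrite /= !(zrN, zrD, zrB, zrM, zr_nat) !zr1 /denD -/(kR e) -/(tR e).
by rewrite [zr _ (Zpos 2)](_ : _ = 2) //; ring.
Qed.

Lemma peval_numP e lam : peval (numP (Z.of_nat (tri e).1) (Z.of_nat (tri e).2)) lam
  = numD (kR e) (tR e) lam.
Proof.
rewrite /= !(zrN, zrD, zrB, zrM, zr_nat) !zr1 /numD -/(kR e) -/(tR e).
by rewrite [zr _ (Zpos 2)](_ : _ = 2) // [zr _ (Zpos 3)](_ : _ = 3) //; ring.
Qed.

Lemma check_sound e c (d : Z) S D lam :
  check (Z.of_nat (tri e).1) (Z.of_nat (tri e).2) (Z.of_nat e) c d S D ->
  kR e <= lam ->
  [/\ 0 < peval D lam, peval S lam / peval D lam < lam ^+ 2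
    & starred lam (zr R d) (peval S lam / peval D lam) < gmax e lam].
Proof.
move=> + kl; have [k1 t0 tk e2] := kRtR e; have lp : 0 < lam by lra.
have el := edges_lt_sqr kl.
rewrite /check; case E: (starredP d S D) => [n f] /and4P[D0 f0 hV hD].
have kz : zr R (Z.of_nat (tri e).1) <= lam by rewrite zr_nat.
have {}D0 := pos_ray_gt0 D0 kz; have {}f0 := pos_ray_gt0 f0 kz.
have [] := @peval_starred d S D lam D0; rewrite E //= => sl sE.
split=> //; rewrite sE lt_max.
have z16 : zr R (Zpos 16) = 16 by [].
have z16p : 0 < zr R (Zpos 16) by rewrite z16; lra.
have [cl|lc] := leP (zr R c) (16 * lam).
  apply/orP; right; move: hV => /pos_ray_gt0 /(_ cl); rewrite -z16 peval_hom_gt0 //.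
  rewrite peval_sub !peval_mul /= !(zrN, zrD, zrM, zr_nat) !zr1 zr0.
  rewrite [zr _ (Zpos 2)](_ : _ = 2) // => H.
  rewrite ltr_pdivrMr // /gVe /gV mulrAC ltr_pdivlMr // -subr_gt0.
  by move: H; congr (0 < _); ring.
apply/orP; left.
have hk : zr R (Z.mul 16 (Z.of_nat (tri e).1)) <= 16 * lam.
  by rewrite zrM z16 ler_pM2l ?ltr0n.
have := pos_segment_gt0 hD hk (ltW lc).
rewrite -z16 peval_hom_gt0 // peval_sub !peval_mul peval_denP peval_numP => H.
have dp : 0 < denD (kR e) (tR e) lam by apply: denD_gt0.
rewrite ltr_pdivrMr // /gDe /gD mulrAC ltr_pdivlMr // -subr_gt0.
by move: H; congr (0 < _); ring.
Qed.

Lemma zr_zeval p (a : Z) : zr R (zeval p a) = peval p (zr R a).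
Proof. by elim: p => [|b p IH] //=; rewrite zrD zrM IH. Qed.

Lemma inv_convex (u v th : R) : 0 < u -> 0 < v -> 0 <= th -> th <= 1 ->
  ((1 - th) * u + th * v)^-1 <= (1 - th) / u + th / v.
Proof.
move=> u0 v0 th0 th1.
have w0 : 0 < (1 - th) * u + th * v.
  have [->|thn] := eqVneq th 0; first by rewrite subr0 mul1r mul0r addr0.
  have thp : 0 < th by rewrite lt0r thn.
  by apply: ltr_wpDl; [rewrite mulr_ge0 ?subr_ge0 // ltW | exact: mulr_gt0].
rewrite -subr_ge0.
have -> : (1 - th) / u + th / v - ((1 - th) * u + th * v)^-1 =
  th * (1 - th) * (u - v) ^+ 2 / (u * v * ((1 - th) * u + th * v)).
  by field; rewrite !lt0r_neq0.
apply: divr_ge0; last by apply/ltW/mulr_gt0 => //; apply: mulr_gt0.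
by rewrite mulr_ge0 ?sqr_ge0 // mulr_ge0 ?subr_ge0.
Qed.

(* d |-> starred lam d (d + C (e - d)) is convex, and at d = e it is the value
   for the star. *)
Lemma starred_interpolate lam (e d1 d C g : R) : 0 < lam ^+ 2 - e ->
  d1 <= d -> d < e -> d1 + C * (e - d1) < lam ^+ 2 ->
  starred lam d1 (d1 + C * (e - d1)) < g -> gV e lam <= g ->
  d + C * (e - d) < lam ^+ 2 /\ starred lam d (d + C * (e - d)) < g.
Proof.
move=> el d1d de s1l F1 Fe.
set s1 := d1 + _ in s1l F1; set s := d + _.
pose th := (e - d) / (e - d1).
have ed1 : 0 < e - d1 by lra.
have th0 : 0 < th by rewrite /th divr_gt0 // subr_gt0.
have th1 : th <= 1 by rewrite /th ler_pdivrMr // mul1r lerD2l lerN2.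
have dE : d = (1 - th) * e + th * d1 by rewrite /th; field; rewrite lt0r_neq0.
have sE : lam ^+ 2 - s = (1 - th) * (lam ^+ 2 - e) + th * (lam ^+ 2 - s1).
  by rewrite /s /s1 /th; field; rewrite lt0r_neq0.
have v0 : 0 < lam ^+ 2 - s1 by rewrite subr_gt0.
have s0 : 0 < lam ^+ 2 - s.
  rewrite sE; apply: ltr_wpDl; last exact: mulr_gt0.
  by rewrite mulr_ge0 ?subr_ge0 // -subr_ge0 ltW.
split; first by rewrite -subr_gt0.
have stE x z : 0 < lam ^+ 2 - z ->
    starred lam x z = (lam + 1) ^+ 2 * (lam ^+ 2 * (lam ^+ 2 - z)^-1 - 1) - x.
  by move=> z0; rewrite /starred; field; rewrite lt0r_neq0.
rewrite -(starred_star (lt0r_neq0 el)) in Fe.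
rewrite stE // in F1; rewrite stE // in Fe; rewrite stE //.
have cv := inv_convex el v0 (ltW th0) th1; rewrite -sE in cv.
set X := (lam ^+ 2 - s)^-1 in cv *; set U := (lam ^+ 2 - e)^-1 in cv Fe.
set V := (lam ^+ 2 - s1)^-1 in cv F1.
set L := (lam + 1) ^+ 2 * lam ^+ 2.
have L0 : 0 <= L by rewrite mulr_ge0 ?sqr_ge0.
have {}cv : L * X <= (1 - th) * (L * U) + th * (L * V).
  by apply: le_trans (ler_wpM2l L0 cv) _; rewrite le_eqVlt; apply/orP; left; apply/eqP; ring.
have F1' : th * (L * V - (lam + 1) ^+ 2 - d1) < th * g by rewrite ltr_pM2l //; rewrite /L; lra.
have Fe' : (1 - th) * (L * U - (lam + 1) ^+ 2 - e) <= (1 - th) * g.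
  by rewrite ler_wpM2l ?subr_ge0 //; rewrite /L; lra.
have -> : (lam + 1) ^+ 2 * (lam ^+ 2 * X - 1) - d = L * X - (lam + 1) ^+ 2 - d by rewrite /L; ring.
have : (1 - th) * (L * U - (lam + 1) ^+ 2 - e) + th * (L * V - (lam + 1) ^+ 2 - d1) < g by lra.
by move: dE cv; lra.
Qed.

(** The least possible degree of a dominating vertex: its d neighbours and itself span all e edges,
    so e <= 'C(d + 1, 2). *)
Definition clique_deg e : nat := if (tri e).2 == 0%N then (tri e).1.-1 else (tri e).1.

(** Both gV and gD for e - d edges lie below [C * (e - d)] with a slope [C] computed at [d1]: the
    slopes increase with the number of edges, hence are largest at [d1]. The majorant is then affine
    in [d], as [starred_interpolate] demands. *)
Lemma check_tail e d1 d (c : Z) lam g' : (d1 <= d)%N -> (d < e)%N ->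
  check_star (Z.of_nat (tri e).1) (Z.of_nat (tri e).2) (Z.of_nat e) c (Z.of_nat d1) ->
  check_linear (Z.of_nat (tri e).1) (Z.of_nat (tri e).2) (Z.of_nat e) c (Z.of_nat d1)
    (Z.of_nat (tri (e - d1)).1) ->
  kR e <= lam -> g' <= gmax (e - d) lam ->
  d%:R + g' < lam ^+ 2 /\ starred lam d%:R (d%:R + g') < gmax e lam.
Proof.
move=> d1d de hS hL kl gle.
have [k1 t0 tk e2] := kRtR e; have lp : 0 < lam by lra.
have el := edges_lt_sqr kl.
have [D1 s1 F1] := check_sound hS kl; have [D2 s2 F2] := check_sound hL kl.
rewrite !zr_nat in F1 F2.
pose e' : R := e%:R - d%:R; pose e1 : R := e%:R - d1%:R.
have d1dR : d1%:R <= d%:R :> R by rewrite ler_nat.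
have deR : d%:R < e%:R :> R by rewrite ltr_nat.
have e'E : (e - d)%:R = e' by rewrite natrB // ltnW.
rewrite /= !(zrB, zrD, zrN, zrM, zr_nat) zr1 ?zr0 -/e1 in D1 s1 F1.
rewrite /= !(zrB, zrD, zrN, zrM, zr_nat) zr1 ?zr0 -/e1 in D2 s2 F2.
rewrite [zr _ (Zpos 2)](_ : _ = 2) // in s1 F1.
rewrite [zr _ (Zpos 2)](_ : _ = 2) // in s2 F2.
set h : R := _.1%:R in D2 s2 F2.
have {}D1 : 0 < lam ^+ 2 - e1 by move: D1; congr (0 < _); ring.
have {}D2 : 0 < lam - h by move: D2; congr (0 < _); ring.
pose C1 := (2 * lam + 1 + e1) / (lam ^+ 2 - e1); pose C2 := 2 / (lam - h).
have E1 : (e1 * (1 + e1) - d1%:R * e1 + lam * (2 * e1 + lam * (d1%:R + lam * 0))) /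
   (- e1 + lam * (0 + lam * (1 + lam * 0))) = d1%:R + C1 * e1.
  have -> : - e1 + lam * (0 + lam * (1 + lam * 0)) = lam ^+ 2 - e1 by ring.
  by rewrite /C1; field; rewrite lt0r_neq0.
have E2 : (2 * e1 - h * d1%:R + lam * (d1%:R + lam * 0)) / (- h + lam * (1 + lam * 0))
   = d1%:R + C2 * e1.
  have -> : - h + lam * (1 + lam * 0) = lam - h by ring.
  by rewrite /C2; field; rewrite lt0r_neq0.
rewrite {}E1 in s1 F1; rewrite {}E2 in s2 F2.
have gVm : gV e%:R lam <= gmax e lam by rewrite le_max lexx orbT.
have [I1 J1] := starred_interpolate el d1dR deR s1 F1 gVm.
have [I2 J2] := starred_interpolate el d1dR deR s2 F2 gVm.
have e'p : 0 < e' by rewrite subr_gt0.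
have e'1 : e' <= e1 by rewrite lerD2l lerN2.
have gV' : gVe (e - d) lam <= C1 * e'.
  rewrite /gVe e'E /gV -mulrA [C1 * e']mulrC; apply: ler_wpM2l; first exact: ltW.
  have D1' : lam ^+ 2 - e1 <= lam ^+ 2 - e' by rewrite lerD2l lerN2.
  apply: ler_pM; rewrite ?invr_ge0 ?lerD2l ?lef_pV2 ?posrE //.
  - apply: addr_ge0 (ltW e'p); apply: addr_ge0 => //; apply: mulr_ge0 => //.
    exact: ltW.
  - exact: le_trans (ltW D1) D1'.
  - by rewrite lerN2.
  - exact: lt_le_trans D1 D1'.
have gD' : gDe (e - d) lam <= C2 * e'.
  have [k1' t0' tk' e2'] := kRtR (e - d).
  have kh : kR (e - d) <= h by rewrite ler_nat tri_k_mono // leq_sub2l.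
  have kl' : kR (e - d) < lam by rewrite (le_lt_trans kh) // -subr_gt0.
  apply: le_trans (gD_le t0' tk' kl') _; rewrite -e2' e'E /C2 [leLHS]mulrAC.
  apply: ler_wpM2r; first exact: ltW.
  by apply: ler_wpM2l => //; rewrite lef_pV2 ?posrE ?subr_gt0 ?lerD2l ?lerN2 // -subr_gt0.
have : g' <= C1 * e' \/ g' <= C2 * e'.
  by move: gle; rewrite le_max => /orP[] ?; [right|left]; apply: le_trans; eassumption.
have fin C : d%:R + C * e' < lam ^+ 2 -> starred lam d%:R (d%:R + C * e') < gmax e lam ->
    g' <= C * e' -> d%:R + g' < lam ^+ 2 /\ starred lam d%:R (d%:R + g') < gmax e lam.
  move=> sl F gC; have le_s : d%:R + g' <= d%:R + C * e' by rewrite lerD2l.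
  split; first exact: le_lt_trans sl.
  by apply: le_lt_trans F; apply: starred_le => //; apply: ltW.
by case; apply: fin.
Qed.

End Sound.

Section Sound.
Local Arguments Z.add : simpl never.
Local Arguments Z.sub : simpl never.
Local Arguments Z.opp : simpl never.
Local Arguments Z.mul : simpl never.
Local Arguments Z.of_nat : simpl never.
Local Arguments zeval : simpl never.
Variable R : realFieldType.
Implicit Types (lam x : R) (e d : nat).

Lemma zr_pos (n : nat) (p : positive) : Pos.to_nat p = n -> zr R (Zpos p) = n%:R.
Proof. by rewrite /zr /= => ->. Qed.

(** In the walk series of the excess the term of length 1 is 2 e / lam; this is lam times the
    remainder of the series for D, taken at lam = k_e + 1. *)
Definition gap e : R := (kR R e + 1) * gDe e (kR R e + 1) - 2 * e%:R.
Definition deg_sqr_bound e (m : nat) : R :=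
  (e * (2 * e + (m - 1) * (m - 2)))%:R / (m - 1)%:R.
Definition extrapolated e m lam : R :=
  ((gap e)^-1 + (lam - (kR R e + 1)) / deg_sqr_bound e m)^-1.

Lemma check_extrapolate_sound e d (c : Z) lam : (1 < d < e)%N ->
  check_extrapolate (Z.of_nat (tri e).1) (Z.of_nat (tri e).2) (Z.of_nat e) c (Z.of_nat d)
    (Z.of_nat (tri (e - d)).1) (Z.of_nat (tri (e - d)).2) ->
  kR R e <= lam ->
  [/\ 0 < gap (e - d),
      d%:R + (2 * (e - d)%:R + extrapolated (e - d) d lam) / lam < lam ^+ 2
    & starred lam d%:R (d%:R + (2 * (e - d)%:R + extrapolated (e - d) d lam) / lam)
      < gmax e lam].
Proof.
move=> /andP[d1 de]; rewrite /check_extrapolate => /andP[q10 hC] kl.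
set e' := (e - d)%N in q10 hC *.
set s := d%:R + _; pose l0 := kR R e' + 1; pose G0 := gap e'.
pose N := deg_sqr_bound e' d.
have [k1 t0 tk e2] := kRtR R e; have lp : 0 < lam by lra.
have [k1' t0' tk' e2'] := kRtR R e'.
have e'p : (0 < e')%N by rewrite subn_gt0.
have z2 : zr R (Zpos 2) = 2 by [].
have e'E : zr R (Z.sub (Z.of_nat e) (Z.of_nat d)) = e'%:R.
  by rewrite zrB !zr_nat natrB // ltnW.
have d1E : zr R (Z.sub (Z.of_nat d) 1) = (d - 1)%:R by rewrite zrB zr_nat zr1 natrB // ltnW.
have d2E : zr R (Z.sub (Z.of_nat d) 2) = (d - 2)%:R by rewrite zrB zr_nat z2 natrB.
have l0E : zr R (Z.add (Z.of_nat (tri e').1) 1) = l0 by rewrite zrD zr_nat zr1.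
move: q10 hC; set eZ := Z.sub _ (Z.of_nat d); set lZ := Z.add _ 1.
set q2Z := zeval (denP _ _) _; set q1Z := Z.sub (Z.mul lZ _) _.
set d1Z := Z.sub (Z.of_nat d) 1; set n1Z := Z.mul eZ _ => q10 hC.
rewrite -/lZ in l0E; rewrite -/d1Z in d1E; rewrite -/eZ in e'E.
have [D0 sl F] := check_sound hC kl.
rewrite zr_nat in F.
pose q2 := denD (kR R e') (tR R e') l0.
pose q1 := l0 * numD (kR R e') (tR R e') l0 - 2 * e'%:R * q2.
have q2E : zr R q2Z = q2 by rewrite zr_zeval l0E peval_denP.
have q1E : zr R q1Z = q1 by rewrite zrB !zrM zr_zeval l0E e'E peval_numP q2E z2.
have {}q10 : 0 < q1 by rewrite -q1E zr_gt0.
have q20 : 0 < q2 by apply: denD_gt0 => //; rewrite /l0 lerDl.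
have G0E : G0 = q1 / q2.
  by rewrite /G0 /gap -/l0 /q1 /gDe /gD -/q2; field; rewrite lt0r_neq0.
pose n1 : R := (e' * (2 * e' + (d - 1) * (d - 2)))%:R.
pose n2 : R := (d - 1)%:R.
have n10 : 0 < n1 by rewrite /n1 ltr0n muln_gt0 e'p addn_gt0 muln_gt0 e'p.
have n20 : 0 < n2 by rewrite /n2 ltr0n subn_gt0.
have n1E : zr R n1Z = n1 by rewrite zrM zrD !zrM e'E z2 d1E d2E /n1 natrM natrD !natrM.
pose A := q2 * n1 + q1 * n2 * (lam - l0).
clearbody n1Z q1Z q2Z d1Z lZ eZ.
set AZ := [:: Z.sub _ _; _] in D0 sl F.
have AE : peval AZ lam = A.
  by rewrite /= zrB !zrM q1E q2E n1E l0E d1E -/n2 /A; ring.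
have DE : peval (Z0 :: AZ) lam = lam * A by rewrite -AE /= zr0 add0r.
rewrite DE pmulr_rgt0 // in D0.
have SE : peval (padd (pmul [:: Z.mul 2 eZ; Z.of_nat d] AZ) [:: Z.mul q1Z n1Z]) lam
   = (2 * e'%:R + lam * d%:R) * A + q1 * n1.
  by rewrite peval_add peval_mul AE /= !zrM e'E z2 zr_nat q1E n1E; ring.
have GE : G0^-1 + (lam - l0) / N = A / (q1 * n1).
  rewrite G0E /N /deg_sqr_bound -/n1 -/n2 /A; clearbody q1 q2 n1 n2.
  by field; rewrite !lt0r_neq0.
have E : ((2 * e'%:R + lam * d%:R) * A + q1 * n1) / (lam * A) = s.
  rewrite /s /extrapolated -/l0 -/G0 -/N GE invf_div; clearbody A; clearbody q1 n1.
  by field; rewrite !lt0r_neq0.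
rewrite DE SE E in sl F.
by split=> //; rewrite -/G0 G0E divr_gt0.
Qed.

Definition psiR e lam := psi_poly (kR R e) (tR R e) lam.

Lemma peval_psiP e lam :
  peval (psiP (Z.of_nat (tri e).1) (Z.of_nat (tri e).2)) lam = psiR e lam.
Proof.
rewrite /= !(zrN, zrD, zrB, zrM, zr_nat) !zr1 /psiR /psi_poly -/(kR R e) -/(tR R e).
by rewrite ?(@zr_pos 2 2%positive erefl) ?(@zr_pos 3 3%positive erefl) ?(@zr_pos 4 4%positive erefl)
   ?(@zr_pos 5 5%positive erefl) ?(@zr_pos 6 6%positive erefl) ?(@zr_pos 8 8%positive erefl)
   ?(@zr_pos 12 12%positive erefl) ?(@zr_pos 15 15%positive erefl) ?(@zr_pos 18 18%positive erefl)
   ?(@zr_pos 20 20%positive erefl) ?(@zr_pos 24 24%positive erefl); ring.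
Qed.

Lemma psi_cubic e : check_psi (Z.of_nat (tri e).1) (Z.of_nat (tri e).2) ->
  psiR e (kR R e + 1) < 0 /\
  exists p0 p1 p2 p3 : R, [/\ p0 < 0, 0 <= p2, 0 < p3
   & forall y, psiR e (kR R e + y) = p0 + p1 * y + p2 * y ^+ 2 + p3 * y ^+ 3].
Proof.
have neg a : Z.ltb a 0 -> zr R a < 0 by rewrite /zr ltrz0; case: a.
have signs q : cubic_signs q -> exists p0 p1 p2 p3 : R, [/\ p0 < 0, 0 <= p2, 0 < p3
    & forall y, peval q y = p0 + p1 * y + p2 * y ^+ 2 + p3 * y ^+ 3].
  case: q => [|a0 [|a1 [|a2 [|a3 [|a4 s]]]]] // /and3P[/neg h0 h2 h3].
  exists (zr R a0), (zr R a1), (zr R a2), (zr R a3).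
  by split=> //; [exact: zr_ge0 | exact: zr_gt0 | move=> y /=; ring].
move=> /andP[/neg hz /signs[p0 [p1 [p2 [p3 [h0 h2 h3 E]]]]]].
rewrite zr_zeval peval_psiP zrD zr_nat zr1 in hz; split=> //.
exists p0, p1, p2, p3; split=> // y.
by rewrite -E peval_shift peval_psiP zr_nat.
Qed.

Lemma gDe_sub_gVe e lam : kR R e <= lam ->
  gDe e lam - gVe e lam =
  - psiR e lam / (4 * (denD (kR R e) (tR R e) lam * (lam ^+ 2 - e%:R))).
Proof.
move=> kl; have [k1 t0 tk e2] := kRtR R e.
apply: gD_sub_gV => //; first by rewrite lt0r_neq0 // denD_gt0.
by rewrite lt0r_neq0 // edges_lt_sqr.
Qed.

Lemma gVe_lt_gDe e lam : kR R e <= lam ->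
  (gVe e lam < gDe e lam) = (psiR e lam < 0) /\ (gDe e lam < gVe e lam) = (0 < psiR e lam).
Proof.
move=> kl; have [k1 t0 tk e2] := kRtR R e.
have dp : 0 < 4 * (denD (kR R e) (tR R e) lam * (lam ^+ 2 - e%:R)).
  by rewrite !mulr_gt0 ?ltr0n ?denD_gt0 ?edges_lt_sqr.
split; first by rewrite -subr_gt0 gDe_sub_gVe // pmulr_lgt0 ?invr_gt0 // oppr_gt0.
by rewrite -subr_lt0 gDe_sub_gVe // pmulr_llt0 ?invr_gt0 // oppr_lt0.
Qed.

End Sound.

Lemma check_edgesP e : (4 <= e <= 130)%N -> exists c d1, check_edges e c d1.
Proof.
move=> /andP[e4 e130]; have := check_allT => /(all_nthP (0, (0, 0))%N) /(_ (e - 4)%N).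
rewrite size_zip size_iota [size thresholds]/= nth_zip ?size_iota // nth_iota; last by lia.
by rewrite subnKC // => H; do 2!eexists; apply: H; lia.
Qed.

Lemma tri_unique e k t : (e = 'C(k, 2) + t)%N -> (t < k)%N -> tri e = (k, t).
Proof.
move=> e1 tk; have [e2 tk2] := tri_spec e.
have kE : (tri e).1 = k.
  apply/eqP; rewrite eqn_leq; apply/andP; split; rewrite leqNgt; apply/negP => h;
  have := bin2_mono h; rewrite bin2S; lia.
rewrite [tri e]surjective_pairing kE; congr (_, _); move: e2; rewrite kE; lia.
Qed.

(** 'C(k, 2) + t - k = 'C(k - 1, 2) + t - 1, and 'C(k, 2) - (k - 1) = 'C(k - 1, 2) when t = 0; the
    truncated predecessor of t covers both cases. *)
Lemma clique_deg_rest e : (0 < e)%N ->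
  [/\ (0 < clique_deg e <= e)%N,
      tri (e - clique_deg e) = ((tri e).1.-1, (tri e).2.-1) & (1 < (tri e).1)%N].
Proof.
move=> e0; rewrite /clique_deg; have [e1 tk] := tri_spec e.
case: (tri e) e1 tk => k t /= e1 tk.
have k2 : (1 < k)%N by case: k e1 tk => [|[|k]] // ; case: t e0 => // ; rewrite ?bin_small //; lia.
case: k k2 e1 tk => // k k2; rewrite bin2S => e1 tk /=.
case: t e1 tk => [|t] e1 tk /=; split=> //; try lia.
- by apply: tri_unique; lia.
- by apply: tri_unique; lia.
Qed.

Section Numeric.
Variable R : realFieldType.

(** At k_e + 1 the quasi-complete graph is at least as good as the star. For e = 1 and e = 2 it is
    the star, so strictness starts at e = 3. *)
Lemma psi_next e : (0 < e <= 130)%N ->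
  psiR e (kR R e + 1) <= 0 /\ ((2 < e)%N -> psiR e (kR R e + 1) < 0).
Proof.
move=> /andP[e0 e130]; have [e4|] := leqP 4 e.
  have [c [d1]] := check_edgesP (introT andP (conj e4 e130)).
  rewrite /check_edges; case E: (tri e) => [k t] /and4P[hp _ _ _].
  have {}hp : check_psi (Z.of_nat (tri e).1) (Z.of_nat (tri e).2) by rewrite E.
  by have [h _] := psi_cubic R hp; split=> //; apply: ltW.
case: e e0 {e130} => [|[|[|[|]]]] // _ _;
  rewrite /psiR /psi_poly /kR /tR /=; split=> [|h] //; lra.
Qed.

Lemma gmax_next e : (0 < e <= 130)%N ->
  gmax e (kR R e + 1) = gDe e (kR R e + 1) /\
  ((2 < e)%N -> gVe e (kR R e + 1) < gDe e (kR R e + 1)).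
Proof.
move=> e130; have [h1 h2] := psi_next e130.
have kk : kR R e <= kR R e + 1 by rewrite lerDl.
have [g1 g2] := gVe_lt_gDe kk; split; last by rewrite g1.
by apply/max_idPl; rewrite leNgt g2 -leNgt.
Qed.

Lemma middle_degree e d lam : (e <= 130)%N -> (clique_deg e < d < e)%N -> kR R e <= lam ->
  [/\ 0 < gap R (e - d),
      d%:R + (2 * (e - d)%:R + extrapolated (e - d) d lam) / lam < lam ^+ 2
    & starred lam d%:R (d%:R + (2 * (e - d)%:R + extrapolated (e - d) d lam) / lam)
      < gmax e lam]
  \/ forall g', g' <= gmax (e - d) lam ->
     d%:R + g' < lam ^+ 2 /\ starred lam d%:R (d%:R + g') < gmax e lam.
Proof.
move=> e130 /andP[dd de] kl.
(* For e <= 3 no degree lies strictly between [clique_deg e] and [e]. *)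
have e4 : (4 <= e)%N.
  by case: e dd de {e130 kl} => [|[|[|[|]]]] //=; rewrite /clique_deg /=; lia.
have [c [d1]] := check_edgesP (introT andP (conj e4 e130)).
have e0 : (0 < e)%N by apply: leq_trans e4.
have [/andP[cd1 _] _ _] := clique_deg_rest e0.
rewrite /check_edges; case E: (tri e) => [k t] /and4P[_ /andP[cd de1] hSL hall].
have Ek : k = (tri e).1 by rewrite E.
have Et : t = (tri e).2 by rewrite E.
have cE : clique_deg e = (if t == 0 then k.-1 else k)%N by rewrite /clique_deg E.
rewrite -cE in cd hall; rewrite {}Ek {}Et {E cE} in hSL hall.
have [d1d|dd1] := leqP d1 d.
  right=> g' gle; move: hSL; rewrite ltn_eqF /=; last exact: leq_ltn_trans de.
  by move=> /andP[hS hL]; apply: check_tail hS hL kl gle.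
left; have := allP hall d; rewrite mem_iota dd subnKC // dd1 => /(_ isT).
case E: (tri (e - d)) => [k' t'] hC.
have {}hC : check_extrapolate (Z.of_nat (tri e).1) (Z.of_nat (tri e).2) (Z.of_nat e)
   (Z.of_nat c) (Z.of_nat d) (Z.of_nat (tri (e - d)).1) (Z.of_nat (tri (e - d)).2) by rewrite E.
by apply: check_extrapolate_sound hC kl; rewrite de andbT; lia.
Qed.

End Numeric.

(** * Recognition of quasi-complete graphs and stars *)

Section Shapes.
Variable T : finType.
Implicit Types (r : rel T) (S : {set T}).

(* MD is the pattern of the quasi-complete graph: class 0 are its t vertices of degree
   k, class 1 the other k - t clique vertices, class 2 the vertex of degree t.  MV is
   the pattern of the star, with centre of class 0. *)
Definition MD : rel nat := fun i j =>
  [|| (i <= 1) && (j <= 1), (i == 0) && (j == 2) | (i == 2) && (j == 0)]%N.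
Definition MV : rel nat := fun i j =>
  ((i == 0) && (j == 1) || (i == 1) && (j == 0))%N.

(* The vertices of S are split into classes of sizes n0, n1, n2 and a rest (class
   3); adjacency of distinct vertices only depends on their classes. *)
Definition shaped (M : rel nat) (n0 n1 n2 : nat) S r := exists c : T -> nat,
  [/\ forall x y, r x y = (x != y) && M (c x) (c y),
      forall x, (c x <= 3)%N, forall x, x \notin S -> c x = 3%N
    & [/\ #|[set x | c x == 0%N]| = n0, #|[set x | c x == 1%N]| = n1
        & #|[set x | c x == 2%N]| = n2]].
(** For t = 0 the vertex of degree t is isolated and is counted in class 3; hence the size [(0 < t)]
    of class 2. *)
Definition isD S r k t := shaped MD t (k - t) (0 < t)%N S r.
Definition isV S r e := shaped MV 1 e 0 S r.

Lemma arcs_le S r : graph_on S r -> (arcs r <= #|S| * (#|S| - 1))%N.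
Proof.
move=> rS; rewrite /arcs (bigID (mem S)) /= [X in (_ + X)%N]big1 ?addn0; last first.
  by move=> u; apply: deg_out.
rewrite -sum_nat_const; apply: leq_sum => u uS.
by have := deg_lt rS uS; lia.
Qed.

Lemma arcs0 r x y : arcs r = 0%N -> r x y = false.
Proof.
move=> /eqP; rewrite /arcs sum_nat_eq0 => /forallP /(_ x) /=.
by rewrite /deg sum_nat_eq0 => /forallP /(_ y) /=; case: (r x y).
Qed.

(** Since k_0 = 1, the clique is a single vertex, for which any [x0] in [S] serves. *)
Lemma isD_edgeless S r x0 : x0 \in S -> arcs r = 0%N -> isD S r 1 0.
Proof.
move=> x0S a0; exists (fun x => if x == x0 then 1 else 3)%N; split.
- move=> x y; rewrite arcs0 //; have [//|xy] := eqVneq x y.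
  have [ex|_] := eqVneq x x0; have [ey|_] := eqVneq y x0 => //=.
  by rewrite ex ey eqxx in xy.
- by move=> x; case: ifP.
- by move=> x; case: eqP => // ->; rewrite x0S.
split; last 1 first.
- by apply: eq_card0 => x; rewrite !inE; case: ifP.
- by apply: eq_card0 => x; rewrite !inE; case: ifP.
by rewrite -[RHS](cards1 x0); apply: eq_card => x; rewrite !inE; case: ifP.
Qed.

Lemma isV_star S r v e : graph_on S r -> v \in S -> #|nbr r v| = e ->
  arcs (unstar r v) = 0%N -> isV S r e.
Proof.
move=> rS vS cN a0; have [rs ri rin] := rS.
exists (fun x => if x == v then 0 else if r v x then 1 else 3)%N; split.
- move=> x y; have := @arcs0 _ x y a0; rewrite /unstar.
  have [->|xv] := eqVneq x v.
    have [->|yv] := eqVneq y v; first by rewrite ri.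
    by rewrite /=; case: (r v y).
  have [->|yv] := eqVneq y v; first by rewrite xv rs /=; case: (r v x).
  by rewrite !andbT => ->; case: (r v x); case: (r v y); rewrite ?andbF.
- by move=> x; case: ifP => // _; case: ifP.
- move=> x xS; case: eqP xS => [->|_]; first by rewrite vS.
  by case: ifP => // rvx; rewrite rs in rvx; rewrite (rin _ _ rvx).
split.
- rewrite -[RHS](cards1 v); apply: eq_card => x; rewrite !inE.
  by case: ifP => // _; case: ifP.
- rewrite -[RHS]cN; apply: eq_card => x; rewrite !inE.
  by have [->|_] := eqVneq x v; rewrite ?ri //; case: ifP.
by apply: eq_card0 => x; rewrite !inE; case: ifP => // _; case: ifP.
Qed.

Section Step.
Variables (S : {set T}) (r : rel T) (v : T).
Hypotheses (rS : graph_on S r) (vS : v \in S).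
Let N := nbr r v.

(** If t = 1, one of the k neighbours is isolated in the rest and sits in class 3 there; joined to
    [v] it becomes the vertex of degree 1, and [minn (c x) 2] moves it to class 2. If t > 1,
    counting shows that no neighbour is in class 3. *)
Lemma isD_step k t : (0 < t < k)%N -> #|N| = k ->
  isD N (unstar r v) k.-1 t.-1 -> isD S r k t.
Proof.
move=> /andP[t0 tk] cN [c [cE c3 cout [c0 c1 c2]]]; have [rs ri rin] := rS.
have NE x : (x \in N) = r v x by rewrite inE.
have vN : v \notin N by rewrite NE ri.
have cN3 x : (c x <= 2)%N -> x \in N.
  by apply: contraTT => /cout ->.
have cv : c v = 3%N by apply: cout.
pose A := [set x | c x == 0%N]; pose B := [set x | c x == 1%N].
have AB : [disjoint A & B].
  by rewrite -setI_eq0; apply/eqP/setP => x; rewrite !inE; case: eqP => // ->.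
have ABN : A :|: B \subset N.
  by apply/subsetP => x; rewrite !inE => /orP[] /eqP e;
  by rewrite -NE; apply: cN3; rewrite e.
have cAB : #|A :|: B| = k.-1 by rewrite cardsU disjoint_setI0 // cards0 c0 c1; lia.
have small x y : x \in N -> y \in N -> MD (c x) (c y) = MD (minn (c x) 2) (minn (c y) 2).
  move=> xN yN; have [t1|t1] := posnP t.-1.
    have n0 z : c z != 0%N.
      apply/negP => /eqP e; have : z \in A by rewrite inE e.
      by rewrite /A (cards0_eq (etrans c0 t1)) inE.
    have := n0 x; have := n0 y; have := c3 x; have := c3 y.
    by case: (c x) => [|[|[|[|]]]] //; case: (c y) => [|[|[|[|]]]].
  have le2 z : z \in N -> (c z <= 2)%N.
    move=> zN; rewrite leqNgt; apply/negP => cz.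
    pose C := [set x | c x == 2%N].
    have sub : A :|: B :|: C \subset N :\ z.
      apply/subsetP => u; rewrite !inE => h; apply/andP; split.
        by apply/negP => /eqP e; move: h cz; rewrite e; case: (c z) => [|[|[|]]].
      have : u \in N by apply: cN3; move: h; case: (c u) => [|[|[|]]].
      by rewrite inE.
    have dC : [disjoint A :|: B & C].
      by rewrite -setI_eq0; apply/eqP/setP => u; rewrite !inE; case: (c u) => [|[|[|]]].
    have := subset_leq_card sub; have := cardsD1 z N; rewrite zN cN.
    by rewrite cardsU disjoint_setI0 // cards0 cAB c2 t1; lia.
  by rewrite !(minn_idPl _) ?le2.
exists (fun x => if x == v then 0 else if x \in N then minn (c x) 2 else 3)%N; split.
- move=> x y; have [->|xv] := eqVneq x v.
    have [->|yv] := eqVneq y v; first by rewrite ri.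
    rewrite /= NE; case: (r v y) => //.
    by rewrite /MD; case: (c y) => [|[|[|]]].
  have [->|yv] := eqVneq y v.
    rewrite xv NE rs /=; case: (r v x) => //.
    by rewrite /MD; case: (c x) => [|[|[|]]].
  have := cE x y; rewrite /unstar xv yv !andbT => ->.
  have [xN|xN] := boolP (x \in N); last by rewrite (cout x xN).
  have [yN|yN] := boolP (y \in N); first by rewrite small.
  by rewrite (cout y yN); case: (c x) => [|[|[|]]].
- by move=> x; case: ifP => // _; case: ifP => // _; rewrite (leq_trans (geq_minr _ _)).
- move=> x xS; case: eqP xS => [->|_]; first by rewrite vS.
  case: ifP => //; rewrite NE => rvx; rewrite rs in rvx; by rewrite (rin _ _ rvx).
have -> : [set x | (if x == v then 0 else if x \in N then minn (c x) 2 else 3)%N == 0%N] = v |: A.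
  apply/setP => x; rewrite !inE; have [//|_] := eqVneq x v; rewrite -NE /=.
  case: ifPn => [_|/cout -> //].
  by case: (c x) => [|[|[|]]].
have -> : [set x | (if x == v then 0 else if x \in N then minn (c x) 2 else 3)%N == 1%N] = B.
  apply/setP => x; rewrite !inE; have [->|_] := eqVneq x v; rewrite /=; first by rewrite cv.
  rewrite -NE; case: ifPn => [_|/cout -> //]; by case: (c x) => [|[|[|]]].
have -> : [set x | (if x == v then 0 else if x \in N then minn (c x) 2 else 3)%N == 2%N]
    = N :\: (A :|: B).
  apply/setP => x; rewrite !inE; have [->|_] := eqVneq x v; rewrite /=; first by rewrite ri andbF.
  rewrite -NE; case: ifPn => xN; last by rewrite andbF.
  by rewrite andbT; case: (c x) => [|[|[|]]].
rewrite cardsU1 inE cv /= c0 c1 cardsD (setIidPr ABN) cAB cN; split; lia.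
Qed.

Lemma isD_step_clique k : (1 < k)%N -> #|N| = k.-1 ->
  isD N (unstar r v) k.-1 0 -> isD S r k 0.
Proof.
move=> k1 cN [c [cE c3 cout [c0 c1 c2]]]; have [rs ri rin] := rS.
have NE x : (x \in N) = r v x by rewrite inE.
have BN : [set x | c x == 1%N] = N.
  apply/eqP; rewrite eqEcard c1 cN subn0 leqnn andbT; apply/subsetP => x.
  by rewrite inE => /eqP e; apply: contraTT isT => /cout; rewrite e.
have cNE x : x \in N -> c x = 1%N by rewrite -BN inE => /eqP.
exists (fun x => if (x == v) || (x \in N) then 1 else 3)%N; split.
- move=> x y; have [->|xv] := eqVneq x v.
    have [->|yv] := eqVneq y v; first by rewrite ri.
    by rewrite /= NE; case: (r v y).
  have [->|yv] := eqVneq y v; first by rewrite xv NE rs /=; case: (r v x).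
  have := cE x y; rewrite /unstar xv yv !andbT => -> /=.
  have [xN|xN] := boolP (x \in N); last by rewrite (cout x xN).
  have [yN|yN] := boolP (y \in N); first by rewrite !cNE.
  by rewrite (cout y yN) cNE.
- by move=> x; case: ifP.
- move=> x xS; case: ifP => // /orP[/eqP e|]; first by rewrite e vS in xS.
  by rewrite NE => rvx; rewrite rs in rvx; rewrite (rin _ _ rvx) in xS.
split.
- by apply: eq_card0 => x; rewrite !inE; case: ifP.
- have -> : [set x | (if (x == v) || (x \in N) then 1 else 3)%N == 1%N] = v |: N.
    by apply/setP => x; rewrite !inE; case: ifP.
  by rewrite cardsU1 NE ri cN; lia.
by apply: eq_card0 => x; rewrite !inE; case: ifP.
Qed.

End Step.
End Shapes.

(** * The bound on the excess *)

Section Main.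
Variables (R : realFieldType) (T : finType).
Implicit Types (r : rel T) (S : {set T}) (x y : T -> R) (lam : R) (e : nat).

(** At lam = k_e + 1 the clause [2 < e] rules out the star, because gV < gD there; for smaller e the
    star falls under the first alternative. *)
Definition is_extremal e S r lam :=
  (isD S r (tri e).1 (tri e).2 /\ gmax e lam = gDe e lam) \/
  [/\ isV S r e, gmax e lam = gVe e lam & (2 < e)%N].

Definition extremal e lam := forall S r x, graph_on S r -> arcs r = (2 * e)%N ->
  S != set0 ->
  qform lam 1 S r x <= (#|S|%:R + gmax e lam) / lam
  /\ (qform lam 1 S r x = (#|S|%:R + gmax e lam) / lam -> is_extremal e S r lam).

Lemma dominated_excess lam S r v x s : 0 < lam -> s < lam ^+ 2 -> graph_on S r ->
  v \in S -> 0 <= x v ->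
  (forall y, qform lam 1 (nbr r v) (unstar r v) y <= s / lam) ->
  qform lam 1 S r x <= (#|S|%:R + starred lam #|nbr r v|%:R s) / lam
  /\ (qform lam 1 S r x = (#|S|%:R + starred lam #|nbr r v|%:R s) / lam ->
      exists y, qform lam 1 (nbr r v) (unstar r v) y = s / lam).
Proof.
move=> l0 sl rS vS xv inner.
have a0 : 0 < 1 + x v by rewrite ltr_wpDr.
have sc := form_scale lam (nbr r v) (unstar r v) x a0.
have [|h1 h2] := dominated_le l0 sl rS vS (x := x).
  by rewrite sc ler_wpM2l ?sqr_ge0.
split=> // /h2; rewrite sc => E; exists (fun u => x u / (1 + x v)).
by apply: (mulfI _ E); rewrite expf_neq0 // lt0r_neq0.
Qed.

Lemma nbr_card_le S r v : graph_on S r -> v \in S -> (#|nbr r v| < #|S|)%N.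
Proof. by move=> rS vS; rewrite -deg_card; apply: deg_lt. Qed.

Lemma dominated_edges S r v e : graph_on S r -> dominates r v -> arcs r = (2 * e)%N ->
  [/\ (#|nbr r v| <= e)%N, arcs (unstar r v) = (2 * (e - #|nbr r v|))%N
    & (e <= 'C(#|nbr r v|.+1, 2))%N].
Proof.
move=> rS dom ae; have a1 := unstar_arcs v rS.
have a2 := arcs_le (unstar_graph_on rS dom).
have c2 : (2 * 'C(#|nbr r v|.+1, 2) = #|nbr r v|.+1 * #|nbr r v|)%N.
  by rewrite -mul_bin_diag bin1.
by split; nia.
Qed.

Lemma qform_edgeless lam S r x : 0 < lam -> arcs r = 0%N ->
  qform lam 1 S r x <= #|S|%:R / lam.
Proof.
move=> l0 a0; rewrite /qform.
have -> : quad r x = 0.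
  by apply: big1 => u _; apply: big1 => v _; rewrite arcs0 // mul0r.
rewrite addr0 [leRHS]mulr_natl -sumr_const; apply: ler_sum => u _.
by rewrite mulr1; apply: isolated_le.
Qed.

Lemma gDe0 lam : gDe 0 lam = 0.
Proof.
rewrite /gDe /gD; have -> : numD (kR R 0) (tR R 0) lam = 0.
  by rewrite /numD /kR /tR /=; ring.
by rewrite mul0r.
Qed.

(** Serves the neighbours of a vertex of least possible degree: on so few vertices gD alone bounds
    the excess, even where gV is larger. Induction on t. For t = 0 the clique attains de Caen's
    bound, so the extrapolation from k_e + 1 is exact; for t > 0 a dominating vertex of degree k is
    removed. *)
Lemma excess_on_few_vertices e lam : (e <= 130)%N ->
  (forall e', (0 < e' <= e)%N -> extremal e' (kR R e' + 1)) ->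
  kR R e + 1 <= lam -> forall S r x, graph_on S r -> arcs r = (2 * e)%N ->
  #|S| = (tri e).1.+1 \/ (tri e).2 = 0%N /\ #|S| = (tri e).1 ->
  qform lam 1 S r x <= (#|S|%:R + gDe e lam) / lam
  /\ (qform lam 1 S r x = (#|S|%:R + gDe e lam) / lam -> isD S r (tri e).1 (tri e).2).
Proof.
have [n] := ubnP (tri e).2; elim: n e => // n IH e tn e130 ext kl S r x rS ae cS.
have [k1 t0 tk e2] := kRtR R e; have lp : 0 < lam by lra.
have [eT tkT] := tri_spec e.
have S0 : S != set0 by rewrite -card_gt0; case: cS => [|[_]] ->; lia.
have [e0|e0] := posnP e.
  subst e; rewrite gDe0 addr0; split; first exact: qform_edgeless.
  by move=> _; have /set0Pn[x0 x0S] := S0; apply: isD_edgeless x0S _.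
have [/andP[cd0 cde] triE k2] := clique_deg_rest e0.
have [tz|tp] := posnP (tri e).2.
  have S1 : (1 < #|S|)%N by case: cS => [|[_]] ->; lia.
  have [gm gs] := gmax_next R (introT andP (conj e0 e130)).
  have tR0 : tR R e = 0 by rewrite /tR tz.
  have kR2 : 2 <= kR R e by rewrite /kR (ler_nat R 2).
  have eR : e%:R = kR R e * (kR R e - 1) / 2.
    by move: e2; rewrite tR0; lra.
  have gnext : gDe e (kR R e + 1) = kR R e * (kR R e - 1) / 2.
    rewrite /gDe tR0 gD_clique ?lt0r_neq0 //; try lra.
    by congr (_ / _); ring.
  have gapE : gap R e = kR R e * (kR R e - 1) ^+ 2 / 2.
    by rewrite /gap gnext eR; field.
  have gap0 : 0 < gap R e by rewrite gapE !mulr_gt0 ?exprn_gt0 ?invr_gt0; lra.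
  (* De Caen's bound is the same for a clique with and without one additional isolated vertex. *)
  have NE : deg_sqr_bound R e #|S| = kR R e * (kR R e - 1) ^+ 2.
    have [m [mE m0]] : exists m : R, (#|S| - 1)%:R = m /\ 0 < m.
      by exists (#|S| - 1)%:R; rewrite ltr0n subn_gt0.
    rewrite /deg_sqr_bound natrM natrD !natrM mE eR.
    have m2 : (#|S| - 2)%:R = m - 1.
      by rewrite -mE -[(#|S| - 2)%N]/(#|S| - (1 + 1))%N subnDA natrB // subn_gt0.
    rewrite m2; case: cS => [cS|[_ cS]].
      have -> : m = kR R e by rewrite -mE cS subn1.
      by field; rewrite lt0r_neq0; lra.
    have -> : m = kR R e - 1 by rewrite -mE cS natrB //; lia.
    by field; rewrite lt0r_neq0 //; lra.
  have N0 : 0 < deg_sqr_bound R e #|S| by rewrite NE mulr_gt0 ?exprn_gt0; lra.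
  have b0 y : qform (kR R e + 1) 1 S r y <=
     (#|S|%:R + (2 * e%:R + gap R e) / (kR R e + 1)) / (kR R e + 1).
    have [h _] := ext e (introT andP (conj e0 (leqnn e))) S r y rS ae S0.
    move: h; rewrite gm; congr (_ <= (_ + _) / _); rewrite /gap; field.
    by rewrite lt0r_neq0; lra.
  have l0 : 0 < kR R e + 1 by lra.
  have [h1 h2] := form_extrapolate l0 kl gap0 N0 rS ae b0 (sum_deg_sqr_le R rS ae S1) x.
  rewrite -/(extrapolated e #|S| lam) in h1 h2.
  have gE : (2 * e%:R + extrapolated e #|S| lam) / lam = gDe e lam.
    rewrite /extrapolated NE gapE /gDe tR0 gD_clique ?lt0r_neq0 //; try lra.
    rewrite eR; have -> : (kR R e * (kR R e - 1) ^+ 2 / 2)^-1 +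
       (lam - (kR R e + 1)) / (kR R e * (kR R e - 1) ^+ 2) =
       (lam - kR R e + 1) / (kR R e * (kR R e - 1) ^+ 2).
      by field; rewrite !lt0r_neq0 //; lra.
    by field; rewrite !lt0r_neq0 //; lra.
  rewrite gE in h1 h2; split=> // /h2[z zE].
  have [_] := ext e (introT andP (conj e0 (leqnn e))) S r z rS ae S0.
  have -> : (#|S|%:R + gmax e (kR R e + 1)) / (kR R e + 1) = qform (kR R e + 1) 1 S r z.
    rewrite zE gm; congr ((_ + _) / _); rewrite /gap; field.
    by rewrite lt0r_neq0; lra.
  by move=> /(_ erefl)[[]|[_ gV e3]] //; have := gs e3; rewrite -gm gV ltxx.
have cSk : #|S| = (tri e).1.+1 by case: cS => [|[]] //; lia.
have cdE : clique_deg e = (tri e).1 by rewrite /clique_deg gtn_eqF.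
rewrite {}cdE in triE cde cd0.
set k := (tri e).1 in triE cde cd0 cSk eT tkT k2 *; set t := (tri e).2 in triE eT tkT tp tn *.
have kRE : kR R e = k%:R by []. have tRE : tR R e = t%:R by [].
have kR' : kR R (e - k) = kR R e - 1 by rewrite /kR triE -/k /= -subn1 natrB.
have tR' : tR R (e - k) = tR R e - 1 by rewrite /tR triE -/t /= -subn1 natrB.
have t1 : 1 <= tR R e by rewrite tRE ler1n.
have [] := @starred_gD R (kR R e) (tR R e - 1) lam _ _ _; try lra.
rewrite subrK => sl sE.
have dom_case r' y v : graph_on S r' -> arcs r' = (2 * e)%N -> (forall u, 0 <= y u) ->
   v \in S -> dominates r' v ->
   qform lam 1 S r' y <= (#|S|%:R + gDe e lam) / lam /\
   (qform lam 1 S r' y = (#|S|%:R + gDe e lam) / lam -> isD S r' k t).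
  move=> r'S ae' y0 vS dom.
  have [de aN eC] := dominated_edges r'S dom ae'.
  (* On k + 1 vertices the degree is at most k, and e > 'C(k, 2) excludes a smaller one. *)
  have cN : #|nbr r' v| = k.
    have := nbr_card_le r'S vS; rewrite cSk ltnS => dk.
    apply/eqP; rewrite eqn_leq dk leqNgt; apply/negP => dk'.
    by have := bin2_mono dk'; lia.
  rewrite cN in aN.
  have inner := IH (e - k)%N _ _ _ _ (nbr r' v) (unstar r' v) _ (unstar_graph_on r'S dom) aN.
  have {}inner z : qform lam 1 (nbr r' v) (unstar r' v) z <=
      (#|nbr r' v|%:R + gDe (e - k) lam) / lam
     /\ (qform lam 1 (nbr r' v) (unstar r' v) z = (#|nbr r' v|%:R + gDe (e - k) lam) / lam ->
         isD (nbr r' v) (unstar r' v) k.-1 t.-1).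
    move: inner; rewrite triE /=; apply.
    - by move: tn tp; lia.
    - by apply: leq_trans e130; apply: leq_subr.
    - by move=> e' /andP[e'0 e'e]; apply: ext; rewrite e'0 (leq_trans e'e) ?leq_subr.
    - by rewrite kR'; lra.
    - by left; rewrite cN; lia.
  have sl' : #|nbr r' v|%:R + gDe (e - k) lam < lam ^+ 2 by rewrite cN /gDe kR' tR' -kRE.
  have [h1 h2] := dominated_excess lp sl' r'S vS (y0 v) (fun z => (inner z).1).
  have sE' : starred lam #|nbr r' v|%:R (#|nbr r' v|%:R + gDe (e - k) lam) = gDe e lam.
    by rewrite cN /gDe kR' tR' -kRE.
  rewrite sE' in h1 h2; split=> // /h2[z /(inner z).2 hD].
  by apply: isD_step cN hD => //; rewrite tp.
split; first by apply: compress_le rS ae => // r' y v ? ? ? ? ?; have [] := @dom_case r' y v.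
move=> /(compress_eq lp _ S0 rS ae)[r' y v ? ? ? ? ?|y [v [y0 vS dom]]].
  by have [] := @dom_case r' y v.
by move/(dom_case r y v rS ae y0 vS dom).2.
Qed.

(** Puts the starting point of the extrapolation, k_(e-d) + 1, at or below every admissible
    [lam]. *)
Lemma kR_rest e d : (0 < e)%N -> (clique_deg e <= d)%N -> kR R (e - d) + 1 <= kR R e.
Proof.
move=> e0 cd; have [_ triE k2] := clique_deg_rest e0.
have kle : ((tri (e - d)).1 <= (tri (e - clique_deg e)).1)%N.
  by apply: tri_k_mono; apply: leq_sub2l.
rewrite natr1 ler_nat; move: kle; rewrite triE /= => kle.
by apply: leq_ltn_trans kle _; rewrite prednK // ltnW.
Qed.

Lemma clique_deg_le e d : (0 < e)%N -> (e <= 'C(d.+1, 2))%N -> (clique_deg e <= d)%N.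
Proof.
move=> e0 ed; rewrite leqNgt; apply/negP => dlt.
have [eT tk] := tri_spec e; move: dlt; rewrite /clique_deg.
case: posnP => tz dlt.
  have := @bin2_mono d.+2 (tri e).1; rewrite bin2S; lia.
by have := bin2_mono dlt; lia.
Qed.

Lemma clique_deg_lt e : (clique_deg e < e)%N -> (2 < e)%N.
Proof. by case: e => [|[|[|e]]]. Qed.

Lemma extremal_le e lam : (0 < e <= 130)%N -> kR R e <= lam -> extremal e lam.
Proof.
elim/ltn_ind: e lam => e IH lam /andP[e0 e130] kl S r x rS ae S0.
have [k1 t0 tk e2] := kRtR R e; have lp : 0 < lam by lra.
have [/andP[cd0 cde] triE k2] := clique_deg_rest e0.
have el : 0 < lam ^+ 2 - e%:R := edges_lt_sqr kl.
have dom_case r' y v : graph_on S r' -> arcs r' = (2 * e)%N -> (forall u, 0 <= y u) ->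
   v \in S -> dominates r' v ->
   qform lam 1 S r' y <= (#|S|%:R + gmax e lam) / lam /\
   (qform lam 1 S r' y = (#|S|%:R + gmax e lam) / lam -> is_extremal e S r' lam).
  move=> r'S ae' y0 vS dom.
  have [de aN eC] := dominated_edges r'S dom ae'.
  have cdd := clique_deg_le e0 eC.
  have NS := unstar_graph_on r'S dom.
  have div_le (g : R) : g <= gmax e lam ->
      (#|S|%:R + g) / lam <= (#|S|%:R + gmax e lam) / lam.
    by move=> gle; rewrite ler_pM2r ?invr_gt0 // lerD2l.
  (* For degrees strictly between the two extreme ones the bound is never attained; [attain] below
     treats the extreme ones. *)
  have strict s : s < lam ^+ 2 -> starred lam #|nbr r' v|%:R s < gmax e lam ->
      (forall z, qform lam 1 (nbr r' v) (unstar r' v) z <= s / lam) ->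
      qform lam 1 S r' y <= (#|S|%:R + gmax e lam) / lam /\
      (qform lam 1 S r' y = (#|S|%:R + gmax e lam) / lam -> is_extremal e S r' lam).
    move=> sl slt inner; have [h _] := dominated_excess lp sl r'S vS (y0 v) inner.
    have hlt : qform lam 1 S r' y < (#|S|%:R + gmax e lam) / lam.
      by apply: le_lt_trans h _; rewrite ltr_pM2r ?invr_gt0 // ltrD2l.
    by split; [exact: ltW | move=> E; rewrite E ltxx in hlt].
  have attain s g : s < lam ^+ 2 -> starred lam #|nbr r' v|%:R s = g -> g <= gmax e lam ->
      (forall z, qform lam 1 (nbr r' v) (unstar r' v) z <= s / lam) ->
      (gmax e lam = g -> (exists z, qform lam 1 (nbr r' v) (unstar r' v) z = s / lam) ->
         is_extremal e S r' lam) ->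
      qform lam 1 S r' y <= (#|S|%:R + gmax e lam) / lam /\
      (qform lam 1 S r' y = (#|S|%:R + gmax e lam) / lam -> is_extremal e S r' lam).
    move=> sl sE gle inner hyp.
    have [h1 h2] := dominated_excess lp sl r'S vS (y0 v) inner; rewrite sE in h1 h2.
    split; first exact: le_trans h1 (div_le _ gle).
    move=> E; rewrite E in h1 h2.
    have gE : gmax e lam = g.
      apply/eqP; rewrite eq_le gle andbT.
      by move: h1; rewrite ler_pM2r ?invr_gt0 // lerD2l.
    by apply: hyp => //; apply: h2; rewrite gE.
  have ext' e' : (0 < e' <= e - #|nbr r' v|)%N -> extremal e' (kR R e' + 1).
    move=> /andP[e'0 e'e]; apply: IH; rewrite ?lerDl ?e'0 //; last first.
      by apply: leq_trans e130; apply: leq_trans e'e (leq_subr _ _).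
    by apply: leq_ltn_trans e'e _; lia.
  have kl' : kR R (e - #|nbr r' v|) + 1 <= lam by apply: le_trans kl; apply: kR_rest.
  have [cN|cN] := eqVneq #|nbr r' v| (clique_deg e).
    have few : #|nbr r' v| = (tri (e - #|nbr r' v|)).1.+1 \/
       (tri (e - #|nbr r' v|)).2 = 0%N /\ #|nbr r' v| = (tri (e - #|nbr r' v|)).1.
      rewrite cN triE /clique_deg /=.
      by case: posnP => tz; [right; rewrite tz | left; rewrite prednK // ltnW].
    have e'130 : (e - #|nbr r' v| <= 130)%N by apply: leq_trans e130; apply: leq_subr.
    have inner z := excess_on_few_vertices e'130 ext' kl' z NS aN few.
    have kR' : kR R (e - #|nbr r' v|) = kR R e - 1.
      by rewrite /kR cN triE /= -subn1 natrB // ltnW.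
    have gDm : gDe e lam <= gmax e lam by rewrite le_max lexx.
    have [tz|tp] := posnP (tri e).2.
      have cdE : clique_deg e = (tri e).1.-1 by rewrite /clique_deg tz.
      have cR : #|nbr r' v|%:R = kR R e - 1 by rewrite cN cdE -subn1 natrB // ltnW.
      have k2R : 2 <= kR R e by rewrite /kR (ler_nat R 2).
      have tR' : tR R (e - #|nbr r' v|) = 0 by rewrite /tR cN triE tz.
      have tR0 : tR R e = 0 by rewrite /tR tz.
      have [sl sE] := starred_clique k2R kl.
      apply: (attain (#|nbr r' v|%:R + gDe (e - #|nbr r' v|) lam)) gDm _ _.
      - by rewrite /gDe kR' tR' cR.
      - by rewrite /gDe kR' tR' cR tR0.
      - by move=> z; apply: (inner z).1.
      move=> gE [z /(inner z).2]; rewrite cN triE tz /= => hD; left; split=> //.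
      by rewrite tz; apply: isD_step_clique hD => //; rewrite cN cdE.
    have cdE : clique_deg e = (tri e).1 by rewrite /clique_deg gtn_eqF.
    have cR : #|nbr r' v|%:R = kR R e by rewrite cN cdE.
    have t1 : 1 <= tR R e by rewrite /tR ler1n.
    have tR' : tR R (e - #|nbr r' v|) = tR R e - 1.
      by rewrite /tR cN triE /= -subn1 natrB.
    have [] := @starred_gD R (kR R e) (tR R e - 1) lam _ _ _; try lra.
    rewrite subrK => sl sE.
    apply: (attain (#|nbr r' v|%:R + gDe (e - #|nbr r' v|) lam)) gDm _ _.
    - by rewrite /gDe kR' tR' cR.
    - by rewrite /gDe kR' tR' cR.
    - by move=> z; apply: (inner z).1.
    move=> gE [z /(inner z).2]; rewrite cN triE /= => hD; left; split=> //.
    apply: isD_step hD => //; last by rewrite cN cdE.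
    by rewrite tp; have [] := tri_spec e.
  have {}cdd : (clique_deg e < #|nbr r' v|)%N by rewrite ltn_neqAle eq_sym cN.
  have [dE|dE] := eqVneq #|nbr r' v| e.
    have a0 : arcs (unstar r' v) = 0%N by rewrite aN dE subnn.
    have gVm : gVe e lam <= gmax e lam by rewrite le_max lexx orbT.
    apply: (attain e%:R) gVm _ _.
    - by rewrite -subr_gt0.
    - by rewrite dE starred_star // lt0r_neq0.
    - by move=> z; have := qform_edgeless (nbr r' v) z lp a0; rewrite dE.
    move=> gE _; right; split=> //; first exact: isV_star dE a0.
    by apply: clique_deg_lt; rewrite -{2}dE.
  have {}de : (#|nbr r' v| < e)%N by rewrite ltn_neqAle dE.
  have e'e : (0 < e - #|nbr r' v| <= 130)%N.
    by rewrite subn_gt0 de /=; apply: leq_trans e130; apply: leq_subr.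
  have e'lt : (e - #|nbr r' v| < e)%N by rewrite ltn_subrL e0 andbT; lia.
  have N0 : nbr r' v != set0 by rewrite -card_gt0; lia.
  have cdde : (clique_deg e < #|nbr r' v| < e)%N by rewrite cdd de.
  (* Either the form on the neighbours is extrapolated from k_(e-d) + 1, or the induction hypothesis
     at [lam] itself is strong enough. *)
  case: (middle_degree e130 cdde kl) => [[gap0 sl slt]|tail].
    apply: strict sl slt _ => z.
    have d1 : (1 < #|nbr r' v|)%N by lia.
    have N20 : 0 < deg_sqr_bound R (e - #|nbr r' v|) #|nbr r' v|.
      rewrite /deg_sqr_bound divr_gt0 ?ltr0n ?muln_gt0 ?subn_gt0 ?de //.
      by rewrite addn_gt0 muln_gt0 subn_gt0 de.
    have [k1' _ _ _] := kRtR R (e - #|nbr r' v|).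
    have l0 : 0 < kR R (e - #|nbr r' v|) + 1 by lra.
    have b0 w : qform (kR R (e - #|nbr r' v|) + 1) 1 (nbr r' v) (unstar r' v) w <=
       (#|nbr r' v|%:R + (2 * (e - #|nbr r' v|)%:R + gap R (e - #|nbr r' v|))
          / (kR R (e - #|nbr r' v|) + 1)) / (kR R (e - #|nbr r' v|) + 1).
      have le1 : kR R (e - #|nbr r' v|) <= kR R (e - #|nbr r' v|) + 1 by rewrite lerDl.
      have [h _] := IH _ e'lt _ e'e le1 _ _ w NS aN N0.
      move: h; rewrite (gmax_next R e'e).1; congr (_ <= (_ + _) / _).
      by rewrite /gap; field; rewrite lt0r_neq0.
    exact: (form_extrapolate l0 kl' gap0 N20 NS aN b0 (sum_deg_sqr_le R NS aN d1) z).1.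
  have [sl slt] := tail _ (lexx _).
  apply: strict sl slt _ => z.
  have kl2 : kR R (e - #|nbr r' v|) <= lam by apply: le_trans kl'; rewrite lerDl.
  exact: (IH _ e'lt _ e'e kl2 _ _ z NS aN N0).1.
split; first by apply: compress_le rS ae => // r' y v ? ? ? ? ?; have [] := @dom_case r' y v.
move=> /(compress_eq lp _ S0 rS ae)[r' y v ? ? ? ? ?|y [v [y0 vS dom]]].
  by have [] := @dom_case r' y v.
by move/(dom_case r y v rS ae y0 vS dom).2.
Qed.

End Main.

(** * The spectral radius as a maximum of Rayleigh quotients *)

Section Hermitian.
Local Open Scope sesquilinear_scope.
Local Open Scope complex_scope.
Variables (C : numClosedFieldType) (n : nat) (A : 'M[C]_n).
Hypotheses (As : A \is symmetricmx) (Ar : A \is a realmx).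
Let U := spectralmx A.
Let d := spectral_diag A.

Let Uu : U \is unitarymx. Proof. exact: spectral_unitarymx. Qed.

Lemma spectral_mulmx : U *m A = diag_mx d *m U.
Proof.
have An : A \is normalmx by apply: hermitian_normalmx; apply: realsym_hermsym.
have /orthomx_spectralP E := An.
by rewrite {1}E -/U -/d !mulmxA mulmxV ?mul1mx // unitarymx_unit.
Qed.

Lemma mulmx_conj_sum (w : 'rV[C]_n) : (w *m w ^t*) 0 0 = \sum_i `|w 0 i| ^+ 2.
Proof. by rewrite mxE; apply: eq_bigr => i _; rewrite !mxE normCK. Qed.

Lemma rayleigh_le (m : C) (y : 'rV[C]_n) : (forall i, `|d 0 i| <= m) ->
  `|(y *m A *m y ^t*) 0 0| <= m * (y *m y ^t*) 0 0.
Proof.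
move=> dm; pose w := y *m U ^t*.
have yE : y = w *m U.
  by rewrite /w -mulmxA -(invmx_unitary Uu) mulVmx ?mulmx1 // unitarymx_unit.
have cE : y ^t* = U ^t* *m w ^t* by rewrite {1}yE trmx_mul map_mxM.
have -> : y *m A *m y ^t* = w *m diag_mx d *m w ^t*.
  rewrite cE {1}yE -mulmxA -!mulmxA (mulmxA U) spectral_mulmx !mulmxA.
  by rewrite mulmxtVK.
have -> : y *m y ^t* = w *m w ^t*.
  by rewrite cE {1}yE !mulmxA mulmxtVK.
rewrite mulmx_conj_sum mulr_sumr mxE; clearbody w.
apply: le_trans (ler_norm_sum _ _ _) _; apply: ler_sum => i _.
rewrite mul_mx_diag !mxE mulrAC -normCK normrM mulrC.
rewrite (ger0_norm (exprn_ge0 2 (normr_ge0 (w 0 i)))).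
exact: (ler_wpM2r (exprn_ge0 2 (normr_ge0 (w 0 i))) (dm i)).
Qed.

Lemma eigenvalue_spectral i : eigenvalue A (d 0 i).
Proof.
apply/eigenvalueP; exists (row i U).
  by rewrite -row_mul spectral_mulmx; apply/rowP => j; rewrite mul_diag_mx !mxE.
have := unitarymx_unit Uu; rewrite -row_free_unit => /row_freeP[B UB].
apply/eqP => r0; have := congr1 (row i) UB.
rewrite row_mul r0 mul0mx => /rowP /(_ i) /eqP.
by rewrite !mxE eqxx eq_sym oner_eq0.
Qed.

Lemma eigenvalue_norm_le (m : C) z : (forall i, `|d 0 i| <= m) -> eigenvalue A z -> `|z| <= m.
Proof.
move=> dm /eigenvalueP[v vA v0].
have := rayleigh_le v dm; rewrite vA -scalemxAl mxE normrM.
have p : 0 < (v *m v ^t*) 0 0.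
  rewrite mulmx_conj_sum lt0r sumr_ge0 ?andbT; last by move=> i _; rewrite exprn_ge0.
  apply: contra v0 => /eqP s0; apply/eqP/rowP => i; rewrite mxE; apply/eqP.
  have h := psumr_eq0P (fun (j : 'I_n) (_ : true) => exprn_ge0 2 (normr_ge0 (v 0 j))) s0.
  by rewrite -normr_eq0 -sqrf_eq0 h.
by rewrite (ger0_norm (ltW p)) ler_pM2r.
Qed.
End Hermitian.

Section SpectralRadius.
Local Open Scope sesquilinear_scope.
Local Open Scope complex_scope.
Variables (R : realType) (G : sgraph).
Let A := adjacency (R[i]) G.
Let d := spectral_diag A.
Let rho := spectral_radius R G.

Let As : A \is symmetricmx.
Proof.
apply/is_hermitianmxP; rewrite expr0 scale1r; apply/matrixP => i j.
by rewrite !mxE edge_sym.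
Qed.

Let Ar : A \is a realmx.
Proof. by apply/mxOverP => i j; rewrite mxE; apply/ger0_real/ler0n. Qed.

Lemma spectral_radius_max : (0 < #|G|)%N ->
  exists i0, rho = Normc.normc (d 0 i0) /\ forall i, `|d 0 i| <= rho%:C.
Proof.
move=> G0; pose f i := Normc.normc (d 0 i).
have nE (z : R[i]) : `|z| = (Normc.normc z)%:C by [].
have [i0 _ i0max] : exists2 i0, true & forall i, f i <= f i0.
  by case: (arg_maxP f (i0 := Ordinal G0) (P := xpredT) isT) => i0 _ h; exists i0 => // i; apply: h.
have dle i : `|d 0 i| <= (f i0)%:C by rewrite nE lecR; apply: i0max.
have sE : rho = f i0.
  apply/eqP; rewrite eq_le; apply/andP; split.
    apply: ge_sup; first by exists (f i0), (d 0 i0); [exact: eigenvalue_spectral | exact: nE].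
    move=> r [z zA zr]; rewrite -lecR -zr; exact: eigenvalue_norm_le zA.
  apply: ub_le_sup; last by exists (d 0 i0); [exact: eigenvalue_spectral | exact: nE].
  exists (f i0) => r [z zA zr]; rewrite -lecR -zr; exact: eigenvalue_norm_le zA.
by exists i0; split=> //; rewrite sE.
Qed.

Lemma sum_enum (M : nmodType) (f : G -> M) : \sum_(i < #|G|) f (enum_val i) = \sum_x f x.
Proof.
by rewrite [RHS](reindex (@enum_val G predT)) //; apply/onW_bij/enum_val_bij.
Qed.

Lemma quad_le_spectral_radius (y : G -> R) : (0 < #|G|)%N ->
  quad (@edge G) y <= rho * \sum_u y u ^+ 2.
Proof.
move=> /spectral_radius_max[i0 [_ dle]].
pose v : 'rV[R[i]]_#|G| := \row_i (y (enum_val i))%:C.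
have := rayleigh_le As Ar v dle.
have vc i : (v ^t*) i 0 = (y (enum_val i))%:C by rewrite !mxE; exact: conjc_real.
have -> : (v *m A *m v ^t*) 0 0 = (quad (@edge G) y)%:C.
  rewrite mxE /quad exchange_big /= -sum_enum rmorph_sum; apply: eq_bigr => j _.
  rewrite vc mxE mulr_suml -(sum_enum (fun u => (edge u (enum_val j))%:R * (y u * y (enum_val j))))
    rmorph_sum.
  by apply: eq_bigr => i _; rewrite !mxE !rmorphM rmorph_nat /=; ring.
have -> : (v *m v ^t*) 0 0 = (\sum_u y u ^+ 2)%:C.
  rewrite mxE -sum_enum rmorph_sum; apply: eq_bigr => i _.
  by rewrite vc mxE -rmorphM expr2.
rewrite -rmorphM => h; rewrite -lecR; apply: le_trans h; apply: real_ler_norm.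
by apply/complex_realP; eexists.
Qed.

(** Take the moduli of an eigenvector whose eigenvalue has largest modulus, whatever its sign:
    adjacency entries being nonnegative, the triangle inequality makes the Rayleigh quotient at
    least [rho]. *)
Lemma spectral_radius_attained : (0 < #|G|)%N -> exists y : G -> R,
  [/\ forall u, 0 <= y u, 0 < \sum_u y u ^+ 2
    & quad (@edge G) y = rho * \sum_u y u ^+ 2].
Proof.
move=> G0; have [i0 [rE _]] := spectral_radius_max G0.
have /eigenvalueP[v vA v0] := eigenvalue_spectral As Ar i0.
have nE (z : R[i]) : `|z| = (Normc.normc z)%:C by [].
pose y u := Normc.normc (v 0 (enum_rank u)).
have y0 u : 0 <= y u by rewrite -lecR -[(y u)%:C]nE normr_ge0.
have ny u : `|v 0 (enum_rank u)| = (y u)%:C by [].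
have vv : (v *m v ^t*) 0 0 = (\sum_u y u ^+ 2)%:C.
  rewrite mulmx_conj_sum -sum_enum rmorph_sum; apply: eq_bigr => i _.
  by rewrite rmorphXn /= -ny enum_valK.
have ge : rho * \sum_u y u ^+ 2 <= quad (@edge G) y.
  rewrite -lecR rmorphM /= -vv.
  have -> : (rho%:C * (v *m v ^t*) 0 0) = `|(v *m A *m v ^t*) 0 0|.
    rewrite vA -scalemxAl [in RHS]mxE normrM; congr (_ * _); first by rewrite rE nE.
    by rewrite ger0_norm // mulmx_conj_sum sumr_ge0 // => i _; rewrite exprn_ge0.
  rewrite mxE; apply: le_trans (ler_norm_sum _ _ _) _.
  rewrite /quad exchange_big /= -sum_enum rmorph_sum; apply: ler_sum => j _.
  rewrite normrM mxE -(sum_enum (fun u => (edge u (enum_val j))%:R * (y u * y (enum_val j))))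
    rmorph_sum.
  apply: le_trans (ler_wpM2r (normr_ge0 _) (ler_norm_sum _ _ _)) _.
  rewrite mulr_suml; apply: ler_sum => i _.
  rewrite !mxE norm_conjC !normrM normr_nat !rmorphM rmorph_nat /= -!ny !enum_valK.
  by rewrite mulrA [`|v 0 i| * _]mulrC.
exists y; split=> //.
  rewrite -ltcR -vv mulmx_conj_sum lt0r sumr_ge0 ?andbT; last by move=> i _; rewrite exprn_ge0.
  apply: contra v0 => /eqP s0; apply/eqP/rowP => i; rewrite mxE; apply/eqP.
  have h := psumr_eq0P (fun (j : 'I_#|G|) (_ : true) => exprn_ge0 2 (normr_ge0 (v 0 j))) s0.
  by rewrite -normr_eq0 -sqrf_eq0 h.
by apply/eqP; rewrite eq_le ge quad_le_spectral_radius.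
Qed.

End SpectralRadius.

Local Opaque spectral_radius.

(** * Cones over quasi-complete graphs and stars *)

Lemma edge_graph_on (G : sgraph) : graph_on [set: G] (@edge G).
Proof. by split=> [x y|x|x y _]; rewrite ?edge_irrefl ?inE // edge_sym. Qed.

Lemma arcs_edge_set (G : sgraph) : arcs (@edge G) = (2 * #|edge_set G|)%N.
Proof.
pose P := [set p : G * G | edge p.1 p.2].
pose f (p : G * G) := [set p.1; p.2]%SET.
have -> : arcs (@edge G) = (\sum_(p in P) 1)%N.
  rewrite big_mkcond /= /arcs /deg pair_big /=; apply: eq_bigr => p _.
  by rewrite inE; case: (edge _ _).
have -> : edge_set G = [set f p | p in P]%SET.
  by apply/setP => s; apply/imsetP/imsetP => -[p pP ->]; exists p; rewrite // ?inE in pP *.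
rewrite (partition_big_imset f) /= mulnC -sum_nat_const; apply: eq_bigr => s.
move=> /imsetP[[a b]]; rewrite inE /= => eab ->.
have ab : a != b by apply: contraTneq eab => ->; rewrite edge_irrefl.
rewrite sum1_card -[RHS](_ : #|[set (a, b); (b, a)]%SET| = 2%N); last first.
  by rewrite cards2 xpair_eqE negb_and ab.
apply: eq_card => -[x y]; rewrite !inE /f /= !xpair_eqE.
apply/andP/orP => [[exy /eqP E]|[] /andP[/eqP-> /eqP->]]; last 2 first.
- by split; rewrite ?inE.
- by split; [rewrite inE /= edge_sym | rewrite /= setUC].
rewrite inE /= in exy; have xy : x != y by apply: contraTneq exy => ->; rewrite edge_irrefl.
have : x \in [set a; b]%SET by rewrite -E set21.
have : y \in [set a; b]%SET by rewrite -E set22.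
rewrite !inE => /orP[] /eqP ey /orP[] /eqP ex; subst; rewrite ?eqxx in xy *; auto.
Qed.

Lemma in_C_arcs n e (G : sgraph) :
  in_C n e G <-> [/\ #|G| = n, connected G & arcs (@edge G) = (2 * (n - 1 + e))%N].
Proof.
split=> -[cG conG eG]; split=> //; first by rewrite arcs_edge_set eG.
by move: eG; rewrite arcs_edge_set => /eqP; rewrite eqn_pmul2l // => /eqP.
Qed.

Section Bijection.
Variables (T1 T2 : finType) (c1 : T1 -> nat) (c2 : T2 -> nat).
Hypothesis same : forall i, #|[set x | c1 x == i]| = #|[set x | c2 x == i]|.

(** An element is sent to the one of the same rank in the class of the same index. *)
Lemma class_bijection : exists2 f : T1 -> T2, bijective f & forall x, c2 (f x) = c1 x.
Proof.
have key (A B : finType) (c : A -> nat) (d : B -> nat) :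
    (forall i, #|[set x | c x == i]| = #|[set x | d x == i]|) ->
    exists2 f : A -> B, injective f & forall x, d (f x) = c x.
  move=> H; pose E x := enum [set y | d y == c x].
  pose i x := index x (enum [set z | c z == c x]).
  have iE x : (i x < size (E x))%N.
    by rewrite -cardE -H cardE index_mem mem_enum inE.
  have ne x : exists y : B, y \in E x.
    by case: (E x) (iE x) => // y s _; exists y; rewrite mem_head.
  pose y0 x := xchoose (ne x).
  pose f x := nth (y0 x) (E x) (i x).
  have fE x : d (f x) = c x.
    by have := mem_nth (y0 x) (iE x); rewrite mem_enum inE => /eqP.
  exists f => // x x' exx.
  have cc : c x = c x' by rewrite -!fE exx.
  have EE : E x = E x' by rewrite /E cc.
  have : i x = i x'.
    apply/eqP; rewrite -(nth_uniq (y0 x) (iE x) _ (enum_uniq _)); last by rewrite -/(E x) EE.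
    rewrite -/(E x) -/(f x) exx /f EE; apply/eqP/set_nth_default; exact: iE.
  have xin : x \in enum [set z | c z == c x'] by rewrite mem_enum inE cc.
  have xin' : x' \in enum [set z | c z == c x'] by rewrite mem_enum inE.
  rewrite /i cc => /(congr1 (nth x (enum [set z | c z == c x']))).
  by rewrite !nth_index.
have [f fi fc] := key _ _ _ _ same.
have [g gi gc] := key _ _ _ _ (fun i => esym (same i)).
exists f => //; apply: inj_card_bij => //; exact: leq_card gi.
Qed.

End Bijection.

(* Class 4 is the apex of the cone. *)
Definition cone (M : rel nat) : rel nat := fun i j => [|| i == 4, j == 4 | M i j]%N.

Definition coned (M : rel nat) (n0 n1 n2 : nat) (G : sgraph) := exists c : G -> nat,
  [/\ forall x y, edge x y = (x != y) && cone M (c x) (c y),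
      forall x, (c x <= 4)%N, #|[set x | c x == 4%N]| = 1%N
    & [/\ #|[set x | c x == 0%N]| = n0, #|[set x | c x == 1%N]| = n1
        & #|[set x | c x == 2%N]| = n2]].
Definition conedD k t G := coned MD t (k - t) (0 < t)%N G.
Definition conedV e G := coned MV 1 e 0 G.

Lemma class_sum (R : pzRingType) (T : finType) (c : T -> nat) (f : nat -> R) :
  (forall x, (c x <= 4)%N) ->
  \sum_x f (c x) = \sum_(i < 5) #|[set x | c x == i]|%:R * f i.
Proof.
move=> c4; under [RHS]eq_bigr => i _ do rewrite mulr_natl -sumr_const.
rewrite [RHS](eq_bigr (fun i : 'I_5 => \sum_(x | c x == i) f (c x))); last first.
  by move=> i _; apply: eq_big => [x|x]; rewrite inE // => /eqP ->.
have c5 x : (c x < 5)%N by rewrite ltnS.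
rewrite (partition_big (fun x => Ordinal (c5 x)) xpredT) //=.
Qed.

Lemma class_card (T : finType) (c : T -> nat) : (forall x, (c x <= 4)%N) ->
  (#|T| = \sum_(i < 5) #|[set x | c x == i]|)%N.
Proof.
move=> c4; have c5 x : (c x < 5)%N by rewrite ltnS.
rewrite -sum1_card (partition_big (fun x => Ordinal (c5 x)) xpredT) //=.
apply: eq_bigr => i _; rewrite -sum1_card; apply: eq_bigl => x.
by rewrite inE -val_eqE.
Qed.

(** Class 3 takes what the other classes leave of [#|G|], so equal orders make all class sizes
    agree. *)
Lemma coned_isomorphic M n0 n1 n2 (G H : sgraph) : #|G| = #|H| ->
  coned M n0 n1 n2 G -> coned M n0 n1 n2 H -> isomorphic G H.
Proof.
move=> GH [c [cE c4 ca [c0 c1 c2]]] [d [dE d4 da [d0 d1 d2]]].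
have same i : #|[set x | c x == i]| = #|[set x | d x == i]|.
  have [i4|i4] := leqP i 4; last first.
    rewrite !eq_card0 // => x; rewrite inE; apply/negP => /eqP e.
      by have := d4 x; rewrite e leqNgt i4.
    by have := c4 x; rewrite e leqNgt i4.
  have := class_card c4; rewrite GH (class_card d4) !big_ord_recr !big_ord0 /=.
  rewrite ca c0 c1 c2 da d0 d1 d2.
  case: i i4 => [|[|[|[|[|]]]]] // _; rewrite ?ca ?c0 ?c1 ?c2 ?da ?d0 ?d1 ?d2 //; lia.
have [f fb fc] := class_bijection same; exists f => // x y.
by rewrite dE cE !fc (inj_eq (bij_inj fb)).
Qed.

Lemma isomorphic_coned M n0 n1 n2 (G H : sgraph) : isomorphic G H ->
  coned M n0 n1 n2 H -> coned M n0 n1 n2 G.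
Proof.
move=> [f fb fE] [d [dE d4 da [d0 d1 d2]]].
have cE i : #|[set x | d (f x) == i]| = #|[set x | d x == i]|.
  have -> : [set x | d x == i] = [set f x | x in [set x | d (f x) == i]]%SET.
    apply/setP => y; rewrite inE; apply/eqP/imsetP => [e|[x]]; last by rewrite inE => /eqP ? ->.
    by have [g gK fK] := fb; exists (g y); rewrite ?inE fK // e.
  by rewrite card_imset //; apply: bij_inj.
exists (d \o f); split.
- by move=> x y; rewrite -fE dE /= (inj_eq (bij_inj fb)).
- by move=> x; apply: d4.
- by rewrite [LHS]cE.
by split; rewrite [LHS]cE.
Qed.

Lemma ord_card_const n (b : bool) : #|[set x : 'I_n | b]| = (b * n)%N.
Proof.
by case: b; rewrite ?cardsT ?card_ord ?mul1n //; apply: eq_card0 => x; rewrite inE.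
Qed.

Lemma card_sum_pred (A B : finType) (P : pred (A + B)) :
  #|[set x | P x]| = (#|[set x | P (inl x)]| + #|[set x | P (inr x)]|)%N.
Proof.
rewrite -!sum1_card big_mkcond big_sumType /= -!big_mkcond.
congr (_ + _)%N; apply: eq_bigl => x; by rewrite !inE.
Qed.

Lemma graph_D_large k t m : conedD k t
  (join (disjoint_union (join (disjoint_union (complete (k - t)) (complete 1)) (complete t))
     (edgeless m)) (complete 1)).
Proof.
(* When t = 0 the single vertex [K_1] sees only the apex and joins class 3. *)
pose cls : 'I_(k - t) + 'I_1 + 'I_t + 'I_m + 'I_1 -> nat := fun x => match x with
  | inr _ => 4 | inl (inr _) => 3 | inl (inl (inr _)) => 0
  | inl (inl (inl (inl _))) => 1 | inl (inl (inl (inr _))) => if (0 < t)%N then 2 else 3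
  end%N.
have I1 (x y : 'I_1) : x = y by rewrite [x]ord1 [y]ord1.
exists cls; split.
- have tp (i : 'I_t) : (0 < t)%N by apply: leq_ltn_trans (ltn_ord i).
  move=> [[[[x|x]|x]|x]|x] [[[[y|y]|y]|y]|y];
    rewrite /= /complete_edge ?(I1 x y) ?eqxx //= ?(tp x) ?(tp y) /= ?andbT ?andbF //;
    by case: (0 < t)%N.
- by move=> [[[[x|x]|x]|x]|x] //=; case: ifP.
- by rewrite !card_sum_pred /= !ord_card_const; case: (posnP t) => t0; rewrite /= ?t0; lia.
by split; rewrite !card_sum_pred /= !ord_card_const; case: (posnP t) => t0; rewrite /= ?t0; lia.
Qed.

Lemma complete_coned k : conedD k 0 (complete k.+1).
Proof.
exists (fun x => if x == ord0 then 4 else 1)%N; split.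
- move=> x y; rewrite /= /complete_edge; case: eqVneq => //= xy.
  by case: ifP => //; case: ifP.
- by move=> x; case: ifP.
- rewrite -[RHS](cards1 (ord0 : 'I_k.+1)); apply: eq_card => x; rewrite !inE.
  by case: ifP.
split.
- by apply: eq_card0 => x; rewrite !inE; case: ifP.
- have -> : [set x : 'I_k.+1 | (if x == ord0 then 4 else 1)%N == 1%N] = [set~ ord0].
    by apply/setP => x; rewrite !inE; case: ifP.
  by rewrite cardsC1 card_ord subn0.
by apply: eq_card0 => x; rewrite !inE; case: ifP.
Qed.

Lemma graph_D_coned n e : (b_ e <= n)%N ->
  conedD (tri e).1 (tri e).2 (graph_D n e) /\ #|graph_D n e| = n.
Proof.
rewrite /b_ /graph_D k_E t_E; have [_ tk] := tri_spec e.
move=> bn; case: leqP => kn.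
  split; first exact: graph_D_large.
  by rewrite !card_sum !card_ord; lia.
have [tz nE] : (tri e).2 = 0%N /\ n = (tri e).1.+1.
  by move: bn; case: eqP => tz; lia.
by rewrite tz nE card_ord; split=> //; apply: complete_coned.
Qed.

Lemma graph_V_coned n e : (e + 2 <= n)%N -> conedV e (graph_V n e) /\ #|graph_V n e| = n.
Proof.
move=> en; split; last by rewrite !card_sum !card_ord; lia.
pose cls : 'I_1 + 'I_e + 'I_(n - e - 2) + 'I_1 -> nat := fun x => match x with
  | inr _ => 4 | inl (inr _) => 3 | inl (inl (inl _)) => 0 | inl (inl (inr _)) => 1
  end%N.
have I1 (x y : 'I_1) : x = y by rewrite [x]ord1 [y]ord1.
exists cls; split.
- move=> [[[x|x]|x]|x] [[[y|y]|y]|y] //=;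
    by rewrite /cls /complete_edge ?(I1 x y) ?eqxx ?andbF ?andbT.
- by move=> [[[x|x]|x]|x].
- by rewrite !card_sum_pred /= !ord_card_const.
by split; rewrite !card_sum_pred /= !ord_card_const /=; lia.
Qed.

Section ConedSums.
Variables (R : fieldType) (M : rel nat) (G : sgraph) (c : G -> nat).
Hypothesis cE : forall x y : G, edge x y = (x != y) && cone M (c x) (c y).
Hypothesis c4 : forall x, (c x <= 4)%N.
Let N i : R := #|[set x | c x == i]|%:R.

(** A row of the quotient matrix applied to [f]; the subtracted term accounts for the missing
    loops. *)
Definition class_nsum (f : nat -> R) (i : nat) : R :=
  N 0 * ((cone M i 0)%:R * f 0%N) + N 1 * ((cone M i 1)%:R * f 1%N)
  + N 2 * ((cone M i 2)%:R * f 2%N) + N 3 * ((cone M i 3)%:R * f 3%N)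
  + N 4 * ((cone M i 4)%:R * f 4%N) - (cone M i i)%:R * f i.

Lemma coned_row_sum f x :
  \sum_u (edge x u)%:R * f (c u) = class_nsum f (c x).
Proof.
rewrite /class_nsum.
have := class_sum (fun j => (cone M (c x) j)%:R * f j) c4.
rewrite !big_ord_recr big_ord0 /= add0r => <-.
rewrite [in RHS](bigD1 x) //= [LHS](bigD1 x) //= edge_irrefl mul0r add0r.
rewrite addrAC subrr add0r; apply: eq_bigr => u ux.
by rewrite cE eq_sym ux.
Qed.

Lemma coned_arcs : (arcs (@edge G))%:R =
  N 0 * class_nsum (fun=> 1) 0 + N 1 * class_nsum (fun=> 1) 1
  + N 2 * class_nsum (fun=> 1) 2 + N 3 * class_nsum (fun=> 1) 3
  + N 4 * class_nsum (fun=> 1) 4 :> R.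
Proof.
have := class_sum (class_nsum (fun=> 1)) c4.
rewrite !big_ord_recr big_ord0 /= add0r => <-.
rewrite /arcs natr_sum; apply: eq_bigr => x _; rewrite -coned_row_sum.
by rewrite /deg natr_sum; apply: eq_bigr => u _; rewrite mulr1.
Qed.

End ConedSums.

Lemma coned_connected M n0 n1 n2 G : coned M n0 n1 n2 G -> connected G.
Proof.
move=> [c [cE c4 ca _]].
have /card_gt0P[v] : (0 < #|[set x | c x == 4%N]|)%N by rewrite ca.
rewrite inE => /eqP cv.
have cv_all x : connect (@edge G) x v.
  by have [->|xv] := eqVneq x v; rewrite ?connect0 // connect1 // cE xv cv /cone eqxx orbT.
move=> x y; apply: connect_trans (cv_all x) _.
by rewrite (sym_connect_sym (@edge_sym G)).
Qed.

Lemma conedD_arcs k t G : (t < k)%N -> conedD k t G ->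
  arcs (@edge G) = (2 * (#|G| - 1 + ('C(k, 2) + t)))%N.
Proof.
move=> tk [c [cE c4 ca [c0 c1 c2]]]; have nE := class_card c4.
rewrite !big_ord_recr big_ord0 /= add0n c0 c1 c2 ca in nE.
have aE := coned_arcs rat cE c4.
rewrite /class_nsum /cone /MD /= c0 c1 c2 ca in aE.
have bE : 2 * 'C(k, 2)%:R = k%:R * (k%:R - 1) :> rat.
  case: k {tk c1 c0 c2 nE aE} => [|k]; first by rewrite bin0n /= !mulr0 mul0r.
  have := mul_bin_diag k.+1 1; rewrite /= bin1 => /eqP.
  by rewrite -(eqr_nat rat) !natrM => /eqP <-; rewrite -[k.+1%:R]natr1; ring.
have G0 : (0 < #|G|)%N by rewrite nE; lia.
apply/eqP; rewrite -(eqr_nat rat) aE natrM !natrD (natrB _ G0) nE !natrD (natrB _ (ltnW tk)).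
have [t0|t0] := posnP t; rewrite ?t0 /=; apply/eqP; move: bE; nra.
Qed.

Lemma conedV_arcs e G : conedV e G -> arcs (@edge G) = (2 * (#|G| - 1 + e))%N.
Proof.
move=> [c [cE c4 ca [c0 c1 c2]]]; have nE := class_card c4.
rewrite !big_ord_recr big_ord0 /= add0n c0 c1 c2 ca in nE.
have aE := coned_arcs rat cE c4.
rewrite /class_nsum /cone /MV /= c0 c1 c2 ca in aE.
have G0 : (0 < #|G|)%N by rewrite nE; lia.
apply/eqP; rewrite -(eqr_nat rat) aE natrM natrD (natrB _ G0) nE.
by rewrite !natrD; apply/eqP; ring.
Qed.

Lemma graph_D_in_C n e : (b_ e <= n)%N -> in_C n e (graph_D n e).
Proof.
move=> /graph_D_coned[D cD]; have [eE tk] := tri_spec e; apply/in_C_arcs; split=> //.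
  exact: coned_connected D.
by rewrite (conedD_arcs tk D) cD -eE.
Qed.

Lemma graph_V_in_C n e : (e + 2 <= n)%N -> in_C n e (graph_V n e).
Proof.
move=> /graph_V_coned[V cV]; apply/in_C_arcs; split=> //.
  exact: coned_connected V.
by rewrite (conedV_arcs V) cV.
Qed.

(** * Maximal graphs are cones *)

Section Apex.
Variables (R : realFieldType) (T : finType).
Implicit Types (r : rel T) (v : T) (y : T -> R).

Definition spans r := forall a b, connect r a b.
Definition apex r v := forall w, w != v -> r v w.

(** Here [u] is a neighbour of [v], unlike in [dominatesP]: the path w, v, u then replaces the lost
    edge wu, and rotation keeps the graph connected. If no such pair exists, the closed
    neighbourhood of [v] is a component. *)
Lemma apexP r v : graph_on [set: T] r -> spans r ->
  apex r v \/ exists u w, [/\ r v u, r w u, ~~ r w v & w != v].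
Proof.
move=> rS con; have [rs _ _] := rS.
case: (pickP [pred p : T * T | [&& r v p.1, r p.2 p.1, ~~ r p.2 v & p.2 != v]]).
  by move=> [u w] /and4P[/= ? ? ? ?]; right; exists u, w.
move=> H; left=> w wv; pose A := [pred x | (x == v) || r v x].
have A_closed : closed r A.
  apply: intro_closed; first exact: sym_connect_sym.
  move=> a b rab /orP[/eqP av|rva]; rewrite inE; first by rewrite -av rab orbT.
  have := H (a, b); rewrite /= rva rs rab /=.
  by rewrite -[r b v]rs; case: (r v b); rewrite ?orbT //= orbF => /negbFE.
have := closed_connect A_closed (con v w).
by rewrite !inE eqxx (negPf wv).
Qed.

Lemma rotate_spans r u w v : graph_on [set: T] r -> r v u -> r w u -> ~~ r w v ->
  w != v -> spans r -> spans (rotate r u w v).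
Proof.
move=> rS rvu rwu rwv wv con a b; have [rs ri _] := rS.
have [rs' _ _] := rotate_graph_on rS rwu wv (in_setT v).
apply: connect_sub (con a b) => {}a {}b rab.
have vu : v != u by apply: contraTneq rvu => ->; rewrite ri.
have wvu : connect (rotate r u w v) w u.
  apply: (@connect_trans _ _ v); apply: connect1; rewrite /rotate ?eqxx //.
  by rewrite rvu (negPf vu) [v == w]eq_sym (negPf wv) /= !orbT.
have [/andP[/eqP-> /eqP->] //|n1] := boolP ((a == w) && (b == u)).
have [/andP[/eqP-> /eqP->]|n2] := boolP ((a == u) && (b == w)).
  by rewrite (sym_connect_sym rs').
by apply: connect1; rewrite /rotate rab (negPf n1) (negPf n2) /= !orbT.
Qed.

Lemma nbr_apex r v : graph_on [set: T] r -> apex r v -> nbr r v = [set~ v].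
Proof.
move=> [_ ri _] av; apply/setP => x; rewrite !inE.
by case: eqVneq => [->|/av]; rewrite ?ri.
Qed.

Lemma apex_bound r v y e lam : graph_on [set: T] r -> apex r v ->
  arcs r = (2 * (#|T| - 1 + e))%N -> (1 < #|T|)%N -> (0 < e <= 130)%N ->
  kR R e <= lam -> 0 < y v -> lam * \sum_u y u ^+ 2 <= quad r y ->
  lam ^+ 2 <= #|T|%:R - 1 + gmax e lam /\
  (lam ^+ 2 = #|T|%:R - 1 + gmax e lam ->
   is_extremal e [set~ v] (unstar r v) lam).
Proof.
move=> rS av ar T1 he kl yv hq.
have [k1 _ _ _] := kRtR R e.
have l0 : 0 < lam by lra.
have dom : dominates r v by move=> a b _; apply: av.
have NE := nbr_apex rS av.
have cN : #|[set~ v]| = (#|T| - 1)%N by rewrite cardsC1 subn1.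
have rN : graph_on [set~ v] (unstar r v) by rewrite -NE; exact: unstar_graph_on rS dom.
have aN : arcs (unstar r v) = (2 * e)%N.
  by have := unstar_arcs v rS; rewrite ar NE cN; lia.
have N0 : [set~ v] != set0 by rewrite -card_gt0 cN; lia.
pose z u := (y v)^-1 * y u.
have [zle zeq] := extremal_le he kl z rN aN N0.
have cNR : #|[set~ v]|%:R = #|T|%:R - 1 :> R by rewrite cN natrB ?(ltnW T1).
rewrite cNR in zle zeq.
have lz : lam <= qform lam 1 [set~ v] (unstar r v) z.
  have -> : qform lam 1 [set~ v] (unstar r v) z =
      (y v)^-2 * (quad r y - lam * \sum_u y u ^+ 2) + lam.
    rewrite (unstar_quad v y rS) NE [\sum_u y u ^+ 2](bigD1 v) //= /qform.
    have -> : quad (unstar r v) z = (y v)^-2 * quad (unstar r v) y.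
      rewrite /quad mulr_sumr; apply: eq_bigr => a _; rewrite mulr_sumr; apply: eq_bigr => b _.
      by rewrite /z; field; rewrite gt_eqF.
    have -> : \sum_(u in [set~ v]) (2 * 1 * z u - lam * z u ^+ 2) =
       (y v)^-2 * (2 * y v * (\sum_(u in [set~ v]) y u) - lam * \sum_(u | u != v) y u ^+ 2).
      have -> : \sum_(u | u != v) y u ^+ 2 = \sum_(u in [set~ v]) y u ^+ 2.
        by apply: eq_bigl => a; rewrite !inE.
      rewrite !big_distrr -sumrB big_distrr /=; apply: eq_bigr => a _.
      by rewrite /z; field; rewrite gt_eqF.
    by field; rewrite gt_eqF.
  by rewrite lerDr mulr_ge0 ?invr_ge0 ?exprn_ge0 ?(ltW yv) // subr_ge0.
have up := le_trans lz zle.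
rewrite ler_pdivlMr // -expr2 in up.
split=> // E; apply: zeq; apply/le_anti; rewrite zle /=.
by rewrite -E expr2 mulfK ?gt_eqF.
Qed.

(** While rotations change the graph, [lam] and [y] stay fixed and only the inequality for the
    Rayleigh quotient is carried along. *)
Lemma max_bound r v y e lam : graph_on [set: T] r -> spans r ->
  arcs r = (2 * (#|T| - 1 + e))%N -> (1 < #|T|)%N -> (0 < e <= 130)%N ->
  kR R e <= lam -> (forall u, 0 <= y u <= y v) -> 0 < y v ->
  lam * \sum_u y u ^+ 2 <= quad r y ->
  lam ^+ 2 <= #|T|%:R - 1 + gmax e lam.
Proof.
move=> rS con ar T1 he kl ymax yv hq.
have [n] := ubnP (#|T| - deg r v); elim: n r rS con ar hq => // n IH r rS con ar hq le_n.
have [av|[u [w [rvu rwu rwv wv]]]] := apexP v rS con.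
  by have [] := apex_bound rS av ar T1 he kl yv hq.
have rS' := rotate_graph_on rS rwu wv (in_setT v).
apply: (IH (rotate r u w v)) => //.
- exact: rotate_spans.
- by rewrite (rotate_arcs rS).
- apply: le_trans hq _; rewrite (rotate_quad rS rwu rwv wv) lerDl mulr_ge0 //.
    by rewrite mulr_ge0 //; case/andP: (ymax w).
  by rewrite subr_ge0; case/andP: (ymax u).
- have d1 := deg_le (rotate r u w v) v.
  by have := rotate_deg u rS rwv wv; lia.
Qed.

End Apex.

Lemma shaped_coned M n0 n1 n2 (G : sgraph) (v : G) :
  apex (@edge G) v -> shaped M n0 n1 n2 [set~ v] (unstar (@edge G) v) -> coned M n0 n1 n2 G.
Proof.
move=> av [c [cE c3 cout [c0 c1 c2]]].
have cv : c v = 3%N by apply: cout; rewrite !inE eqxx.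
pose c' x := if x == v then 4%N else c x.
have c'E i : (i <= 2)%N -> [set x | c' x == i] = [set x | c x == i].
  move=> i2; apply/setP => x; rewrite !inE /c'; have [->|//] := eqVneq x v.
  by rewrite cv; case: i i2 => [|[|[|]]].
exists c'; split.
- move=> x y; rewrite /c' /cone.
  have [->|xv] := eqVneq x v.
    by have [->|yv] := eqVneq y v; rewrite ?edge_irrefl // (av y yv).
  have [->|yv] := eqVneq y v; first by rewrite edge_sym (av x xv) xv orbT.
  have := cE x y; rewrite /unstar xv yv !andbT => ->.
  by have := c3 x; have := c3 y; case: (c x) => [|[|[|[|]]]] //; case: (c y) => [|[|[|[|]]]].
- by move=> x; rewrite /c'; case: ifP => // _; apply: leq_trans (c3 x) _.
- rewrite -[RHS](cards1 v); apply: eq_card => x; rewrite !inE /c'.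
  by case: ifP => // xv; apply/negP => /eqP cx; have := c3 x; rewrite cx.
by split; rewrite c'E.
Qed.

(** * Perron vectors and the structure of maximal graphs *)

Section Perron.
Variable R : realType.
Implicit Types G H : sgraph.

Lemma quad_const1 G : quad (@edge G) (fun=> 1) = (arcs (@edge G))%:R :> R.
Proof.
rewrite /quad /arcs natr_sum; apply: eq_bigr => a _; rewrite /deg natr_sum.
by apply: eq_bigr => b _; rewrite !mulr1.
Qed.

Lemma spectral_radius_gt0 G : (0 < arcs (@edge G))%N -> 0 < spectral_radius R G.
Proof.
move=> a0; have [G0|G0] := posnP #|G|.
  by move: a0; rewrite /arcs big1 // => x; have := fintype0 x; rewrite G0.
have := quad_le_spectral_radius (fun=> 1 : R) G0; rewrite quad_const1.
rewrite expr1n sumr_const => h.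
have : 0 < spectral_radius R G * #|G|%:R by apply: lt_le_trans h; rewrite ltr0n.
by rewrite pmulr_lgt0 // ltr0n.
Qed.

(** The Rayleigh inequality says that the form with linear coefficient 0 is at most 0, with equality
    at [y]; stationarity is the eigenvector equation. *)
Lemma maximizer_eigen G (y : G -> R) v : 0 < spectral_radius R G ->
  quad (@edge G) y = spectral_radius R G * \sum_u y u ^+ 2 ->
  spectral_radius R G * y v = nsum (@edge G) y v.
Proof.
move=> r0 yE; have G0 : (0 < #|G|)%N by apply/card_gt0P; exists v.
have E z : qform (spectral_radius R G) 0 [set: G] (@edge G) z =
    quad (@edge G) z - spectral_radius R G * \sum_u z u ^+ 2.
  rewrite /qform addrC mulr_sumr -sumrN; congr (_ + _).
  by apply: eq_big => u; rewrite ?inE // mulr0 mul0r add0r.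
rewrite -[RHS]add0r; apply: (stationary r0 (edge_graph_on G) (B := 0) _ _ (in_setT v)).
  by move=> z; rewrite E subr_le0 quad_le_spectral_radius.
by rewrite E yE subrr.
Qed.

(** The eigenvector equation makes the zero set of a nonnegative maximizer closed under adjacency,
    and connectedness would spread a single zero to all of [G]. *)
Lemma perron G : connected G -> (0 < arcs (@edge G))%N -> exists y : G -> R,
  (forall u, 0 < y u) /\ quad (@edge G) y = spectral_radius R G * \sum_u y u ^+ 2.
Proof.
move=> con a0; have r0 := spectral_radius_gt0 a0.
have G0 : (0 < #|G|)%N.
  rewrite lt0n; apply: contraTneq a0 => G0.
  by rewrite /arcs big1 // => x; have := fintype0 x; rewrite G0.
have [y [y0 ys yE]] := spectral_radius_attained R G0.
exists y; split=> // u; rewrite lt_neqAle y0 andbT; apply/negP => /eqP yu.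
pose A := [pred x | y x == 0].
have A_closed : closed (@edge G) A.
  apply: intro_closed; first exact/sym_connect_sym/edge_sym.
  move=> a b ab /eqP ya; have := maximizer_eigen a r0 yE.
  rewrite ya mulr0 => /esym /psumr_eq0P -/(_ _ b isT).
  rewrite inE ab mul1r => ->//.
  by move=> i _; rewrite mulr_ge0.
suff : \sum_u y u ^+ 2 = 0 by move/eqP; rewrite gt_eqF.
rewrite big1 // => x _; have := closed_connect A_closed (con u x).
by rewrite !inE -yu eqxx => /esym /eqP ->; rewrite expr0n.
Qed.

Lemma max_vertex G (y : G -> R) : (0 < #|G|)%N -> exists v, forall u, y u <= y v.
Proof.
case/card_gt0P => v0 _.
by case: (arg_maxP y (i0 := v0) (P := xpredT) isT) => v _ h; exists v => u; apply: h.
Qed.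

Lemma scale_squeeze (a b s q q' : R) : 0 < s -> q = a * s -> q <= q' -> q' <= b * s ->
  b <= a -> b = a /\ q' = b * s.
Proof.
move=> s0 -> h1 h2 ba; have /eqP E : b == a.
  by rewrite eq_le ba -(ler_pM2r s0); apply: le_trans h1 h2.
by split=> //; apply/le_anti; rewrite h2 E.
Qed.

(** Otherwise some rotation [H] is again connected and, by maximality of [G], has the same radius
    with [y] as a common eigenvector; comparing the two equations at [v] gives [y w = 0]. *)
Lemma maximal_apex n e G (y : G -> R) v : attains_max_spectral_radius R n e G ->
  0 < spectral_radius R G -> (forall u, 0 < y u <= y v) ->
  quad (@edge G) y = spectral_radius R G * \sum_u y u ^+ 2 -> apex (@edge G) v.
Proof.
move=> [/in_C_arcs[cG con aG] maxG] r0 ymax yE.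
have GS := edge_graph_on G.
have [//|[u [w [vu wu wv nwv]]]] := apexP v GS con.
have GS' := rotate_graph_on GS wu nwv (in_setT v).
have [rs ri _] := GS'.
pose H := SGraph rs ri.
have HC : in_C n e H.
  apply/in_C_arcs; split=> //; first exact: (rotate_spans GS).
  by rewrite -aG; exact: (rotate_arcs GS).
have G0 : (0 < #|H|)%N by apply/card_gt0P; exists v.
have ge : quad (@edge G) y <= quad (rotate (@edge G) u w v) y.
  rewrite (rotate_quad GS wu wv nwv) lerDl !mulr_ge0 //.
    by case/andP: (ymax w) => /ltW.
  by rewrite subr_ge0; case/andP: (ymax u).
have s0 : 0 < \sum_u y u ^+ 2.
  apply: lt_le_trans (_ : y v ^+ 2 <= _).
    by rewrite exprn_gt0 //; case/andP: (ymax v).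
  by rewrite (bigD1 v) //= lerDl sumr_ge0 // => i _; rewrite sqr_ge0.
have le : quad (rotate (@edge G) u w v) y <= spectral_radius R H * \sum_(u : G) y u ^+ 2.
  exact: (quad_le_spectral_radius (G := H) y G0).
have [rE yE'] := scale_squeeze s0 yE ge le (maxG H HC).
have h1 := maximizer_eigen v r0 yE.
have h2 : spectral_radius R H * y v = nsum (rotate (@edge G) u w v) y v.
  by apply: (maximizer_eigen (G := H)) yE'; rewrite rE.
have h3 := rotate_sum_v u GS wv nwv y.
move: h2; rewrite rE h1 /nsum h3 -[LHS]addr0 => /addrI yw.
by have /andP[] := ymax w; rewrite -yw ltxx.
Qed.

Lemma in_C_gt1 n e G : (0 < e)%N -> in_C n e G -> (1 < #|G|)%N /\ (0 < arcs (@edge G))%N.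
Proof.
move=> e0 /in_C_arcs[cG con aG]; have := arcs_le (edge_graph_on G).
by rewrite cardsT aG; case: #|G| => [|[|m]] //; lia.
Qed.

Section Bound.
Variables (n e : nat) (G : sgraph).
Hypotheses (he : (0 < e <= 130)%N) (GC : in_C n e G).
Let rho := spectral_radius R G.
Hypothesis kr : kR R e <= rho.

Lemma radius_bound : rho ^+ 2 <= n%:R - 1 + gmax e rho.
Proof.
have /andP[e0 _] := he; have [G1 a0] := in_C_gt1 e0 GC.
have /in_C_arcs[cG con aG] := GC; have r0 := spectral_radius_gt0 a0.
have [y [y0 yE]] := perron con a0; have [v vmax] := max_vertex y (ltnW G1).
rewrite -cG; apply: (max_bound (edge_graph_on G) con (v := v) (y := y)) => //.
- by rewrite cG.
- by move=> u; rewrite ltW //=.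
- by rewrite yE.
Qed.

Lemma radius_structure : attains_max_spectral_radius R n e G ->
  rho ^+ 2 = n%:R - 1 + gmax e rho ->
  (conedD (tri e).1 (tri e).2 G /\ gmax e rho = gDe e rho) \/
  (conedV e G /\ gmax e rho = gVe e rho).
Proof.
move=> maxG rE.
have /andP[e0 _] := he; have [G1 a0] := in_C_gt1 e0 GC.
have /in_C_arcs[cG con aG] := GC; have r0 := spectral_radius_gt0 a0.
have [y [y0 yE]] := perron con a0; have [v vmax] := max_vertex y (ltnW G1).
have av : apex (@edge G) v.
  by apply: (maximal_apex maxG r0 _ yE) => u; rewrite y0 vmax.
have aG' : arcs (@edge G) = (2 * (#|G| - 1 + e))%N by rewrite cG.
have le : rho * \sum_u y u ^+ 2 <= quad (@edge G) y by rewrite yE.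
have [_] := apex_bound (edge_graph_on G) av aG' G1 he kr (y0 v) le.
rewrite cG => /(_ rE) [[D gE]|[V gE _]]; [left|right]; split=> //; exact: shaped_coned av _.
Qed.

End Bound.
End Perron.

(** * Test vectors for the cones *)

Section Attain.
Variables (R : realFieldType) (G : sgraph).

(** The weights satisfy the eigenvector equation everywhere except at the apex, so only the defect
    at the apex, of weight 1, remains. *)
Lemma coned_quad M (c : G -> nat) (f : nat -> R) lam :
  (forall x y : G, edge x y = (x != y) && cone M (c x) (c y)) ->
  (forall x, (c x <= 4)%N) -> #|[set x | c x == 4%N]| = 1%N -> f 4%N = 1 ->
  (forall i, (i < 4)%N -> [set x | c x == i] != set0 -> class_nsum M c f i = lam * f i) ->
  quad (@edge G) (f \o c) = lam * (\sum_x f (c x) ^+ 2)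
    + (\sum_(i < 4) #|[set x | c x == i]|%:R * f i - lam).
Proof.
move=> cE c4 ca f4 rows.
have -> : quad (@edge G) (f \o c) = \sum_x f (c x) * class_nsum M c f (c x).
  by rewrite quadE; apply: eq_bigr => x _; rewrite -(coned_row_sum cE c4).
rewrite (class_sum (fun i => f i * class_nsum M c f i) c4) (class_sum (fun i => f i ^+ 2) c4).
have row4 : class_nsum M c f 4 = \sum_(i < 4) #|[set x | c x == i]|%:R * f i.
  by rewrite /class_nsum /cone /= ca f4 !big_ord_recr big_ord0 /=; ring.
rewrite big_ord_recr [in RHS]big_ord_recr /= ca f4 row4.
set s := \sum_(i < 4) _ * f i.
have -> : \sum_(i < 4) #|[set x | c x == i]|%:R * (f i * class_nsum M c f i) =
    lam * \sum_(i < 4) #|[set x | c x == i]|%:R * f i ^+ 2.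
  rewrite big_distrr /=; apply: eq_bigr => i _.
  have [->|ne] := eqVneq [set x | c x == i] set0; first by rewrite cards0 !mul0r mulr0.
  by rewrite rows //; ring.
by clearbody s; ring.
Qed.

Lemma coned_norm_gt0 (c : G -> nat) (f : nat -> R) :
  #|[set x | c x == 4%N]| = 1%N -> f 4%N = 1 -> 0 < \sum_x f (c x) ^+ 2.
Proof.
move=> ca f4; have /card_gt0P[v] : (0 < #|[set x | c x == 4%N]|)%N by rewrite ca.
rewrite inE => /eqP cv; rewrite (bigD1 v) //= cv f4 expr1n.
by rewrite ltr_wpDr ?ltr01 // sumr_ge0 // => x _; rewrite sqr_ge0.
Qed.

Lemma conedD_attain k t lam : (t < k)%N -> conedD k t G -> k%:R <= lam ->
  exists y : G -> R, 0 < \sum_x y x ^+ 2 /\ quad (@edge G) y =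
    lam * (\sum_x y x ^+ 2) + ((#|G|%:R - 1 + gD k%:R t%:R lam) / lam - lam).
Proof.
move=> tk [c [cE c4 ca [c0 c1 c2]]] kl.
have k1 : 1 <= k%:R :> R by rewrite ler1n; lia.
have l0 : 0 < lam by lra.
have ln : lam != 0 by rewrite gt_eqF.
have dn : denD k%:R t%:R lam != 0.
  by rewrite gt_eqF // denD_gt0 ?ler0n // natr1 ler_nat.
(* Cramer's solution of the equations lam f_i = 1 + (sum of f over the other neighbours), the 1
   coming from the apex; a vertex of class 3 sees the apex only and gets [lam^-1]. *)
pose f := nth (1 : R) [:: ((lam + 1) ^+ 2 - (k%:R - t%:R)) / denD k%:R t%:R lam;
  lam * (lam + 1) / denD k%:R t%:R lam;
  (lam + 1) * (lam + 1 - k%:R + t%:R) / denD k%:R t%:R lam; lam^-1].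
exists (f \o c); split; first exact: coned_norm_gt0.
have ktR : (k - t)%:R = k%:R - t%:R :> R by rewrite natrB // ltnW.
rewrite (coned_quad (lam := lam) (f := f) cE) //; last first.
  (* For t = 0 the classes 0 and 2 are empty, which leaves the rows of classes 1 and 3. *)
  have [t0|t0] := posnP t.
    rewrite t0 ?subn0 /= in c0 c1 c2 dn; rewrite /f t0 mulr0n subr0 addr0.
    move=> [|[|[|[|]]]] // _; rewrite -card_gt0 /class_nsum /cone /MD ?c0 ?c1 ?c2 //= => _;
      rewrite ca.
      by move: dn; rewrite /denD addr0 mul0r addr0 => dn; field; rewrite dn ln.
    by field; rewrite ?ln ?dn.
  move=> [|[|[|[|]]]] // _ _; rewrite /class_nsum /cone /MD c0 c1 c2 ca ktR t0 /f /=.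
  - by move: dn; rewrite /denD => dn; field; rewrite ?dn ?ln.
  - by move: dn; rewrite /denD => dn; field; rewrite ?dn ?ln.
  - by move: dn; rewrite /denD => dn; field; rewrite ?dn ?ln.
  by field; rewrite ?ln ?dn.
congr (_ + (_ - _)).
have nE := class_card c4.
have : #|G|%:R = t%:R + (k%:R - t%:R) + (0 < t)%N%:R + #|[set x | c x == 3%N]|%:R + 1 :> R.
  by rewrite nE !big_ord_recr big_ord0 /= add0n c0 c1 c2 ca !natrD ktR.
move=> ->; rewrite !big_ord_recr big_ord0 /= c0 c1 c2 ktR /gD /numD /f /denD /=.
move: dn; rewrite /denD => dn; have [t0|t0] := posnP t; rewrite ?t0 /=.
  by rewrite t0 addr0 mul0r addr0 in dn; field; rewrite dn ln.
by field; rewrite dn ln.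
Qed.

Lemma conedV_attain e lam : conedV e G -> 0 < lam -> 0 < lam ^+ 2 - e%:R ->
  exists y : G -> R, 0 < \sum_x y x ^+ 2 /\ quad (@edge G) y =
    lam * (\sum_x y x ^+ 2) + ((#|G|%:R - 1 + gV e%:R lam) / lam - lam).
Proof.
move=> [c [cE c4 ca [c0 c1 c2]]] l0 dp.
have ln : lam != 0 by rewrite gt_eqF.
have dn : lam ^+ 2 - e%:R != 0 by rewrite gt_eqF.
(* Obtained in the same way; the third entry is arbitrary, class 2 being empty. *)
pose f := nth (1 : R) [:: (lam + e%:R) / (lam ^+ 2 - e%:R); (lam + 1) / (lam ^+ 2 - e%:R);
  1; lam^-1].
exists (f \o c); split; first exact: coned_norm_gt0.
rewrite (coned_quad (lam := lam) (f := f) cE) //; last first.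
  move=> [|[|[|[|]]]] // _; rewrite -card_gt0 /class_nsum /cone /MV c0 c1 c2 ca /f /= => ne.
  - by field; rewrite ?dn.
  - by field; rewrite ?dn.
  - by [].
  - by field; rewrite ?ln ?dn.
congr (_ + (_ - _)).
have nE := class_card c4.
have : #|G|%:R = 1 + e%:R + #|[set x | c x == 3%N]|%:R + 1 :> R.
  by rewrite nE !big_ord_recr big_ord0 /= add0n c0 c1 c2 ca !natrD addr0.
move=> ->; rewrite !big_ord_recr big_ord0 /= c0 c1 c2 /gV /f /=.
by field; rewrite ?dn ?ln.
Qed.

End Attain.

Section Radius.
Variable R : realType.
Implicit Types G H : sgraph.

Lemma spectral_radius_ge G lam d : (0 < #|G|)%N -> 
  (exists y : G -> R, 0 < \sum_x y x ^+ 2 /\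
     quad (@edge G) y = lam * (\sum_x y x ^+ 2) + d) ->
  (0 <= d -> lam <= spectral_radius R G) /\ (0 < d -> lam < spectral_radius R G).
Proof.
move=> G0 [y [y0 yE]]; have := quad_le_spectral_radius y G0; rewrite yE => h.
split=> d0.
  by rewrite -(ler_pM2r y0); apply: le_trans h; rewrite lerDl.
by rewrite -(ltr_pM2r y0); apply: lt_le_trans h; rewrite ltrDl.
Qed.

Lemma conedD_radius_ge k t G lam : (t < k)%N -> conedD k t G -> k%:R <= lam ->
  (lam ^+ 2 <= #|G|%:R - 1 + gD k%:R t%:R lam -> lam <= spectral_radius R G) /\
  (lam ^+ 2 < #|G|%:R - 1 + gD k%:R t%:R lam -> lam < spectral_radius R G).
Proof.
move=> tk D kl; have G0 : (0 < #|G|)%N.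
  by have [c [_ _ ca _]] := D; apply: leq_trans (max_card (mem [set x | c x == 4%N])); rewrite ca.
have l0 : 0 < lam by apply: lt_le_trans kl; rewrite ltr0n; lia.
have [ge gt] := spectral_radius_ge G0 (conedD_attain tk D kl).
by split=> h; [apply: ge | apply: gt]; rewrite ?subr_ge0 ?subr_gt0 ?ler_pdivlMr ?ltr_pdivlMr //
  -expr2.
Qed.

Lemma conedV_radius_ge e G lam : conedV e G -> 0 < lam -> 0 < lam ^+ 2 - e%:R ->
  (lam ^+ 2 <= #|G|%:R - 1 + gV e%:R lam -> lam <= spectral_radius R G) /\
  (lam ^+ 2 < #|G|%:R - 1 + gV e%:R lam -> lam < spectral_radius R G).
Proof.
move=> V l0 dp; have G0 : (0 < #|G|)%N.
  by have [c [_ _ ca _]] := V; apply: leq_trans (max_card (mem [set x | c x == 4%N])); rewrite ca.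
have [ge gt] := spectral_radius_ge G0 (conedV_attain V l0 dp).
by split=> h; [apply: ge | apply: gt]; rewrite ?subr_ge0 ?subr_gt0 ?ler_pdivlMr ?ltr_pdivlMr //
  -expr2.
Qed.

(* D contains a clique on k + 1 vertices. *)
Lemma conedD_radius_ge_k k t G : (t < k)%N -> conedD k t G -> k%:R <= spectral_radius R G.
Proof.
move=> tk D; have [ge _] := conedD_radius_ge tk D (lexx _); apply: ge.
have t0 : 0 <= t%:R :> R by [].
have tk' : t%:R + 1 <= k%:R :> R by rewrite natr1 ler_nat.
have d0 : 0 < denD k%:R t%:R k%:R :> R by apply: denD_gt0.
have nk : k%:R <= #|G|%:R - 1 :> R.
  rewrite lerBrDr natr1 ler_nat; have [c [_ c4 ca [c0 c1 _]]] := D.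
  by rewrite (class_card c4) !big_ord_recr big_ord0 /= c0 c1 ca; lia.
suff : k%:R ^+ 2 - k%:R <= gD k%:R t%:R k%:R :> R by lra.
rewrite /gD ler_pdivlMr // -subr_ge0.
have -> : numD k%:R t%:R k%:R - (k%:R ^+ 2 - k%:R) * denD k%:R t%:R k%:R =
   2 * t%:R * k%:R ^+ 2 + k%:R ^+ 2 * t%:R ^+ 2 + t%:R ^+ 2 * k%:R + 2 * t%:R * k%:R
   + t%:R ^+ 2 + t%:R :> R by rewrite /numD /denD; ring.
by rewrite !(addr_ge0, mulr_ge0, exprn_ge0) ?ler0n.
Qed.

End Radius.

(* In V all edges meet two fixed vertices, whereas D contains a clique on four. *)
Lemma conedD_not_conedV k t e G : (t < k)%N -> (2 < k)%N -> conedD k t G -> ~ conedV e G.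
Proof.
move=> tk k2 [c [cE c4 ca [c0 c1 c2]]] [d [dE d4 da [d0 d1 d2]]].
have /eqP/cards1P[p pE] := da; have /eqP/cards1P[q qE] := d0.
have dp x : (d x == 4%N) = (x == p) by rewrite -[RHS]in_set1 -pE inE.
have dq x : (d x == 0%N) = (x == q) by rewrite -[RHS]in_set1 -qE inE.
pose f i : int := [|| i == 0, i == 1 | i == 4]%N.
pose Q := [set x | [|| c x == 0, c x == 1 | c x == 4]%N].
have cQ : #|Q| = k.+1.
  have : #|Q|%:R = k.+1%:R :> int.
    rewrite -sum1_card natr_sum big_mkcond /=.
    rewrite (eq_bigr (fun x => f (c x))); last by move=> x _; rewrite inE /f; case: ifP.
    by rewrite (class_sum f c4) !big_ord_recr big_ord0 /= c0 c1 ca /f /=; lia.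
  by move/eqP; rewrite eqr_nat => /eqP.
have : (1 < #|Q :\: [set p; q]|)%N.
  have := cardsID [set p; q] Q; have := subset_leq_card (subsetIr Q [set p; q]).
  by rewrite cards2 cQ; case: (p != q); lia.
case/card_gt1P => x [y []]; rewrite !inE !negb_or.
move=> /andP[/andP[xp xq] cx] /andP[/andP[yp yq] cy] xy.
have e1 : edge x y.
  rewrite cE xy /cone /MD.
  by case/or3P: cx => /eqP ->; case/or3P: cy => /eqP ->.
move: e1; rewrite dE xy /cone /MV dp dq.
by rewrite !dp !dq (negPf xp) (negPf xq) (negPf yp) (negPf yq) /= andbF.
Qed.

Lemma conedD_iso n e G : (b_ e <= n)%N ->
  isomorphic G (graph_D n e) <-> #|G| = n /\ conedD (tri e).1 (tri e).2 G.
Proof.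
move=> bn; have [D cD] := graph_D_coned bn; split=> [iso|[cG DG]]; last first.
  by apply: coned_isomorphic DG D; rewrite cD.
  split; last exact: isomorphic_coned iso D.
  by have [f fb _] := iso; rewrite (bij_eq_card fb).
Qed.

Lemma conedV_iso n e G : (e + 2 <= n)%N ->
  isomorphic G (graph_V n e) <-> #|G| = n /\ conedV e G.
Proof.
move=> bn; have [V cV] := graph_V_coned bn; split=> [iso|[cG VG]]; last first.
  by apply: coned_isomorphic VG V; rewrite cV.
  split; last exact: isomorphic_coned iso V.
  by have [f fb _] := iso; rewrite (bij_eq_card fb).
Qed.

Lemma cubic_ge0 (R : realFieldType) (p0 p1 p2 p3 : R) : 0 <= p2 -> 0 < p3 ->
  exists2 y, 1 <= y & 0 <= p0 + p1 * y + p2 * y ^+ 2 + p3 * y ^+ 3.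
Proof.
move=> h2 h3; have [a0 b0] := (normr_ge0 p0, normr_ge0 p1).
have pa := ler_norm (- p0); have pb := ler_norm (- p1); rewrite !normrN in pa pb.
(* A Cauchy bound: beyond this point the cubic term outweighs [p0] and [p1]. *)
have [y y1 E] : exists2 y, 1 <= y & p3 * y = p3 + `|p0| + `|p1|.
  exists (1 + (`|p0| + `|p1|) / p3); last by field; rewrite gt_eqF.
  by rewrite lerDl divr_ge0 ?addr_ge0 // ltW.
have y0 : 0 <= y by apply: le_trans y1; exact: ler01.
exists y => //; have -> : p3 * y ^+ 3 = y ^+ 2 * (p3 * y) by ring.
move: `|p0| `|p1| a0 b0 pa pb E => a b a0 b0 pa pb ->.
have aY : a <= y ^+ 2 * a by rewrite ler_peMl // exprn_ege1.
have bY : y * b <= y ^+ 2 * b by rewrite ler_wpM2r // ler_eXnr.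
have pY : 0 <= y * (p1 + b) by rewrite mulr_ge0 // -lerBlDl sub0r.
have p3Y : 0 <= y ^+ 2 * p3 by rewrite mulr_ge0 ?exprn_ge0 // ltW.
have p2Y : 0 <= p2 * y ^+ 2 by rewrite mulr_ge0 ?exprn_ge0.
lra.
Qed.

(** * The threshold *)

Section Threshold.
Variables (R : realType) (e : nat).
Hypothesis he : (4 <= e <= 130)%N.

Lemma horner_Psi x : (Psi R e).[x] = psiR e x.
Proof.
rewrite /Psi /psiR /psi_poly k_E t_E -/(kR R e) -/(tR R e) !hornerE.
by rewrite ?hornerXn; ring.
Qed.

(** A root above k_e + 1 comes from the intermediate value theorem; the single sign change makes it
    the largest root, hence the supremum [psi]. *)
Lemma psi_signs : [/\ kR R e + 1 < psi R e, psiR e (psi R e) = 0,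
  forall x, kR R e <= x -> x < psi R e -> psiR e x < 0
  & forall x, psi R e < x -> 0 < psiR e x].
Proof.
have [c [d1]] := check_edgesP he; rewrite /check_edges; case tE: (tri e) => [k t].
move=> /andP[chk _].
have [|neg [p0 [p1 [p2 [p3 [h0 h2 h3 qE]]]]]] := @psi_cubic R e; first by rewrite tE.
pose q y := p0 + p1 * y + p2 * y ^+ 2 + p3 * y ^+ 3.
(* Monotonicity of q(y) / y, multiplied out to include y = 0. *)
have mono y y' : 0 <= y -> y < y' -> 0 < y * q y' - y' * q y.
  move=> y0 yy; have -> : y * q y' - y' * q y =
    (y' - y) * (- p0 + p2 * (y * y') + p3 * (y * y') * (y + y')) by rewrite /q; ring.
  have y'0 := le_lt_trans y0 yy.
  rewrite mulr_gt0 ?subr_gt0 // -addrA ltr_wpDr ?oppr_gt0 //.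
  by rewrite !(addr_ge0, mulr_ge0) ?(ltW h3) ?(ltW y'0).
have [Y Y1 qY] := cubic_ge0 p0 p1 h2 h3.
have [||x /andP[x1 x2] xr] := @poly_ivt R (Psi R e) (kR R e + 1) (kR R e + Y).
- by rewrite lerD2l.
- by rewrite !horner_Psi (ltW neg) qE.
have x0 : psiR e x = 0 by apply/eqP; rewrite -horner_Psi.
have kx : kR R e + 1 < x.
  by rewrite lt_neqAle x1 andbT; apply/eqP => kx; move: neg; rewrite kx x0 ltxx.
pose y := x - kR R e; have xE : x = kR R e + y by rewrite /y addrC subrK.
have qy : q y = 0 by rewrite /q -qE -xE.
have above z : x < z -> 0 < psiR e z.
  move=> xz; have -> : z = kR R e + (z - kR R e) by rewrite addrC subrK.
  rewrite qE -/(q _); have := @mono y (z - kR R e); rewrite qy mulr0 subr0.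
  by rewrite pmulr_rgt0; [apply; rewrite /y; lra | rewrite /y; lra].
have psiE : psi R e = x.
  apply/le_anti/andP; split.
    apply: ge_sup; first by exists x.
    move=> z; rewrite /= => /eqP; rewrite horner_Psi => z0; rewrite leNgt; apply/negP => /above.
    by rewrite z0 ltxx.
  apply: ub_le_sup => //; exists x => z /= /eqP; rewrite horner_Psi => z0.
  by rewrite leNgt; apply/negP => /above; rewrite z0 ltxx.
rewrite psiE; split=> // z kz zx.
have -> : z = kR R e + (z - kR R e) by rewrite addrC subrK.
rewrite qE -/(q _); have := @mono (z - kR R e) y; rewrite qy mulr0 sub0r oppr_gt0.
by rewrite pmulr_rlt0; [apply; rewrite /y; lra | rewrite /y; lra].
Qed.

End Threshold.

Lemma tri_gt2 e : (4 <= e)%N -> (2 < (tri e).1)%N.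
Proof.
move=> e4; have [eE tk] := tri_spec e; rewrite ltnNge; apply/negP => k2.
have : ('C((tri e).1, 2) <= 'C(2, 2))%N by rewrite leq_bin2l.
by rewrite binn; lia.
Qed.

Lemma conedD_in_C n e (G : sgraph) : (0 < n)%N -> #|G| = n ->
  conedD (tri e).1 (tri e).2 G -> in_C n e G.
Proof.
move=> n0 cG D; have [eE tk] := tri_spec e; apply/in_C_arcs; split=> //.
  exact: coned_connected D.
by rewrite (conedD_arcs tk D) cG -eE.
Qed.

Lemma conedV_in_C n e (G : sgraph) : #|G| = n -> conedV e G -> in_C n e G.
Proof.
move=> cG V; apply/in_C_arcs; split=> //; first exact: coned_connected V.
by rewrite (conedV_arcs V) cG.
Qed.

Section Crossing.
Variables (R : realType) (e : nat).
Hypothesis he : (4 <= e <= 130)%N.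
Local Notation P := (psi R e).

Lemma kR_lt_psi : kR R e < P.
Proof. by have [h _ _ _] := psi_signs R he; lra. Qed.

Lemma gmax_below lam : kR R e <= lam -> lam < P ->
  gmax e lam = gDe e lam /\ gVe e lam < gDe e lam.
Proof.
move=> kl lP; have [_ _ neg _] := psi_signs R he; have [h _] := gVe_lt_gDe kl.
have lt : gVe e lam < gDe e lam by rewrite h neg.
by split=> //; rewrite /gmax max_l ?ltW.
Qed.

Lemma gmax_above lam : P < lam -> gmax e lam = gVe e lam /\ gDe e lam < gVe e lam.
Proof.
move=> Pl; have kl : kR R e <= lam by have := kR_lt_psi; lra.
have [_ _ _ pos] := psi_signs R he; have [_ h] := gVe_lt_gDe kl.
have lt : gDe e lam < gVe e lam by rewrite h pos.
by split=> //; rewrite /gmax max_r ?ltW.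
Qed.

Lemma gDe_psi : gDe e P = gVe e P.
Proof.
have [_ z _ _] := psi_signs R he; apply/eqP; rewrite -subr_eq0 gDe_sub_gVe ?(ltW kR_lt_psi) //.
by rewrite z oppr0 mul0r.
Qed.

Lemma gmax_psi : gmax e P = gDe e P.
Proof. by rewrite /gmax -gDe_psi maxxx. Qed.

Lemma omegaE : omega R e = 1 + P ^+ 2 - gVe e P.
Proof.
have d0 := edges_lt_sqr (ltW kR_lt_psi).
by rewrite /omega /gVe /gV; field; rewrite gt_eqF.
Qed.

Lemma omega_gt : e%:R + 2 < omega R e.
Proof.
have d0 := edges_lt_sqr (ltW kR_lt_psi); have [k1 t0 tk e2] := kRtR R e.
have [kP _ _ _] := psi_signs R he.
rewrite /omega ltrDl divr_gt0 // mulr_gt0 //; first by rewrite mulr_gt0; lra.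
(* This suffices because t <= k - 1 gives 2 e <= k^2 + k - 2. *)
have : (kR R e + 1) * kR R e < P * (P - 1) by rewrite ltr_pM //; lra.
lra.
Qed.

(** This function equals [omega R e - 1] at [psi], so comparing [n] with [omega] locates a radius
    relative to [psi]. *)
Lemma sqr_sub_gVe_mono a b : kR R e <= a -> a < b -> a ^+ 2 - gVe e a < b ^+ 2 - gVe e b.
Proof.
move=> ka ab; have kb : kR R e <= b by lra.
have [k1 _ _ _] := kRtR R e.
have [da db] := (edges_lt_sqr ka, edges_lt_sqr kb).
have sq : a ^+ 2 < b ^+ 2 by rewrite ltr_pXn2r // nnegrE; lra.
suff : gVe e b <= gVe e a by lra.
rewrite -subr_ge0 (_ : gVe e a - gVe e b = (e%:R * (2 * a * b * (b - a)
  + (1 + e%:R) * (b ^+ 2 - a ^+ 2) + 2 * e%:R * (b - a)))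
    / ((a ^+ 2 - e%:R) * (b ^+ 2 - e%:R))); last first.
  by rewrite /gVe /gV; field; rewrite !gt_eqF.
have e0 : 0 <= e%:R :> R by [].
apply: divr_ge0; last by rewrite mulr_ge0 // ltW.
have d1 : 0 <= b - a by lra.
have d2 : 0 <= b ^+ 2 - a ^+ 2 by lra.
have [a0 b0] : 0 <= a /\ 0 <= b by split; lra.
have e1 : 0 <= 1 + e%:R :> R by rewrite addr_ge0.
by rewrite mulr_ge0 // addr_ge0 ?addr_ge0 ?mulr_ge0.
Qed.

End Crossing.

(** * Comparison of the radii on both sides of the threshold *)

Section Final.
Variables (R : realType) (e n : nat).
Hypothesis he : (4 <= e <= 130)%N.
Local Notation P := (psi R e).
Local Notation rho := (spectral_radius R).
Implicit Types G H : sgraph.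

Let he' : (0 < e <= 130)%N.
Proof. by case/andP: he => e4 ->; rewrite andbT; lia. Qed.

Let tk : ((tri e).2 < (tri e).1)%N.
Proof. by case: (tri_spec e). Qed.

(** The number [rho G] itself is the test value for [H]: below [psi] the upper bound for [G] is the
    criterion for [rho G <= rho H]. A radius below k_e is beaten by the clique in [H]. *)
Lemma radius_le_D G H : in_C n e G -> #|H| = n -> conedD (tri e).1 (tri e).2 H ->
  rho G <= P -> rho G <= rho H.
Proof.
move=> GC cH DH GP.
have [kG|kG] := leP (kR R e) (rho G); last first.
  by apply: le_trans (ltW kG) _; apply: conedD_radius_ge_k tk DH.
have [ge _] := conedD_radius_ge tk DH kG; apply: ge; rewrite cH.
have gE : gmax e (rho G) = gDe e (rho G).
  move: GP; rewrite le_eqVlt => /orP[/eqP-> |GP]; first exact: gmax_psi.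
  by have [] := gmax_below he kG GP.
by have := radius_bound he' GC kG; rewrite gE.
Qed.

Lemma radius_le_V G H : in_C n e G -> #|H| = n -> conedV e H -> P <= rho G -> rho G <= rho H.
Proof.
move=> GC cH VH GP; have kP := kR_lt_psi R he.
have kG : kR R e <= rho G by apply: le_trans GP; apply: ltW.
have [k1 _ _ _] := kRtR R e; have G0 : 0 < rho G by lra.
have [ge _] := conedV_radius_ge VH G0 (edges_lt_sqr kG); apply: ge; rewrite cH.
have gE : gmax e (rho G) = gVe e (rho G).
  move: GP; rewrite le_eqVlt => /orP[/eqP <- |GP]; first by rewrite gmax_psi // gDe_psi.
  by have [] := gmax_above he GP.
by have := radius_bound he' GC kG; rewrite gE.
Qed.

Lemma radius_le_psi G : in_C n e G -> n%:R <= omega R e -> rho G <= P.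
Proof.
move=> GC nw; rewrite leNgt; apply/negP => PG; have kP := kR_lt_psi R he.
have kG : kR R e <= rho G by apply/ltW/(lt_trans kP).
have := radius_bound he' GC kG; have [-> _] := gmax_above he PG.
have := sqr_sub_gVe_mono (ltW kP) PG; move: nw; rewrite omegaE //; lra.
Qed.

Lemma radius_lt_psi G : in_C n e G -> n%:R < omega R e -> rho G < P.
Proof.
move=> GC nw; rewrite lt_neqAle radius_le_psi ?(ltW nw) // andbT.
apply/eqP => GP; have kP := kR_lt_psi R he.
have kG : kR R e <= rho G by rewrite GP ltW.
have := radius_bound he' GC kG; rewrite GP gmax_psi // gDe_psi //.
by move: nw; rewrite omegaE //; lra.
Qed.

Lemma psi_le_radius_V H : #|H| = n -> conedV e H ->
  (omega R e <= n%:R -> P <= rho H) /\ (omega R e < n%:R -> P < rho H).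
Proof.
move=> cH VH; have kP := kR_lt_psi R he; have [k1 _ _ _] := kRtR R e.
have P0 : 0 < P by lra.
have [ge gt] := conedV_radius_ge VH P0 (edges_lt_sqr (ltW kP)).
by split=> h; [apply: ge | apply: gt]; move: h; rewrite cH omegaE // -/(gVe e P); lra.
Qed.

(** Were the upper bound strict for [G], then D or V, according to the side of [psi], would have a
    larger radius. The last hypothesis ensures that V exists when it is the competitor. *)
Lemma maximal_structure G : (b_ e <= n)%N ->
  attains_max_spectral_radius R n e G ->
  (P < rho G -> (e + 2 <= n)%N) ->
  conedD (tri e).1 (tri e).2 G /\ rho G <= P \/ conedV e G /\ P <= rho G.
Proof.
move=> hn maxG PV; have [GC maxG'] := maxG; have [D cD] := graph_D_coned hn.
have DG := maxG' _ (graph_D_in_C hn).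
have kG : kR R e <= rho G by apply: le_trans DG; apply: conedD_radius_ge_k tk D.
have le := radius_bound he' GC kG.
have E : rho G ^+ 2 = n%:R - 1 + gmax e (rho G).
  apply/eqP; rewrite eq_le le /= leNgt; apply/negP => lt.
  have [GP|PG] := leP (rho G) P.
    have gE : gmax e (rho G) = gDe e (rho G).
      move: GP; rewrite le_eqVlt => /orP[/eqP-> |GP]; first exact: gmax_psi.
      by have [] := gmax_below he kG GP.
    have [_ gt] := conedD_radius_ge tk D kG.
    by move: DG; rewrite leNgt gt // cD; move: lt; rewrite gE.
  have [V cV] := graph_V_coned (PV PG).
  have VG := maxG' _ (graph_V_in_C (PV PG)).
  have [k1 _ _ _] := kRtR R e; have G0 : 0 < rho G by lra.
  have [gE _] := gmax_above he PG.
  have [_ gt] := conedV_radius_ge V G0 (edges_lt_sqr kG).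
  by move: VG; rewrite leNgt gt // cV; move: lt; rewrite gE.
have [[DG' gE]|[VG gE]] := radius_structure he' GC kG maxG E; [left|right]; split=> //.
  rewrite leNgt; apply/negP => PG; have [gE' lt] := gmax_above he PG.
  by move: lt; rewrite -gE' -gE ltxx.
rewrite leNgt; apply/negP => GP; have [gE' lt] := gmax_below he kG GP.
by move: lt; rewrite -gE' -gE ltxx.
Qed.

End Final.

Theorem theorem4p7 (R : realType) (e n : nat)
    (he : (4 <= e <= 130)%N) (hn : (b_ e <= n)%N) :
  [/\ n%:R < omega R e ->
        forall G : sgraph,
          attains_max_spectral_radius R n e G <-> isomorphic G (graph_D n e),
      n%:R = omega R e ->
        ~ isomorphic (graph_D n e) (graph_V n e) /\
        forall G : sgraph,
          attains_max_spectral_radius R n e G <->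
          isomorphic G (graph_D n e) \/ isomorphic G (graph_V n e)
    & omega R e < n%:R ->
        forall G : sgraph,
          attains_max_spectral_radius R n e G <-> isomorphic G (graph_V n e)].
Proof.
have tk : ((tri e).2 < (tri e).1)%N by case: (tri_spec e).
have n0 : (0 < n)%N.
  apply: leq_trans hn; rewrite /b_ k_E; case: ifP; lia.
have [D cD] := graph_D_coned hn.
(* As [omega] exceeds e + 2, the graph V exists from the threshold on. *)
have en : omega R e <= n%:R -> (e + 2 <= n)%N.
  move=> wn; rewrite -(ler_nat R) natrD; apply: le_trans wn; exact/ltW/omega_gt.
split=> wn.
- move=> G; rewrite conedD_iso //; split=> [maxG|[cG DG]].
    have GP := radius_lt_psi he (proj1 maxG) wn.
    have [|[DG _]|[_ PG]] := maximal_structure he hn maxG.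
    + by move=> PG; move: (lt_trans GP PG); rewrite ltxx.
    + by have [[cG _ _] _] := maxG.
    by move: (lt_le_trans GP PG); rewrite ltxx.
  split=> [|H HC]; first exact: conedD_in_C.
  by apply: (radius_le_D he HC cG DG); have := radius_lt_psi he HC wn; apply: ltW.
- have [nw nw'] : n%:R <= omega R e /\ omega R e <= n%:R by rewrite wn lexx.
  have nV := en nw'; have [V cV] := graph_V_coned nV; split.
    move=> /(conedV_iso _ nV)[_]; apply: conedD_not_conedV tk _ D; apply: tri_gt2.
    by case/andP: he.
  move=> G; rewrite conedD_iso // conedV_iso //; split=> [maxG|].
    have [[cG _ _] _] := maxG.
    by have [//|[DG _]|[VG _]] := maximal_structure he hn maxG; [left|right].
  case=> -[cG shG]; (split=> [|H HC]; first by [exact: conedD_in_C | exact: conedV_in_C]).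
    by have := radius_le_D he HC cG shG (radius_le_psi he HC nw).
  have HP := radius_le_psi he HC nw; apply: le_trans HP _.
  by have [ge _] := psi_le_radius_V R he cG shG; apply: ge.
have nV := en (ltW wn); have [V cV] := graph_V_coned nV.
move=> G; rewrite conedV_iso //; split=> [maxG|[cG VG]].
  have [[cG _ _] maxG'] := maxG.
  have [_ /(_ wn) PV] := psi_le_radius_V R he cV V.
  have PG := lt_le_trans PV (maxG' _ (graph_V_in_C nV)).
  have [//|[_ GP]|[VG _]] := maximal_structure he hn maxG; last by [].
  by move: (lt_le_trans PG GP); rewrite ltxx.
split=> [|H HC]; first exact: conedV_in_C.
have [PH|HP] := leP (psi R e) (spectral_radius R H); first by have := radius_le_V he HC cG VG PH.
apply: le_trans (ltW HP) _.
by have [ge _] := psi_le_radius_V R he cG VG; apply: ge; apply: ltW.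
Qed.
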